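(* Let $u \in C^0([0,+\infty[ ; L^\infty(\mathbb{R}^2;\mathbb{R}^2))$ be a Serfati solution of the Euler system on $\mathbb{R}^2$. Then, for all $t\ge0$ and all $\alpha < 1$, $$\left\| \chi(\lambda D) \big( u(t) - u(0) \big) \right\|_{L^\infty} = O \left( \frac{1}{\lambda^\alpha} \right) \qquad \text{as } \lambda \rightarrow + \infty.$$ In particular, $u$ is a bounded weak solution of the projected problem $\partial_tu+\mathbb{P}\,\mathrm{div}(u\otimes u)=0$ with initial value $u(0)$.
   Context: The space dimension is $d=2$. $D=-i\nabla$, and $\chi(\lambda D)$ is the Fourier multiplier with symbol $\chi(\lambda\xi)$, where $\chi$ is a fixed smooth radial function supported in $B(0,2)\subset\mathbb{R}^2$, equal to $1$ for $|\xi|\le1$ and radially non-increasing. For a matrix field $A$, $(\mathrm{div}\,A)_l=\sum_k\partial_kA_{kl}$. Write $x^\perp=(-x_2,x_1)$ and $\nabla^\perp=(-\partial_2,\partial_1)$. Serfati solution: a divergence-free $u\in C^0([0,+\infty[;L^\infty(\mathbb{R}^2))$ such that (i) $u$ and the vorticity $\omega=\partial_1u_2-\partial_2u_1$ are uniformly bounded: $\sup_{t\ge0}(\|u\|_{L^\infty}+\|\omega\|_{L^\infty})<+\infty$; (ii) $\partial_t\omega+u\cdot\nabla\omega=0$ in the sense of distributions; (iii) the Serfati identity holds: for every radial cut-off function $\theta\in\mathcal{D}(\mathbb{R}^2)$ with $\theta(x)=1$ around $x=0$, and all $t\ge0$, $$u(t)-u(0)=(\theta K)*\big(\omega(t)-\omega(0)\big)-\int_0^t\nabla\nabla^\perp\big((1-\theta)K\big)*(u\otimes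 u)\,ds,$$ where $K(x)=\frac{x^\perp}{2\pi|x|^2}$ is the Biot-Savart kernel and the last convolution contains an implicit contraction of the $2\times2$ matrices $\nabla\nabla^\perp$ and $u\otimes u$, i.e. its $i$-th component is $\sum_{k,l}\partial_k\nabla^\perp_l\big((1-\theta)K_i\big)*(u_ku_l)$. Leray projection: formally $\mathbb{P}=\mathrm{Id}+\nabla(-\Delta)^{-1}\mathrm{div}$. On bounded matrix fields, $(\mathbb{P}\,\mathrm{div} f)_l=\sum_k\partial_kf_{kl}+\sum_{j,k}\Gamma_{j,k,l}*f_{jk}$ with $\Gamma_{j,k,l}=\partial_j\partial_k\partial_lE$, where $E(x)=C\log|x|$ is the fundamental solution with $-\Delta E=\delta_0$; the convolution makes sense because $\Gamma_{j,k,l}$ is the sum of a compactly supported distribution and an $L^1$ function. $u$ is a bounded weak solution of the projected problem with initial datum $v_0\in L^\infty$ if $\partial_tu+\mathbb{P}\,\mathrm{div}(u\otimes u)=\delta_0(t)\otimes v_0(x)$ in $\mathcal{D}'([0,+\infty[\times\mathbb{R}^2)$, the dual of the space of smooth functions with compact support in $[0,+\infty[\times\mathbb{R}^2$ (not necessarily vanishing at $t=0$), with $\langle\delta_0(t)\otimes v_0(x),\phi\rangle=\int v_0\cdot\phi(0,x)\,dx$ and derivatives defined by duality. *)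

(* Defs.v *)
From HB Require Import structures.
From mathcomp Require Import all_boot all_order all_algebra.
From mathcomp Require Import all_classical all_reals all_analysis.
From mathcomp Require Import complex.

Set Implicit Arguments.
Unset Strict Implicit.
Unset Printing Implicit Defensive.

Import Order.TTheory GRing.Theory Num.Theory.
Import numFieldNormedType.Exports.

Local Open Scope classical_set_scope.
Local Open Scope ring_scope.
Local Open Scope complex_scope.

Section Calculus.
Context {R : realType} {V : normedModType R}.
Implicit Types (f : V -> R) (v x : V).

Definition iter_derive (s : seq V) f : V -> R :=
  foldr (fun v (g : V -> R) => 'D_v g) f s.

(* On a finite-dimensional V, this is C^oo: the iterated directional
   derivatives of all orders exist and are Frechet differentiable, hence
   continuous. *)
Definition smooth f := forall (s : seq V) x, differentiable (iter_derive s f) x.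

(* The space D(U), for U open. *)
Definition test_on (U : set V) f :=
  smooth f /\
  exists K : set V, [/\ compact K, K `<=` U & forall x, ~ K x -> f x = 0].

Definition test f := test_on setT f.

(* A distribution is represented by its action on test functions. *)
Definition dist := (V -> R) -> R.

Definition dderive v (T : dist) : dist := fun phi => - T ('D_v phi).

End Calculus.
Arguments dist R V : clear implicits.

Section Plane.
Context {R : realType}.

Implicit Types (x y : R * R) (f g phi : R * R -> R).

Definition leb2 :
    {measure set (measurableTypeR R * measurableTypeR R) -> \bar R} :=
  (@lebesgue_measure R \x @lebesgue_measure R)%E.

(* The indices 0 and 1 of 'I_2 stand for the directions 1 and 2 of R^2. *)
Definition cpnt (i : 'I_2) x : R := if i == 0 then x.1 else x.2.

Definition edir (i : 'I_2) : R * R := if i == 0 then (1, 0) else (0, 1).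

Definition partial (i : 'I_2) f : R * R -> R := 'D_(edir i) f.

Definition gradperp (i : 'I_2) f : R * R -> R :=
  if i == 0 then fun x => - partial 1 f x else partial 0 f.

Definition perp x : R * R := (- x.2, x.1).

Definition dot x y : R := x.1 * y.1 + x.2 * y.2.

(* The library's norm `|x| on R * R is the max norm. *)
Definition enorm x : R := Num.sqrt (dot x x).

Definition radial f := forall x y, enorm x = enorm y -> f x = f y.

Definition linf_norm (v : R * R -> R * R) : \bar R :=
  Lnorm leb2 +oo%E (fun x => (enorm (v x))%:E).

Definition linf_norms f : \bar R := Lnorm leb2 +oo%E (EFin \o f).

Definition in_linf (v : R * R -> R * R) :=
  measurable_fun setT v /\ (linf_norm v < +oo)%E.

Definition in_linfs f :=
  measurable_fun setT f /\ (linf_norms f < +oo)%E.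

(* C^0([0,+oo[; L^oo(R^2;R^2)); each u t is a chosen representative of its
   class. *)
Definition C0_linf (u : R -> R * R -> R * R) :=
  (forall t : R, 0 <= t -> in_linf (u t)) /\
  forall t0 : R, 0 <= t0 ->
    linf_norm (u t \- u t0) @[t --> within `[0, +oo[ (nbhs t0)] --> 0%E.

Definition convol f g x : R := \int[leb2]_y (f (x - y) * g y).

Definition fun_dist f : dist R (R * R)%type :=
  fun phi => \int[leb2]_x (f x * phi x).

Definition div_free (v : R * R -> R * R) :=
  forall phi, test phi ->
    \sum_(k < 2) dderive (edir k) (fun_dist (cpnt k \o v)) phi = 0.

Definition is_curl (v : R * R -> R * R) (w : R * R -> R) :=
  forall phi, test phi ->
    dderive (edir 0) (fun_dist (cpnt 1 \o v)) phi
    - dderive (edir 1) (fun_dist (cpnt 0 \o v)) phi = fun_dist w phi.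

(* Distributions on time-space R * (R * R), given by functions on
   [0,+oo[ x R^2.  The integrals are iterated: no joint measurability of the
   chosen representatives is needed. *)
Definition spacetime_dist (f : R -> R * R -> R) : dist R (R * (R * R))%type :=
  fun (phi : R * (R * R) -> R) => \int[@lebesgue_measure R]_(t in `[0, +oo[)
    fun_dist (f t) (fun x => phi (t, x)).

Definition dir_t : R * (R * R) := (1, 0).

Definition dir_x (k : 'I_2) : R * (R * R) := (0, edir k).

(* d_t w + u . grad w = 0 in D'(]0,+oo[ x R^2); as div u = 0, the product
   u . grad w is the distribution div (w u). *)
Definition vorticity_transport
    (u : R -> R * R -> R * R) (w : R -> R * R -> R) :=
  forall phi : R * (R * R) -> R, test_on [set p : R * (R * R) | 0 < p.1] phi ->
    dderive dir_t (spacetime_dist w) phi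
    + \sum_(k < 2) dderive (dir_x k)
        (spacetime_dist (fun t x => w t x * cpnt k (u t x))) phi = 0.

Definition cutoff (theta : R * R -> R) :=
  [/\ test theta, radial theta & \forall x \near (0 : R * R), theta x = 1].

(* The value at x = 0 is 0 by the convention 0^-1 = 0; it plays no role. *)
Definition biot_savart (i : 'I_2) x : R :=
  cpnt i (perp x) / (2 * pi * enorm x ^+ 2).

Definition tensor (v : R * R -> R * R) (k l : 'I_2) x : R :=
  cpnt k (v x) * cpnt l (v x).

Definition serfati_identity
    (u : R -> R * R -> R * R) (w : R -> R * R -> R) :=
  forall theta : R * R -> R, cutoff theta -> forall t : R, 0 <= t -> forall i : 'I_2,
    {ae leb2, forall x,
      cpnt i (u t x) - cpnt i (u 0 x) =
        convol (theta \* biot_savart i) (w t \- w 0) x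
        - \int[@lebesgue_measure R]_(s in `[0, t])
            \sum_(k < 2) \sum_(l < 2)
              convol (partial k (gradperp l
                      (fun y => (1 - theta y) * biot_savart i y)))
                   (tensor (u s) k l) x}.

Record serfati_with_vorticity
    (u : R -> R * R -> R * R) (w : R -> R * R -> R) : Prop := {
  serfati_C0 : C0_linf u ;
  serfati_div_free : forall t : R, 0 <= t -> div_free (u t) ;
  serfati_vorticity : forall t : R, 0 <= t -> in_linfs (w t) /\ is_curl (u t) (w t) ;
  serfati_bounded :
    (ereal_sup [set linf_norm (u t) + linf_norms (w t) | t in `[0%R, +oo[]
       < +oo)%E ;
  serfati_transport : vorticity_transport u w ;
  serfati_ident : serfati_identity u w }.

(* The vorticity w is determined a.e. by u. *)
Definition serfati_solution (u : R -> R * R -> R * R) :=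
  exists w : R -> R * R -> R, serfati_with_vorticity u w.

(* The fundamental solution: - Laplacian E = delta_0. *)
Definition fundsol x : R := - (2 * pi)^-1 * ln (enorm x).

(* Gamma_{j,k,l} * f for Gamma_{j,k,l} = d_j d_k d_l E and f bounded, through
   the splitting of Gamma into the compactly supported distribution
   d_j d_k d_l (theta E), with theta E in L^1, and the L^1 function
   d_j d_k d_l ((1 - theta) E).  The result does not depend on theta. *)
Definition gamma_conv (theta : R * R -> R) (j k l : 'I_2) f : dist R (R * R)%type :=
  fun phi =>
    dderive (edir j) (dderive (edir k) (dderive (edir l)
      (fun_dist (convol (theta \* fundsol) f)))) phi
    + fun_dist (convol (partial j (partial k (partial l
        (fun y => (1 - theta y) * fundsol y)))) f) phi.

Definition leray_div (theta : R * R -> R) (f : 'I_2 -> 'I_2 -> R * R -> R)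
    (l : 'I_2) : dist R (R * R)%type :=
  fun phi =>
    \sum_(k < 2) dderive (edir k) (fun_dist (f k l)) phi
    + \sum_(j < 2) \sum_(k < 2) gamma_conv theta j k l (f j k) phi.

(* Test functions on [0,+oo[ x R^2 are the restrictions of test functions on
   R x R^2; they may be nonzero at t = 0, whence the initial datum. *)
Definition bounded_weak_solution
    (v0 : R * R -> R * R) (u : R -> R * R -> R * R) :=
  [/\ in_linf v0,
      forall t : R, 0 <= t -> measurable_fun setT (u t),
      (ereal_sup [set linf_norm (u t) | t in `[0%R, +oo[] < +oo)%E &
      forall theta : R * R -> R, cutoff theta ->
      forall phi : 'I_2 -> R * (R * R) -> R, (forall l, test (phi l)) ->
        \sum_(l < 2)
          (dderive dir_t (spacetime_dist (fun t => cpnt l \o u t)) (phi l)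
           + \int[@lebesgue_measure R]_(t in `[0, +oo[)
               leray_div theta (tensor (u t)) l (fun x => phi l (t, x)))
        = \int[leb2]_x (\sum_(l < 2) cpnt l (v0 x) * phi l (0, x))].

Definition schwartz_real phi :=
  smooth phi /\
  forall (s : seq (R * R)) (n : nat),
    exists C : R, forall x, enorm x ^+ n * `|iter_derive s phi x| <= C.

Definition schwartz (phi : R * R -> R[i]) :=
  schwartz_real (fun x => complex.Re (phi x)) /\
  schwartz_real (fun x => complex.Im (phi x)).

Definition cintegral (f : R * R -> R[i]) : R[i] :=
  (\int[leb2]_x complex.Re (f x)) +i* (\int[leb2]_x complex.Im (f x)).

Definition expi (t : R) : R[i] := cos t +i* sin t.

Definition fourier (f : R * R -> R[i]) (xi : R * R) : R[i] :=
  cintegral (fun x => expi (- dot x xi) * f x).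

Definition inv_fourier (f : R * R -> R[i]) (x : R * R) : R[i] :=
  (((2 * pi) ^- 2)%:C) * cintegral (fun xi => expi (dot x xi) * f xi).

(* g = m(D) f, i.e. g = F^-1 (m F f) as tempered distributions:
   <g, phi> = <m F f, F^-1 phi> = <f, F (m F^-1 phi)>. *)
Definition is_fourier_multiplier
    (m : R * R -> R[i]) (f g : R * R -> R[i]) :=
  forall phi : R * R -> R[i], schwartz phi ->
    cintegral (fun x => g x * phi x) =
    cintegral (fun x => f x * fourier (fun xi => m xi * inv_fourier phi xi) x).

Definition lowpass_symbol (chi : R * R -> R) :=
  [/\ smooth chi,
      radial chi,
      forall x, 2 <= enorm x -> chi x = 0,
      forall x, enorm x <= 1 -> chi x = 1 &
      forall x y, enorm x <= enorm y -> chi y <= chi x].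

(* g = chi(lambda D) v in L^oo, componentwise; such a g is unique a.e. *)
Definition is_lowpass (chi : R * R -> R) (lambda : R)
    (v g : R * R -> R * R) :=
  in_linf g /\
  forall i : 'I_2, is_fourier_multiplier
    (fun xi => (chi (lambda *: xi))%:C)
    (fun x => (cpnt i (v x))%:C) (fun x => (cpnt i (g x))%:C).

End Plane.

(* Main.v *)
Require Import Defs.
From HB Require Import structures.
From mathcomp Require Import all_boot all_order all_algebra.
From mathcomp Require Import all_classical all_reals all_analysis.
From mathcomp Require Import measurable_realfun ess_sup_inf complex.
From mathcomp Require Import ring lra.

Set Implicit Arguments.
Unset Strict Implicit.
Unset Printing Implicit Defensive.

Import Order.TTheory GRing.Theory Num.Theory.
Import numFieldNormedType.Exports.

Local Open Scope classical_set_scope.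
Local Open Scope ring_scope.

(** The increment [u t - u 0] is read off the Serfati identity, whose two terms are
convolutions of bounded functions with two kernels: [theta K], compactly
supported with a [1/|x|] singularity, and the second derivatives of
[(1 - theta) K], smooth and of size [|x|^-3] at infinity, [K] being the
Biot-Savart kernel.

Low frequencies.  The symbol [chi] is itself an admissible cut-off, and
[chi (lam D)] is the convolution with [k_lam x = lam^-2 k (x / lam)], [k] being
the inverse Fourier transform of [chi]; this is Fubini's theorem, once
integrations by parts have shown that [k] decays faster than any power
([cosT_decay], [is_fourier_multiplier_convol]).  Both kernels [h] of the
identity are odd, hence of mean zero, so that in [k_lam * (h * f)] the kernel
[k_lam] may be replaced by its increments, whose [L^1] norm under a translation
by [y] is [O ((|y| / lam)^a)] ([cosT_modulus]).  This gives a bound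
[C lam^-a] times the moment of order [a] of [h] ([lowpass_error]).  For
[a < 1] this moment is finite, since [|x|^(a - 3)] is integrable at infinity in
the plane ([decay3_moment_L1]); at [a = 1] it diverges logarithmically, which is
where the restriction [alpha < 1] comes from.

Projected equation.  The cut-off in the identity may be shrunk to
[theta (x / e)].  The vorticity term is then [O (e)], because the mass of
[theta (x / e) K] is [e] times that of [theta K] ([cut_biot_savart_scale]),
while the flux term converges, against a test function, to the Leray
projection of the divergence of [u (x) u] ([convol_identity], [flux_leray]).
The algebra behind it is [d^perp_i d^perp_l = delta_il Laplacian - d_i d_l]
together with [- Laplacian E = delta_0] and [K = - nabla^perp E], which read, on a
test function [f],

  [int K_i d^perp_l f = - delta_il f 0 - int E d_i d_l f]

([biot_savart_fundsol]).  In the limit the time-integrated identity says that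
[u t] is [u 0] minus the integral over [0, t] of the projected divergence;
pairing with the time derivative of a test function and exchanging the order of
the integrals gives the weak formulation ([velocity_weak_equation]).

Two technical points recur.  Integrability over the plane is mostly obtained
from a product of two functions of one variable: [(1 + |x.1|)^-p (1 + |x.2|)^-p]
at infinity ([L1_le_weight]), and [|x.1|^(-1/2) |x.2|^(-1/2)] near a singularity
[1/|x|] ([L1_singular]).  Joint measurability in time and space, on which Fubini
rests, comes from continuity in time and measurability in space
([measurable_uncurry_continuous]): the fields themselves are continuous in time
only as elements of [L^oo], but their convolutions with an [L^1] kernel are so at
every point. *)

Local Notation L1 f := (leb2.-integrable setT (EFin \o f)).

(** The carrier [R] bears two measurable structures; these notations select the
    one on which the Lebesgue measure of the plane and of space-time live. *)
Local Notation meas2 f := (@measurable_fun _ _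
  (measurableTypeR _ * measurableTypeR _)%type (Real.sort _) setT f).
Local Notation meas3 f := (@measurable_fun _ _
  (measurableTypeR _ * (measurableTypeR _ * measurableTypeR _))%type (Real.sort _) setT f).

(** * Integration: domination, Fubini, similarities of the plane *)

Section MeasureGeneral.
Context d (T : measurableType d) (R : realType) (mu : {measure set T -> \bar R}).
Implicit Types f g h : T -> R.

Lemma integrable_measurable f :
  mu.-integrable setT (EFin \o f) -> measurable_fun setT f.
Proof. by move=> /measurable_int/measurable_EFinP. Qed.

Lemma integrable_dominated f g : mu.-integrable setT (EFin \o g) ->
  measurable_fun setT f -> (forall x, `|f x| <= g x) ->
  mu.-integrable setT (EFin \o f).
Proof.
move=> ig mf fg; apply: le_integrable ig => //.
  exact/measurable_EFinP.
by move=> x _ /=; rewrite lee_fin (le_trans (fg x))// ler_norm.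
Qed.

Lemma integrable_mul_bounded h f (B : R) :
  mu.-integrable setT (EFin \o h) -> measurable_fun setT f ->
  (forall x, `|f x| <= B) -> mu.-integrable setT (EFin \o (fun x => h x * f x)).
Proof.
move=> ih mf fB.
apply: (@integrable_dominated _ (fun x => B * `|h x|)).
- rewrite (_ : _ \o _ = (fun x => B%:E * (`|h x|%:E))%E); last by apply/funext => x /=; rewrite EFinM.
  by apply: integrableZl => //; exact: integrable_norm.
- by apply: measurable_funM => //; exact: integrable_measurable.
- by move=> x; rewrite normrM mulrC ler_wpM2r.
Qed.

Lemma integrable_bounded_mul h f (B : R) :
  mu.-integrable setT (EFin \o h) -> measurable_fun setT f ->
  (forall x, `|f x| <= B) -> mu.-integrable setT (EFin \o (fun x => f x * h x)).
Proof.
move=> ih mf fB; have := integrable_mul_bounded ih mf fB.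
by congr (mu.-integrable setT (EFin \o _)); apply/funext => x; rewrite mulrC.
Qed.

Lemma eq_Rintegral_ae f g : measurable_fun setT f -> measurable_fun setT g ->
  {ae mu, forall x, f x = g x} -> \int[mu]_x f x = \int[mu]_x g x.
Proof.
move=> mf mg fg; rewrite /Rintegral; congr fine; apply: ae_eq_integral => //.
- exact/measurable_EFinP.
- exact/measurable_EFinP.
- by apply: filterS fg => x -> _.
Qed.

End MeasureGeneral.

Lemma Rdominated_cvg (R : realType) d (T : measurableType d)
  (m : {measure set T -> \bar R}) (D : set T) (F : nat -> T -> R) (f g : T -> R) :
  measurable D -> (forall n, measurable_fun D (F n)) -> measurable_fun D f ->
  m.-integrable D (EFin \o g) ->
  {ae m, forall x, D x -> F n x @[n --> \oo] --> f x} ->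
  {ae m, forall x n, D x -> `|F n x| <= g x} ->
  \int[m]_(x in D) F n x @[n --> \oo] --> \int[m]_(x in D) f x.
Proof.
move=> mD mF mf ig cv le.
have [|||||iff _ cvI] := @dominated_convergence _ _ _ m D mD
  (fun n => EFin \o F n) (EFin \o f) (EFin \o g).
- by move=> n; apply/measurable_EFinP.
- by apply/measurable_EFinP.
- by apply: filterS cv => x h Dx; apply: cvg_EFin; [exact: nearW|exact: h].
- exact: ig.
- by apply: filterS le => x h n Dx; rewrite /= lee_fin; exact: h.
have fi : (\int[m]_(x in D) (f x)%:E \is a fin_num)%E by exact: integrable_fin_num.
by apply: fine_cvg; rewrite fineK.
Qed.

Lemma Rcvg_unique (R : realType) (u : nat -> R) (a b : R) :
  u n @[n --> \oo] --> a -> u n @[n --> \oo] --> b -> a = b.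
Proof. by move=> ua ub; rewrite -(cvg_lim (@Rhausdorff R) ua) (cvg_lim (@Rhausdorff R) ub). Qed.

Section FubiniReal.
Context d1 d2 (T1 : measurableType d1) (T2 : measurableType d2) (R : realType).
Variable m1 : {sigma_finite_measure set T1 -> \bar R}.
Variable m2 : {sigma_finite_measure set T2 -> \bar R}.
Variable F : T1 * T2 -> R.
Hypothesis iF : (m1 \x m2)%E.-integrable setT (EFin \o F).

Lemma measurable_Rfubini1 : measurable_fun setT (fun x => \int[m2]_y F (x, y)).
Proof.
by rewrite /Rintegral; apply: measurableT_comp => //; exact: measurable_fubini_F iF.
Qed.

Lemma measurable_Rfubini2 : measurable_fun setT (fun y => \int[m1]_x F (x, y)).
Proof.
by rewrite /Rintegral; apply: measurableT_comp => //; exact: measurable_fubini_G iF.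
Qed.

(** The inner integral of an integrable function may diverge on a null set, where
    [Rintegral] is 0 by convention. *)
Lemma Rfubini_ae1 :
  {ae m1, forall x, ((\int[m2]_y F (x, y))%:E = \int[m2]_y (F (x, y))%:E)%E}.
Proof.
have := integrable_ae measurableT (integrable_fubini_F iF).
apply: filterS => x /(_ I) fx; rewrite /Rintegral fineK//.
Qed.

End FubiniReal.

Lemma Rfubini d1 d2 (T1 : measurableType d1) (T2 : measurableType d2) (R : realType)
  (m1 : {sigma_finite_measure set T1 -> \bar R})
  (m2 : {sigma_finite_measure set T2 -> \bar R}) (F : T1 * T2 -> R) :
  (m1 \x m2)%E.-integrable setT (EFin \o F) ->
  \int[m1]_x \int[m2]_y F (x, y) = \int[m2]_y \int[m1]_x F (x, y).
Proof.
move=> iF; rewrite /Rintegral; congr fine.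
rewrite (_ : \int[m1]_x _ = \int[m1]_x fubini_F m2 (EFin \o F) x)%E; last first.
  apply: ae_eq_integral => //.
  - by apply/measurable_EFinP; exact: (measurable_Rfubini1 iF).
  - exact: (measurable_fubini_F iF).
  - have := Rfubini_ae1 iF; apply: filterS => x + _; exact.
rewrite (_ : \int[m2]_x _ = \int[m2]_x fubini_G m1 (EFin \o F) x)%E; last first.
  apply: ae_eq_integral => //.
  - by apply/measurable_EFinP; exact: (measurable_Rfubini2 iF).
  - exact: (measurable_fubini_G iF).
  - have := ae_integrable2 iF; apply: filterS => y iy _.
    by rewrite /Rintegral fineK//; exact: integrable_fin_num.
by rewrite [LHS](Fubini iF).
Qed.

Lemma Rfubini_integrable1 d1 d2 (T1 : measurableType d1) (T2 : measurableType d2) (R : realType)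
  (m1 : {sigma_finite_measure set T1 -> \bar R})
  (m2 : {sigma_finite_measure set T2 -> \bar R}) (F : T1 * T2 -> R) :
  (m1 \x m2)%E.-integrable setT (EFin \o F) ->
  m1.-integrable setT (EFin \o (fun x => \int[m2]_y F (x, y))).
Proof.
move=> iF; apply/integrableP; split.
  by apply/measurable_EFinP; exact: (measurable_Rfubini1 iF).
have /integrableP[_] := integrable_fubini_F iF; apply: le_lt_trans.
apply: ae_ge0_le_integral => //.
- by apply: measurableT_comp => //; apply/measurable_EFinP; exact: (measurable_Rfubini1 iF).
- by apply: measurableT_comp => //; exact: (measurable_fubini_F iF).
- by have := Rfubini_ae1 iF; apply: filterS => x xE _; rewrite [(EFin \o _) x]xE.
Qed.

(** Where the inner integral diverges its real version vanishes; elsewhere the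
    triangle inequality bounds it by the inner integral of the norm. *)
Lemma Rfubini_integrable2 d1 d2 (T1 : measurableType d1) (T2 : measurableType d2) (R : realType)
  (m1 : {sigma_finite_measure set T1 -> \bar R})
  (m2 : {sigma_finite_measure set T2 -> \bar R}) (F : T1 * T2 -> R) :
  (m1 \x m2)%E.-integrable setT (EFin \o F) ->
  m2.-integrable setT (EFin \o (fun y => \int[m1]_x F (x, y))).
Proof.
move=> iF; apply/integrableP; split.
  by apply/measurable_EFinP; exact: (measurable_Rfubini2 iF).
have mF : measurable_fun setT (EFin \o F) by case/integrableP : iF.
apply: le_lt_trans ((integrable21ltyP m1 m2 mF).1 iF).
have mA := measurableT_comp (abse_measurable (D := setT)) mF.
apply: ge0_le_integral => //.
- by apply: measurableT_comp => //; apply/measurable_EFinP; exact: (measurable_Rfubini2 iF).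
- exact: (@measurable_fun_fubini_tonelli_G _ _ _ _ _ m1 _ mA (fun p => abse_ge0 _)).
move=> y _; apply: (@le_trans _ _ `|\int[m1]_x (F (x, y))%:E|%E).
  by rewrite /= /Rintegral; case: (\int[m1]_x _)%E => [r| |]//=; rewrite normr0 leey.
apply: le_abse_integral => //.
exact: (measurableT_comp mF (measurable_pair2 y)).
Qed.

(** By Tonelli, joint integrability needs only an integrable bound for the inner
    integrals of the norm. *)
Lemma integrable_iterated d1 d2 (T1 : measurableType d1) (T2 : measurableType d2) (R : realType)
  (m1 : {sigma_finite_measure set T1 -> \bar R})
  (m2 : {sigma_finite_measure set T2 -> \bar R}) (F : T1 * T2 -> R) (G : T1 -> R) :
  measurable_fun setT F -> (forall x, m2.-integrable setT (EFin \o (fun y => F (x, y)))) ->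
  m1.-integrable setT (EFin \o G) -> (forall x, \int[m2]_y `|F (x, y)| <= G x) ->
  (m1 \x m2)%E.-integrable setT (EFin \o F).
Proof.
move=> mF iF iG FG.
have mF' := (measurable_EFinP _ _).2 mF.
apply/(integrable12ltyP m1 m2 mF').
have /integrableP[mG Goo] := iG; apply: le_lt_trans Goo.
have mA := measurableT_comp (abse_measurable (D := setT)) mF'.
apply: ge0_le_integral => //.
- by move=> x _; exact: integral_ge0.
- exact: (@measurable_fun_fubini_tonelli_F _ _ _ _ _ m2 _ mA (fun p => abse_ge0 _)).
- by apply: measurableT_comp.
move=> x _.
have ifx : m2.-integrable setT (EFin \o (fun y => `|F (x, y)|)).
  exact: integrable_abse (iF x).
apply: (@le_trans _ _ (\int[m2]_y `|F (x, y)|)%:E).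
  by rewrite /Rintegral fineK//; exact: integrable_fin_num.
by rewrite lee_fin (le_trans (FG x))// ler_norm.
Qed.

(** Rounding [s] down to a multiple of [1/(n+1)] leaves countably many slices,
    hence a measurable function, and continuity in [s] recovers the limit. *)
Lemma measurable_uncurry_continuous (R : realType) d (T : measurableType d) (F : R -> T -> R) :
  (forall x, continuous (F^~ x)) -> (forall s, measurable_fun setT (F s)) ->
  measurable_fun setT (fun p : measurableTypeR R * T => F p.1 p.2).
Proof.
move=> cF mF.
pose q (n : nat) (s : R) : R := (Num.floor (n.+1%:R * s))%:~R / n.+1%:R.
apply: (@measurable_fun_cvg _ _ _ _ (fun n p => F (q n p.1) p.2)).
- move=> n _ /= B mB; rewrite setTI.
  rewrite (_ : _ @^-1` _ = \bigcup_(z : int)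
     (((fun s : measurableTypeR R => Num.floor (n.+1%:R * s)) @^-1` [set z]) `*`
       (F (z%:~R / n.+1%:R) @^-1` B))).
    apply: countable_bigcupT_measurable => [|z]; first exact: countableP.
    apply: measurableX; last by rewrite -[X in measurable X]setTI; exact: mF.
    rewrite (_ : _ @^-1` _ = `[(z%:~R / n.+1%:R : R), ((z + 1)%:~R / n.+1%:R)[%classic).
      exact: measurable_itv.
    apply/seteqP; split => s /=; rewrite in_itv /= ler_pdivrMr// ltr_pdivlMr// (mulrC s).
      by move=> <-; exact: floor_itv.
    exact: floor_def.
  apply/seteqP; split => [[s x] /= Bx|[s x] /= [z _ [/= <-]]//].
  by exists (Num.floor (n.+1%:R * s)).
- move=> [s x] _ /=.
  apply: (continuous_cvg _ (cF x s)).
  apply/cvgrPdist_le => e e0; near=> n.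
  have /andP[h1 h2] := floor_itv (n.+1%:R * s).
  have n0 : 0 < n.+1%:R :> R by [].
  have qs : q n s <= s by rewrite /q ler_pdivrMr// (mulrC s).
  rewrite ger0_norm ?subr_ge0// /q lerBlDr -lerBlDl.
  apply: ltW; rewrite ltr_pdivlMr// mulrBl (mulrC s) ltrBlDr (lt_le_trans h2)//.
  rewrite intrD lerD2l -ler_pdivrMr// mul1r.
  by apply: ltW; near: n; exact: (near_infty_natSinv_lt (PosNum e0)).
Unshelve. all: by end_near. Qed.

Section AffineLine.
Context {R : realType}.
Notation mu := (@lebesgue_measure R).

(** Both sides are integrals for measures that agree on half-open intervals. *)
Lemma ge0_integral_affine1 (c b : R) (f : R -> \bar R) : c != 0 ->
  measurable_fun setT f -> (forall x, 0 <= f x)%E ->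
  (\int[mu]_x f x = `|c|%:E * \int[mu]_x f (c * x + b)%R)%E.
Proof.
move=> c0 mf f0.
have mphi : measurable_fun setT (fun x : R => c * x + b).
  by apply: measurable_funD => //; exact: mulrl_measurable.
pose phi : measurableTypeR R -> measurableTypeR R := fun x => c * x + b.
have [nu nuE nuint] : exists2 nu : {measure set (measurableTypeR R) -> \bar R},
    forall A, nu A = (`|c|%:E * mu (phi @^-1` A))%E &
    (\int[nu]_x f x = `|c|%:E * \int[mu]_x f (phi x))%E.
  unshelve refine (ex_intro2 _ _ (mscale (NngNum (normr_ge0 c))
    (pushforward mu phi : {measure set (measurableTypeR R) -> \bar R})
      : {measure set (measurableTypeR R) -> \bar R}) _ _) => //.
  by rewrite ge0_integral_mscale// ge0_integral_pushforward.
have E : forall A, measurable A -> mu A = nu A.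
  refine (@lebesgue_measure_unique R nu _) => _ [[x y] _ <-] /=.
  rewrite nuE lebesgue_measure_itv /=.
  have [xy|yx] := ltP x y; last first.
    rewrite lte_fin ltNge yx /= set_itv_ge; last by rewrite bnd_simp -leNgt.
    by rewrite preimage_set0 measure0 mule0.
  rewrite lte_fin xy.
  have [cp|cn] : c > 0 \/ c < 0 by move: c0; rewrite neq_lt orbC => /orP[]; [left|right].
  - rewrite (_ : _ @^-1` _ = `](x - b) / c, (y - b) / c]%classic); last first.
      by apply/seteqP; split => z /=; rewrite !in_itv /= ltr_pdivrMr// ler_pdivlMr// ltrBlDr lerBrDr (mulrC z).
    rewrite lebesgue_measure_itv /= lte_fin ltr_pM2r ?invr_gt0// ltrD2r xy gtr0_norm//.
    by rewrite -!EFinB -EFinM; congr EFin; field.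
  - rewrite (_ : _ @^-1` _ = `[(y - b) / c, (x - b) / c[%classic); last first.
      by apply/seteqP; split => z /=; rewrite !in_itv /= ler_ndivrMr// ltr_ndivlMr// ltrBlDr lerBrDr (mulrC z) andbC.
    rewrite lebesgue_measure_itv /= lte_fin ltr_nM2r ?invr_lt0// ltrD2r xy ltr0_norm//.
    by rewrite -!EFinB -EFinM; congr EFin; field.
rewrite (@eq_measure_integral _ _ _ setT nu mu f) => [|A mA _]; last exact: E.
exact: nuint.
Qed.

End AffineLine.

Section Plane.
Context {R : realType}.
Notation mu := (@lebesgue_measure R).
Implicit Types (f g h : R * R -> R) (x y : R * R).

Lemma ge0_leb2E1 (f : R * R -> \bar R) : measurable_fun setT f -> (forall x, 0 <= f x)%E ->
  (\int[leb2]_x f x = \int[mu]_x1 \int[mu]_x2 f (x1, x2))%E.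
Proof. by move=> mf f0; rewrite /leb2 fubini_tonelli1. Qed.

Lemma measurable_affine2 (c : R) (b : R * R) :
  @measurable_fun _ _ (measurableTypeR R * measurableTypeR R)%type
    (measurableTypeR R * measurableTypeR R)%type setT
    (fun x => (c *: (x : R * R) + b : R * R)).
Proof.
apply: measurable_fun_pair; apply: measurable_funD => //; exact: measurable_funM.
Qed.

(** Similarities of the plane act on the two coordinates separately, so the
    planar change of variables is the one of the line applied twice. *)
Lemma ge0_integral_affine2 (c : R) (b : R * R) (f : R * R -> \bar R) : c != 0 ->
  measurable_fun setT f -> (forall x, 0 <= f x)%E ->
  (\int[leb2]_x f x = (c ^+ 2)%:E * \int[leb2]_x f (c *: x + b)%R)%E.
Proof.
move=> c0 mf f0.
have mfa : measurable_fun setT (fun x => f (c *: x + b)).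
  by apply: measurableT_comp => //; exact: measurable_affine2.
rewrite !ge0_leb2E1//.
have mG : measurable_fun setT (fun x1 : R => \int[mu]_x2 f (x1, x2))%E.
  exact: (@measurable_fun_fubini_tonelli_F _ _ _ _ _ mu f mf f0).
have G0 (x1 : R) : (0 <= \int[mu]_x2 f (x1, x2))%E by exact: integral_ge0.
rewrite [LHS](ge0_integral_affine1 b.1 c0 mG G0).
have -> : ((c ^+ 2)%:E = `|c|%:E * `|c|%:E)%E.
  by rewrite -EFinM -expr2 real_normK// num_real.
rewrite -muleA; congr (_ * _)%E.
rewrite -ge0_integralZl//.
- apply: eq_integral => x1 _; rewrite (@ge0_integral_affine1 _ c b.2)//.
  by apply: measurableT_comp mf _; exact: pair1_measurable.
- by exact: (@measurable_fun_fubini_tonelli_F _ _ _ _ _ mu _ mfa (fun x => f0 _)).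
- by move=> x _; exact: integral_ge0.
Qed.

Lemma L1_affine (c : R) (b : R * R) f : c != 0 -> L1 f ->
  L1 (fun x => f (c *: x + b)).
Proof.
move=> c0 /integrableP[mf ff]; apply/integrableP; split.
  by apply: (measurableT_comp mf); exact: measurable_affine2.
have mf' : measurable_fun setT (fun x => `|(EFin \o f) x|)%E by exact: measurableT_comp.
have f0 (x : R * R) : (0 <= `|(EFin \o f) x|)%E by [].
move: ff; rewrite (ge0_integral_affine2 b c0 mf' f0).
set J := (X in (_ * X < _)%E -> _); move=> h.
have c2 : 0 < c ^+ 2 by rewrite exprn_even_gt0.
have [//|] := ltP J +oo%E; rewrite leye_eq => /eqP JE.
by move: h; rewrite JE gt0_muley ?lte_fin.
Qed.

Lemma Rintegral_affine2 (c : R) (b : R * R) f : c != 0 -> L1 f ->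
  \int[leb2]_x f x = c ^+ 2 * \int[leb2]_x f (c *: x + b).
Proof.
move=> c0 if_; have mf := integrable_measurable if_.
have ifa := L1_affine b c0 if_.
rewrite /Rintegral.
have E (g : R * R -> \bar R) : measurable_fun setT g -> (forall x, 0 <= g x)%E ->
   (\int[leb2]_x g x < +oo)%E ->
   fine (\int[leb2]_x g x) = c ^+ 2 * fine (\int[leb2]_x g (c *: x + b)%R).
  move=> mg g0 gf; rewrite (ge0_integral_affine2 b c0 mg g0).
  rewrite fineM// ge0_fin_numE ?integral_ge0//.
  move: gf; rewrite (ge0_integral_affine2 b c0 mg g0).
  set J := (X in (_ * X < _)%E -> _); move=> h.
  have c2 : 0 < c ^+ 2 by rewrite exprn_even_gt0.
  have [//|] := ltP J +oo%E; rewrite leye_eq => /eqP JE.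
  by move: h; rewrite JE gt0_muley ?lte_fin.
rewrite [in LHS]integralE [in RHS]integralE.
have [fp fn] := (integral_funepos_lt_pinfty measurableT if_, integral_funeneg_lt_pinfty measurableT if_).
have [fpa fna] := (integral_funepos_lt_pinfty measurableT ifa, integral_funeneg_lt_pinfty measurableT ifa).
have gefn (g : R * R -> \bar R) : (forall x, 0 <= g x)%E -> (\int[leb2]_x g x < +oo)%E ->
  (\int[leb2]_x g x)%E \is a fin_num by move=> g0 ?; rewrite ge0_fin_numE// integral_ge0.
have p0 (g : R * R -> \bar R) x : (0 <= g^\+ x)%E by exact: funepos_ge0.
have n0 (g : R * R -> \bar R) x : (0 <= g^\- x)%E by exact: funeneg_ge0.
rewrite (fineB (gefn _ (p0 _) fp) (gefn _ (n0 _) fn)).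
rewrite (fineB (gefn _ (p0 _) fpa) (gefn _ (n0 _) fna)) mulrBr.
have mF : measurable_fun setT (EFin \o f) by exact/measurable_EFinP.
congr (_ - _).
- rewrite (E _ (measurable_funepos mF) (p0 _) fp); congr (_ * fine _).
  by apply: eq_integral => x _; rewrite !funeposE.
- rewrite (E _ (measurable_funeneg mF) (n0 _) fn); congr (_ * fine _).
  by apply: eq_integral => x _; rewrite !funenegE.
Qed.

Lemma L1_shift f (b : R * R) : L1 f -> L1 (fun x => f (x + b)).
Proof.
move=> /(@L1_affine 1 b _ (oner_neq0 _)).
by under eq_fun do rewrite /= scale1r.
Qed.

Lemma Rintegral_shift f (b : R * R) : L1 f ->
  \int[leb2]_x f (x + b) = \int[leb2]_x f x.
Proof.
move=> /(@Rintegral_affine2 1 b _ (oner_neq0 _)) ->.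
by rewrite expr1n mul1r; under [in RHS]eq_Rintegral do rewrite scale1r.
Qed.

Lemma L1_reflect f (b : R * R) : L1 f -> L1 (fun x => f (b - x)).
Proof.
have N1 : (-1 : R) != 0 by rewrite oppr_eq0 oner_neq0.
move=> /(L1_affine b N1).
by under eq_fun do rewrite /= scaleN1r addrC.
Qed.

Lemma Rintegral_reflect f (b : R * R) : L1 f ->
  \int[leb2]_x f (b - x) = \int[leb2]_x f x.
Proof.
have N1 : (-1 : R) != 0 by rewrite oppr_eq0 oner_neq0.
move=> /(Rintegral_affine2 b N1) ->.
by rewrite sqrrN expr1n mul1r; under [in RHS]eq_Rintegral do rewrite scaleN1r addrC.
Qed.

Lemma Rintegral_odd f : L1 f -> (forall x, f (- x) = - f x) -> \int[leb2]_x f x = 0.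
Proof.
move=> if_ fN; have := Rintegral_reflect 0 if_.
under eq_Rintegral do rewrite sub0r fN -mulN1r.
by rewrite RintegralZl// mulN1r => h; lra.
Qed.

End Plane.

(** * Convolution of an integrable kernel with a bounded function *)

Section SigmaFinite.
Variable R : realType.

(** The Lebesgue measure of the plane again, carrying its sigma-finiteness so
    that Fubini applies to pairs of points of the plane. *)
Definition leb2s : set (measurableTypeR R * measurableTypeR R)%type -> \bar R :=
  @leb2 R.

Lemma leb2_sigma_finite : sigma_finite setT leb2s.
Proof.
have /sigma_finiteP[F [TF ndF Foo]] := sigma_finiteT (@lebesgue_measure R).
exists (fun n => F n `*` F n).
  rewrite -setXTT TF predeqE => -[x y]; split.
    move=> [/= [n _ Fnx] [k _ Gky]]; exists (maxn n k) => //; split.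
    - by move: x Fnx; exact/subsetPset/ndF/leq_maxl.
    - by move: y Gky; exact/subsetPset/ndF/leq_maxr.
  by move=> [n _ []/= ? ?]; split; exists n.
move=> k; have [? ?] := Foo k.
split; first exact: measurableX.
by rewrite /leb2s [X in (X < _)%E]product_measure1E// lte_mul_pinfty// ge0_fin_numE.
Qed.

HB.instance Definition _ := Measure.copy leb2s (@leb2 R).
HB.instance Definition _ :=
  Measure_isSigmaFinite.Build _ _ _ leb2s leb2_sigma_finite.

End SigmaFinite.
Arguments leb2s {R}.

(** The continuous functions [x / (x^2 + 1/(n+1))] converge to the inverse, even
    at 0 where the inverse is 0 by convention. *)
Lemma measurable_inv (R : realType) : measurable_fun setT (fun x : R => x^-1).
Proof.
pose F (n : nat) (x : R) := x / (x ^+ 2 + n.+1%:R^-1).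
have den (n : nat) (x : R) : 0 < x ^+ 2 + n.+1%:R^-1.
  by rewrite ltr_wpDl ?sqr_ge0// invr_gt0.
apply: (@measurable_fun_cvg _ _ _ setT F) => [n _|x _].
  have cF : continuous (F n); last exact: (continuous_measurable_fun cF).
  move=> x.
  apply: cvgM; first exact: cvg_id.
  apply: cvgV; first by rewrite gt_eqF.
  by apply: cvgD; [exact: exprn_continuous|exact: cvg_cst].
rewrite /F; have [->|x0] := eqVneq x 0.
  by rewrite invr0; under eq_fun do rewrite mul0r; exact: cvg_cst.
rewrite [X in _ --> X](_ : _ = x / (x ^+ 2 + 0)); last by rewrite addr0; field.
apply: cvgMr; apply: cvgV; first by rewrite addr0 sqrf_eq0.
by apply: cvgD; [exact: cvg_cst|exact: cvg_harmonic].
Qed.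

Lemma measurable_funV d (T : measurableType d) (R : realType) (D : set T) (f : T -> R) :
  measurable_fun D f -> measurable_fun D (fun x => (f x)^-1).
Proof. by move=> mf; exact: (measurableT_comp (@measurable_inv R) mf). Qed.

Section Convolution.
Context {R : realType}.
Notation mu := (@lebesgue_measure R).
Implicit Types (f g h phi : R * R -> R) (x y : R * R) (B : R).

Lemma L1D f g : L1 f -> L1 g -> L1 (fun x => f x + g x).
Proof. by move=> h1 h2; exact: (integrableD measurableT h1 h2). Qed.

Lemma L1Z (k : R) f : L1 f -> L1 (fun x => k * f x).
Proof. by move=> h1; exact: (integrableZl measurableT k h1). Qed.

Lemma L1N f : L1 f -> L1 (fun x => - f x).
Proof. by move=> h1; under eq_fun do rewrite -mulN1r; exact: L1Z. Qed.

Lemma L1B f g : L1 f -> L1 g -> L1 (fun x => f x - g x).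
Proof. by move=> h1 h2; apply: L1D => //; exact: L1N. Qed.

Lemma L1_norm f : L1 f -> L1 (fun x => `|f x|).
Proof. exact: integrable_norm. Qed.

Lemma L1_measurable f : L1 f -> meas2 f.
Proof. exact: integrable_measurable. Qed.

Lemma le_norm_Rintegral2 f g : L1 g -> meas2 f ->
  (forall x, `|f x| <= g x) -> `|\int[leb2]_x f x| <= \int[leb2]_x g x.
Proof.
move=> ig mf fg; have if_ := integrable_dominated ig mf fg.
apply: (le_trans (le_normr_Rintegral measurableT if_)).
by apply: le_Rintegral => //; exact: L1_norm.
Qed.

Lemma Rintegral_norm_ge0 f : 0 <= \int[leb2]_x `|f x|.
Proof. exact: Rintegral_ge0. Qed.

Lemma measurable_sub2 : @measurable_fun _ _
  ((measurableTypeR R * measurableTypeR R) * (measurableTypeR R * measurableTypeR R))%type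
  (measurableTypeR R * measurableTypeR R)%type setT
  (fun p : (R * R) * (R * R) => p.1 - p.2).
Proof.
apply: measurable_fun_pair; apply: measurable_funB => //; apply: measurableT_comp => //;
  exact: measurable_fst || exact: measurable_snd.
Qed.

Lemma convol_integrand_L1 h f B x : L1 h -> meas2 f ->
  (forall y, `|f y| <= B) -> L1 (fun y => h (x - y) * f y).
Proof.
by move=> ih mf fB; apply: (integrable_mul_bounded (L1_reflect x ih) mf fB).
Qed.

Lemma convol_bound h f B x : L1 h -> meas2 f ->
  (forall y, `|f y| <= B) -> `|convol h f x| <= B * \int[leb2]_y `|h y|.
Proof.
move=> ih mf fB; rewrite /convol -(Rintegral_reflect x (L1_norm ih)).
have ih' := L1_reflect x (L1_norm ih).
rewrite -RintegralZl//; apply: le_norm_Rintegral2.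
- exact: L1Z.
- by apply: measurable_funM => //; apply: L1_measurable; exact: L1_reflect.
- by move=> y; rewrite normrM mulrC ler_wpM2r.
Qed.

(** For fixed [x] the integral over [y] is at most [B |phi x|] times the mass of
    [h]. *)
Lemma convol_triple_integrable h f B phi : L1 h -> meas2 f ->
  (forall y, `|f y| <= B) -> L1 phi ->
  (leb2s \x leb2s)%E.-integrable setT
    (EFin \o (fun p : (R * R) * (R * R) => h (p.1 - p.2) * f p.2 * phi p.1)).
Proof.
move=> ih mf fB iphi.
have mh := L1_measurable ih; have mphi := L1_measurable iphi.
have B0 : 0 <= B := le_trans (normr_ge0 _) (fB 0).
have A0 : 0 <= B * \int[leb2]_y `|h y| by rewrite mulr_ge0// Rintegral_norm_ge0.
have mF : measurable_fun setT (fun p : (measurableTypeR R * measurableTypeR R) *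
    (measurableTypeR R * measurableTypeR R) => h (p.1 - p.2) * f p.2 * phi p.1).
  apply: measurable_funM; last exact: (measurableT_comp mphi measurable_fst).
  apply: measurable_funM; last exact: (measurableT_comp mf measurable_snd).
  exact: (measurableT_comp mh measurable_sub2).
have mF' := (measurable_EFinP _ _).2 mF.
apply/(integrable12ltyP leb2s leb2s mF').
have /integrableP[_ phioo] := iphi.
apply: (@le_lt_trans _ _ (\int[leb2]_x ((B * \int[leb2]_y `|h y|)%:E * `|(phi x)%:E|))%E); last first.
  rewrite ge0_integralZl ?lte_mul_pinfty//.
  by apply: measurableT_comp => //; exact/measurable_EFinP.
apply: ge0_le_integral => //.
- by move=> x _; exact: integral_ge0.
- have mA := measurableT_comp (abse_measurable (D := setT)) mF'.
  exact: (@measurable_fun_fubini_tonelli_F _ _ _ _ _ leb2s _ mA (fun p => abse_ge0 _)).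
- by apply: measurable_funeM; apply: measurableT_comp => //; exact/measurable_EFinP.
move=> x _.
have ihx := L1_norm (convol_integrand_L1 x ih mf fB).
have -> : (\int[leb2s]_y `|(EFin \o (fun p : (R * R) * (R * R) =>
      (h (p.1 - p.2) * f p.2 * phi p.1)%R)) (x, y)| =
    \int[leb2]_y (`|phi x|%:E * `|h (x - y) * f y|%:E))%E.
  by apply: eq_integral => y _; rewrite /= -EFinM normrM mulrC.
rewrite ge0_integralZl//; last by case/integrableP : ihx.
rewrite muleC lee_wpmul2r//.
have ? := integrable_fin_num measurableT ihx.
rewrite -[leLHS]fineK// lee_fin.
rewrite -(Rintegral_reflect x (L1_norm ih)) -RintegralZl//; last exact: (L1_reflect x (L1_norm ih)).
apply: le_Rintegral => //.
- exact: (L1Z B (L1_reflect x (L1_norm ih))).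
- by move=> y _; rewrite normrM mulrC ler_wpM2r.
Qed.

(** Fubini.  The kernel now faces the test function alone, so that identities
    between kernels need only be checked on test functions. *)
Lemma convol_transpose h f phi B P : L1 h -> meas2 f -> (forall y, `|f y| <= B) ->
  L1 phi -> (forall y, `|phi y| <= P) ->
  \int[leb2]_x (convol h f x * phi x) =
  \int[leb2]_y (f y * \int[leb2]_x (h (x - y) * phi x)).
Proof.
move=> ih mf fB iphi phiP.
have iF := convol_triple_integrable ih mf fB iphi.
have E := Rfubini iF; rewrite /= in E.
transitivity (\int[leb2]_x \int[leb2]_y (h (x - y) * f y * phi x)).
  apply: eq_Rintegral => x _; rewrite /convol -RintegralZr//.
  exact: (convol_integrand_L1 x ih mf fB).
rewrite [LHS]E; apply: eq_Rintegral => y _.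
have ihy := integrable_mul_bounded (L1_shift (- y) ih) (L1_measurable iphi) phiP.
rewrite -[RHS](RintegralZl _ measurableT ihy).
by apply: eq_Rintegral => x _; ring.
Qed.

Lemma convol_mul_L1 h f phi B : L1 h -> meas2 f -> (forall y, `|f y| <= B) ->
  L1 phi -> L1 (fun x => convol h f x * phi x).
Proof.
move=> ih mf fB iphi.
have := Rfubini_integrable1 (convol_triple_integrable ih mf fB iphi).
congr (is_true (leb2.-integrable _ _)); apply/funext => x /=.
congr EFin; rewrite /convol -RintegralZr//.
exact: (convol_integrand_L1 x ih mf fB).
Qed.

(** Dividing by a positive integrable weight reduces this to the measurability
    of the partial integrals of an integrable function. *)
Lemma convol_measurable h f B w : L1 w -> (forall x, 0 < w x) ->
  L1 h -> meas2 f -> (forall y, `|f y| <= B) -> meas2 (convol h f).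
Proof.
move=> iw w0 ih mf fB.
have := L1_measurable (convol_mul_L1 ih mf fB iw) => mhw.
rewrite (_ : convol h f = fun x => (convol h f x * w x) * (w x)^-1); last first.
  by apply/funext => x; rewrite -mulrA divff ?mulr1// gt_eqF.
apply: measurable_funM => //.
exact: measurable_funV (L1_measurable iw).
Qed.

Lemma convolDr h f g B B' : L1 h -> meas2 f -> (forall y, `|f y| <= B) ->
  meas2 g -> (forall y, `|g y| <= B') ->
  convol h (fun y => f y - g y) = fun x => convol h f x - convol h g x.
Proof.
move=> ih mf fB mg gB; apply/funext => x; rewrite /convol -RintegralB//.
- by apply: eq_Rintegral => y _; rewrite mulrBr.
- exact: (convol_integrand_L1 x ih mf fB).
- exact: (convol_integrand_L1 x ih mg gB).
Qed.

Lemma meas2_affine h (c : R) (b : R * R) : meas2 h -> meas2 (fun x => h (c *: x + b)).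
Proof. by move=> mh; exact: measurableT_comp mh (measurable_affine2 c b). Qed.

Lemma meas2_reflect h (b : R * R) : meas2 h -> meas2 (fun x => h (b - x)).
Proof. by move=> /(meas2_affine (-1) b); under eq_fun do rewrite scaleN1r addrC. Qed.

Lemma filterS_ae (P Q : R * R -> Prop) : (forall x, P x -> Q x) ->
  {ae leb2, forall x, P x} -> {ae leb2, forall x, Q x}.
Proof.
have FF := ae_filter_ringOfSetsType (@leb2 R).
move=> PQ; apply: (@filterS _ _ FF P Q PQ).
Qed.

(** This is what lets essentially bounded fields be replaced by everywhere
    bounded representatives. *)
Lemma convol_ae h f g : meas2 h -> meas2 f -> meas2 g ->
  {ae leb2, forall y, f y = g y} -> convol h f = convol h g.
Proof.
move=> mh mf mg fg; apply/funext => x; apply: eq_Rintegral_ae.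
- by apply: measurable_funM => //; exact: meas2_reflect.
- by apply: measurable_funM => //; exact: meas2_reflect.
- by apply: filterS_ae fg => y ->.
Qed.

End Convolution.

(** * Directional derivatives and functions of class C^n *)

Section Calculus.
Context {R : realType}.

(** Differentiability is local; it is used to transfer it between functions that
    agree on an open set. *)
Lemma near_eq_differentiable (V : normedModType R) (f g : V -> R) (x : V) :
  (\near x, f x = g x) -> differentiable f x -> differentiable g x.
Proof.
move=> fg df; have fgx : f x = g x by exact: nbhs_singleton fg.
have E : g \o shift x = cst (g x) + 'd f x +o_ 0 id.
  have := diff_locally df; move=> /eqaddoP fE; apply/eqaddoP => e e0.
  have := fE e e0; have : \forall y \near (0 : V), f (y + x) = g (y + x).
    by move: fg; rewrite (near_shift 0) /= subr0; apply: filterS => y.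
  apply: filterS2 => y fgy.
  by rewrite !fctE /= -fgx -fgy.
have cd : continuous ('d f x) by exact: diff_continuous.
by apply/diff_locallyP; rewrite (diff_unique cd E).
Qed.

Lemma derive_compose (U V : normedModType R) (a : U -> V) (f : V -> R) (x v : U) :
  differentiable a x -> differentiable f (a x) ->
  'D_v (f \o a) x = 'D_('D_v a x) f (a x).
Proof.
move=> da df; rewrite !deriveE//; last exact: differentiable_comp.
by rewrite diff_comp.
Qed.

Lemma deriveZdir (V : normedModType R) (f : V -> R) (c : R) (v x : V) :
  differentiable f x -> 'D_(c *: v) f x = c * 'D_v f x.
Proof. by move=> df; rewrite !deriveE// linearZ. Qed.

Lemma differentiable_affine (V : normedModType R) (c : R) (b x : V) :
  differentiable (fun x : V => c *: x + b) x.
Proof. by apply: differentiableD => //; apply: differentiableZ. Qed.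

Lemma derive_affine (V : normedModType R) (c : R) (b v x : V) :
  'D_v (fun x : V => c *: x + b) x = c *: v.
Proof.
rewrite (_ : (fun x : V => c *: x + b) = c *: (id : V -> V) + cst b); last by [].
by rewrite deriveD// deriveZ// derive_id derive_cst addr0.
Qed.

Lemma derive_comp_affine (V : normedModType R) (f : V -> R) (c : R) (b v x : V) :
  differentiable f (c *: x + b) ->
  'D_v (fun x => f (c *: x + b)) x = c * 'D_v f (c *: x + b).
Proof.
move=> df; have da := @differentiable_affine V c b x.
by rewrite (derive_compose v da df) derive_affine deriveZdir.
Qed.

Lemma iter_derive_affine (V : normedModType R) (f : V -> R) (c : R) (b : V) s :
  smooth f -> iter_derive s (fun x => f (c *: x + b)) =
              fun x => c ^+ size s * iter_derive s f (c *: x + b).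
Proof.
move=> sf; elim: s => [|v s IH] /=; first by apply/funext => x; rewrite mul1r.
rewrite IH; apply/funext => x.
rewrite [LHS](@deriveZ _ _ _ (fun x => iter_derive s f (c *: x + b)) (c ^+ size s)); last first.
  apply: diff_derivable; apply: (@differentiable_comp _ _ _ _ (fun x => c *: x + b)).
    exact: differentiable_affine.
  exact: sf.
by rewrite derive_comp_affine// [LHS]mulrA exprSr.
Qed.

Lemma smooth_affine (V : normedModType R) (f : V -> R) (c : R) (b : V) :
  smooth f -> smooth (fun x => f (c *: x + b)).
Proof.
move=> sf s x; rewrite iter_derive_affine//.
apply: differentiableZ.
apply: (@differentiable_comp _ _ _ _ (fun x => c *: x + b)); last exact: sf.
exact: differentiable_affine.
Qed.

Lemma derive_slice (U V : normedModType R) (f : U * V -> R) (t : U) (v x : V) :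
  differentiable f (t, x) -> 'D_v (fun x => f (t, x)) x = 'D_(0, v) f (t, x).
Proof.
move=> df.
have dp : is_diff x (fun x : V => (t, x)) (fun x => (0, x)).
  by apply: is_diff_eq.
rewrite (@derive_compose _ _ (fun x => (t, x)) f x v)//.
by rewrite (@deriveE _ _ _ (fun x : V => (t, x)))// diff_val.
Qed.

Lemma iter_derive_slice (U V : normedModType R) (f : U * V -> R) (t : U) s :
  smooth f -> iter_derive s (fun x => f (t, x)) =
              fun x => iter_derive [seq (0, v) | v <- s] f (t, x).
Proof.
move=> sf; elim: s => [//|v s IH] /=.
by rewrite IH; apply/funext => x; rewrite derive_slice.
Qed.

Lemma smooth_slice (U V : normedModType R) (f : U * V -> R) (t : U) :
  smooth f -> smooth (fun x => f (t, x)).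
Proof.
move=> sf s x; rewrite iter_derive_slice//.
by apply: (@differentiable_comp _ _ _ _ (fun x => (t, x))).
Qed.

(** The definition of [smooth] treats all sequences of directions at once, on the
    whole space; taking one derivative at a time, on a subset, allows closure
    under products, inverses and logarithms to be proved by induction. *)
Fixpoint Cn (V : normedModType R) (n : nat) (U : set V) (f : V -> R) : Prop :=
  (forall x, U x -> differentiable f x) /\
  if n is n'.+1 then forall v, Cn n' U ('D_v f) else True.

Section Cn.
Variable V : normedModType R.
Implicit Types (U : set V) (f g : V -> R).

Lemma CnSE n U f : Cn n.+1 U f <->
  (forall x, U x -> differentiable f x) /\ (forall v, Cn n U ('D_v f)).
Proof. by []. Qed.

Lemma Cn0E U f : Cn 0 U f <-> (forall x, U x -> differentiable f x).
Proof. by split=> [[]|]. Qed.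

Opaque Cn.

Lemma Cn_differentiable n U f x : Cn n U f -> U x -> differentiable f x.
Proof. by case: n => [/Cn0E|n /CnSE[]] df ; [exact: df|move=> _; exact: df]. Qed.

Lemma Cn_derive n U f v : Cn n.+1 U f -> Cn n U ('D_v f).
Proof. by move=> /CnSE[_]. Qed.

Lemma CnS n U f : Cn n.+1 U f -> Cn n U f.
Proof.
elim: n f => [|n IH] f /CnSE[df Df]; first exact/Cn0E.
by apply/CnSE; split=> // v; apply: IH.
Qed.

Lemma Cn_sub n U U' f : U' `<=` U -> Cn n U f -> Cn n U' f.
Proof.
move=> UU; elim: n f => [|n IH] f; first by move=> /Cn0E df; apply/Cn0E => x /UU/df.
by move=> /CnSE[df Df]; apply/CnSE; split=> [x /UU/df//|v]; exact: IH.
Qed.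

Lemma Cn_eq n U f g : open U -> (forall x, U x -> f x = g x) -> Cn n U f -> Cn n U g.
Proof.
move=> oU; have nU x : U x -> \forall y \near x, U y by move=> Ux; exact: open_nbhs_nbhs.
elim: n f g => [|n IH] f g fg.
  move=> /Cn0E df; apply/Cn0E => x Ux; apply: near_eq_differentiable (df _ Ux).
  by near=> y; apply: fg; near: y; exact: nU.
move=> /CnSE[df Df]; apply/CnSE; split=> [x Ux|v].
  apply: near_eq_differentiable (df _ Ux).
  by near=> y; apply: fg; near: y; exact: nU.
apply: (IH ('D_v f)) (Df v) => // x Ux; apply: near_eq_derive.
by near=> y; apply: fg; near: y; exact: nU.
Unshelve. all: by end_near. Qed.

Lemma CnD n U f g : open U -> Cn n U f -> Cn n U g -> Cn n U (fun x => f x + g x).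
Proof.
move=> oU; elim: n f g => [|n IH] f g.
  move=> /Cn0E df /Cn0E dg; apply/Cn0E => x Ux.
  by apply: differentiableD; [exact: df|exact: dg].
move=> /CnSE[df Df] /CnSE[dg Dg]; apply/CnSE; split=> [x Ux|v].
  by apply: differentiableD; [exact: df|exact: dg].
apply: (Cn_eq oU _ (IH _ _ (Df v) (Dg v))) => x Ux.
by rewrite [RHS](@deriveD _ _ _ f g)//; apply: diff_derivable; [exact: df|exact: dg].
Qed.

Lemma Cn_cst n U (c : R) : open U -> Cn n U (fun=> c).
Proof.
move=> oU; elim: n c => [|n IH] c.
  by apply/Cn0E => x _; exact: differentiable_cst.
apply/CnSE; split=> [x _|v]; first exact: differentiable_cst.
by apply: (Cn_eq oU _ (IH 0)) => x _; rewrite derive_cst.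
Qed.

Lemma CnM n U f g : open U -> Cn n U f -> Cn n U g -> Cn n U (fun x => f x * g x).
Proof.
move=> oU; elim: n f g => [|n IH] f g.
  move=> /Cn0E df /Cn0E dg; apply/Cn0E => x Ux.
  by apply: differentiableM; [exact: df|exact: dg].
move=> Cf Cg; have /CnSE[df Df] := Cf; have /CnSE[dg Dg] := Cg.
apply/CnSE; split=> [x Ux|v]; first by apply: differentiableM; [exact: df|exact: dg].
apply: (Cn_eq oU _ (CnD oU (IH _ _ (CnS Cf) (Dg v))
                          (IH _ _ (CnS Cg) (Df v)))) => x Ux.
by rewrite [RHS](@deriveM _ _ f g)//; apply: diff_derivable; [exact: df|exact: dg].
Qed.

Lemma CnZ n U f (c : R) : open U -> Cn n U f -> Cn n U (fun x => c * f x).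
Proof. by move=> oU; apply: CnM => //; exact: Cn_cst. Qed.

Lemma CnN n U f : open U -> Cn n U f -> Cn n U (fun x => - f x).
Proof.
by move=> oU /(CnZ (-1) oU); apply: Cn_eq => // x _; rewrite mulN1r.
Qed.

Lemma CnV n U f : open U -> (forall x, U x -> f x != 0) -> Cn n U f ->
  Cn n U (fun x => (f x)^-1).
Proof.
move=> oU f0 Cf0; have dV x : U x -> differentiable (fun x => (f x)^-1) x.
  by move=> Ux; apply: differentiableV; [exact: Cn_differentiable Cf0 Ux|exact: f0].
elim: n Cf0 => [|n IH] Cf; first exact/Cn0E.
apply/CnSE; split=> // v; have C1 := IH (CnS Cf).
apply: (Cn_eq oU _ (CnN oU (CnM oU (CnM oU C1 C1) (Cn_derive v Cf)))) => x Ux.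
rewrite [RHS](@deriveV _ _ f)//; [|exact: f0|by apply: diff_derivable; exact: Cn_differentiable Cf Ux].
by rewrite -expr2 exprVn [in RHS]scaleNr.
Qed.

Lemma Cn_ln n U f : open U -> (forall x, U x -> 0 < f x) -> Cn n U f ->
  Cn n U (fun x => ln (f x)).
Proof.
move=> oU f0 Cf.
have dln x : U x -> differentiable (fun x => ln (f x)) x.
  move=> Ux; apply: (@differentiable_comp _ _ _ _ f (@ln R)).
    exact: Cn_differentiable Cf Ux.
  by apply/derivable1_diffP; apply: ex_derive; exact: is_derive1_ln (f0 _ Ux).
case: n Cf => [|n] Cf; first exact/Cn0E.
apply/CnSE; split=> // v.
have fn0 x : U x -> f x != 0 by move=> /f0; rewrite lt0r => /andP[].
apply: (Cn_eq oU _ (CnM oU (CnV oU fn0 (CnS Cf)) (Cn_derive v Cf))) => x Ux.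
have df := Cn_differentiable Cf Ux.
have dl : differentiable (@ln R) (f x).
  by apply/derivable1_diffP; apply: ex_derive; exact: is_derive1_ln (f0 _ Ux).
rewrite [RHS](@derive_compose _ _ f (@ln R) x v)//.
have := @deriveZdir R (@ln R) ('D_v f x) 1 (f x) dl; rewrite [_ *: _]mulr1 => ->.
by rewrite (@derive_val _ _ _ _ _ _ _ (is_derive1_ln (f0 _ Ux))) mulrC.
Qed.

Lemma smooth_derive f v : smooth f -> smooth ('D_v f).
Proof. by move=> sf s x; have := sf (rcons s v) x; rewrite /iter_derive foldr_rcons. Qed.

Lemma smooth_Cn n f U : smooth f -> Cn n U f.
Proof.
elim: n f => [|n IH] f sf; first by apply/Cn0E => x _; exact: (sf [::]).
apply/CnSE; split=> [x _|v]; first exact: (sf [::]).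
exact/IH/smooth_derive.
Qed.

Lemma Cn_smooth f : (forall n, Cn n setT f) -> smooth f.
Proof.
move=> Cf s; elim/last_ind: s f Cf => [|s v IH] f Cf x.
  exact: (Cn_differentiable (Cf 0%N)).
by rewrite /iter_derive foldr_rcons; apply: IH => n; exact: Cn_derive (Cf n.+1).
Qed.

End Cn.
End Calculus.

(** * Integrable decay and integrable singularities *)

Section Line.
Context {R : realType}.
Notation mu := (@lebesgue_measure R).

(** Improper integrals are bounded through the compact intervals that exhaust
    the line. *)
Lemma ge0_integral_le_sets (F : nat -> set R) (f : R -> R) (C : \bar R) :
  {homo F : n m / (n <= m)%N >-> (n <= m)%O} -> (forall n, measurable (F n)) ->
  measurable_fun setT f -> (forall x, 0 <= f x) ->
  (forall n, \int[mu]_(x in F n) (f x)%:E <= C)%E ->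
  (\int[mu]_(x in \bigcup_n F n) (f x)%:E <= C)%E.
Proof.
move=> Fnd mF mf f0 FC.
have mf' n : measurable_fun (F n) (fun x => (f x)%:E).
  by apply: measurable_funTS; exact/measurable_EFinP.
have := @ge0_nondecreasing_set_cvg_integral _ (measurableTypeR R) R F (fun x => (f x)%:E) mu Fnd mF mf'.
move=> /(_ (fun _ _ _ => f0 _)) H.
rewrite -(cvg_lim (@ereal_hausdorff R) H); apply: lime_le.
  by apply/cvg_ex; eexists; exact: H.
by apply: nearW => n; exact: FC.
Qed.

Lemma derivable_FTC2 (f F : R -> R) (a b : R) : a < b ->
  (forall x, a <= x <= b -> is_derive x 1 F (f x)) ->
  (forall x, a <= x <= b -> {for x, continuous f}) ->
  (\int[mu]_(x in `[a, b]) (f x)%:E = (F b)%:E - (F a)%:E)%E.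
Proof.
move=> ab dF cf.
have cF x : a <= x <= b -> {for x, continuous F}.
  move=> /dF dFx; apply: differentiable_continuous; apply/derivable1_diffP.
  exact: ex_derive.
apply: continuous_FTC2 => //.
- apply: continuous_in_subspaceT => x /set_mem /=; rewrite in_itv /=; exact: cf.
- split.
  + move=> x; rewrite in_itv /= => /andP[ax xb].
    by apply: (@ex_derive _ _ _ _ _ _ _ (dF x _)); rewrite (ltW ax) (ltW xb).
  + by apply: cvg_at_right_filter; apply: cF; rewrite lexx ltW.
  + by apply: cvg_at_left_filter; apply: cF; rewrite lexx ltW.
- move=> x; rewrite in_itv /= => /andP[ax xb].
  by rewrite derive1E (@derive_val _ _ _ _ _ _ _ (dF x _))// (ltW ax) (ltW xb).
Qed.

Lemma integrable_symmetrized (g : R -> R) : measurable_fun setT g ->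
  (forall x, 0 <= g x) -> (\int[mu]_x (g x)%:E < +oo)%E ->
  mu.-integrable setT (EFin \o (fun t => g t + g (- t))).
Proof.
move=> mg g0 goo.
have mgN : measurable_fun setT (fun t : R => g (- t)) by exact: measurableT_comp.
apply: (@integrableD _ _ _ mu setT measurableT (EFin \o g) (EFin \o (fun t : R => g (- t)))).
  apply/integrableP; split; first exact/measurable_EFinP.
  by under eq_integral do rewrite /= ger0_norm//.
apply/integrableP; split; first exact/measurable_EFinP.
have N1 : (-1 : R) != 0 by rewrite oppr_eq0 oner_neq0.
have mg' : measurable_fun setT (fun x => (g x)%:E) by exact/measurable_EFinP.
have g0' x : (0 <= (g x)%:E)%E by rewrite lee_fin.
move: goo; rewrite (ge0_integral_affine1 0 N1 mg' g0') normrN1 mul1e.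
apply: le_lt_trans; rewrite le_eqVlt; apply/orP; left; apply/eqP.
by apply: eq_integral => x _; rewrite /= mulN1r addr0 ger0_norm.
Qed.

Definition tail (p t : R) : R := (1 + `|t|) `^ (- p).

Lemma tail_gt0 p t : 0 < tail p t.
Proof. by rewrite powR_gt0// ltr_pwDl. Qed.

Lemma measurable_tail p : measurable_fun setT (tail p).
Proof.
apply: (measurableT_comp (measurable_powR (- p))).
by apply: measurable_funD => //; exact: measurableT_comp.
Qed.

(** The integral over [0, n] is [(1 - (1 + n)^(1 - p)) / (p - 1)], below
    [1 / (p - 1)]. *)
Lemma integrable_tail p : 1 < p -> mu.-integrable setT (EFin \o tail p).
Proof.
move=> p1; have p0 : 0 < p - 1 by rewrite subr_gt0.
pose g (t : R) := if 0 <= t then tail p t else 0.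
have g0 x : 0 <= g x by rewrite /g; case: ifP => // _; exact/ltW/tail_gt0.
have mg : measurable_fun setT g.
  apply: measurable_fun_ifT => //; last exact: measurable_tail.
  exact: measurable_fun_ler.
have goo : (\int[mu]_x (g x)%:E < +oo)%E.
  have -> : (\int[mu]_x (g x)%:E =
      \int[mu]_(x in \bigcup_n `[0%R, n.+1%:R]%classic) (tail p x)%:E)%E.
    rewrite (_ : \bigcup_n _ = `[0%R, +oo[%classic); last first.
      apply/seteqP; split => x /=.
        by move=> [n _] /=; rewrite !in_itv /= => /andP[-> _].
      rewrite in_itv /= andbT => x0.
      exists (Num.truncn x) => //=; rewrite in_itv /= x0 /=.
      by apply: ltW; exact: truncnS_gt.
    rewrite [RHS]integral_mkcond; apply: eq_integral => x _.
    rewrite patchE /g mem_setE in_itv /= andbT; by case: ifP.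
  apply: (@le_lt_trans _ _ ((p - 1)^-1)%:E); last by rewrite ltry.
  apply: ge0_integral_le_sets => //.
  - move=> n m nm; apply/subsetPset => x /=; rewrite !in_itv /= => /andP[-> /le_trans]; apply.
    by rewrite ler_nat.
  - exact: measurable_tail.
  - by move=> x; exact/ltW/tail_gt0.
  move=> n.
  pose F (x : R) : R := - (p - 1)^-1 * (1 + x) `^ (1 - p).
  pose f (x : R) : R := (1 + x) `^ (- p).
  have dpow (q x : R) : 0 <= x -> is_derive x 1 (fun x => (1 + x) `^ q) (q * (1 + x) `^ (q - 1)).
    move=> x0; have x1 : 0 < 1 + x by rewrite ltr_pwDl.
    have d1 : is_derive x (1 : R) (fun x => 1 + x) 1.
      have := is_deriveD (is_derive_cst (1 : R) x 1) (is_derive_id x (1 : R)); rewrite add0r; exact.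
    have := is_derive1_comp (is_derive1_powR q x1) d1.
    by rewrite mulr1.
  have -> : (\int[mu]_(x in `[0%R, n.+1%:R]) (tail p x)%:E =
      \int[mu]_(x in `[0%R, n.+1%:R]) (f x)%:E)%E.
    apply: eq_integral => x /set_mem /=; rewrite in_itv /= /tail /f => /andP[x0 _].
    by rewrite ger0_norm.
  have ab : 0 < n.+1%:R :> R by [].
  have dF (x : R) : 0 <= x <= n.+1%:R -> is_derive x 1 F (f x).
    move=> /andP[x0 _]; have := dpow (1 - p) x x0 => d.
    apply: is_derive_eq.
    rewrite /f (_ : 1 - p - 1 = - p); last by ring.
    by rewrite [LHS]mulrA [X in X * _](_ : _ = 1) ?mul1r//; field; rewrite gt_eqF.
  have cf (x : R) : 0 <= x <= n.+1%:R -> {for x, continuous f}.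
    move=> /andP[x0 _]; apply: differentiable_continuous; apply/derivable1_diffP.
    exact: (@ex_derive _ _ _ _ _ _ _ (dpow (- p) x x0)).
  rewrite (derivable_FTC2 ab dF cf) -EFinB lee_fin /F addr0 powR1 mulr1 opprK mulNr.
  rewrite -[leRHS]add0r lerD2r oppr_le0 mulr_ge0// ?powR_ge0// invr_ge0 ltW//.
have := integrable_symmetrized mg g0 goo.
move=> /integrable_dominated; apply; first exact: measurable_tail.
move=> x; rewrite ger0_norm; last exact: ltW (tail_gt0 p x).
rewrite /g oppr_ge0 /tail normrN.
have [x0|x0] := leP 0 x; last by rewrite (ltW x0) add0r.
by rewrite lerDl; case: ifP => // _; exact: powR_ge0.
Qed.

Definition invsqrt (r t : R) : R := if `|t| <= r then `|t| `^ (- 2^-1) else 0.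

Lemma invsqrt_ge0 r t : 0 <= invsqrt r t.
Proof. by rewrite /invsqrt; case: ifP => // _; exact: powR_ge0. Qed.

Lemma measurable_invsqrt r : measurable_fun setT (invsqrt r).
Proof.
apply: measurable_fun_ifT => //.
  by apply: measurable_fun_ler => //; exact: measurableT_comp.
exact: (measurableT_comp (measurable_powR _) (@normr_measurable R setT)).
Qed.

Lemma integrable_invsqrt r : 0 < r -> mu.-integrable setT (EFin \o invsqrt r).
Proof.
move=> r0.
pose g (t : R) := if 0 < t then invsqrt r t else 0.
have g0 x : 0 <= g x by rewrite /g; case: ifP => // _; exact: invsqrt_ge0.
have mg : measurable_fun setT g.
  apply: measurable_fun_ifT => //; last exact: measurable_invsqrt.
  exact: measurable_fun_ltr.
have goo : (\int[mu]_x (g x)%:E < +oo)%E.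
  have -> : (\int[mu]_x (g x)%:E =
      \int[mu]_(x in \bigcup_n `[(r / n.+2%:R)%R, r]%classic) (invsqrt r x)%:E)%E.
    rewrite [RHS]integral_mkcond; apply: eq_integral => x _.
    rewrite patchE /g; case: ifPn => x0; case: ifPn => [/set_mem|/negP] //; rewrite ?inE.
    - move=> /= nx; rewrite /invsqrt; case: ifP => // xr; exfalso; apply: nx.
      rewrite gtr0_norm// in xr.
      exists (Num.truncn (r / x)) => //=; rewrite in_itv /= xr andbT.
      rewrite ler_pdivrMr// mulrC -ler_pdivrMr// ltW// (lt_le_trans (truncnS_gt _))//.
      by rewrite ler_nat.
    - move=> [n _] /=; rewrite in_itv /= => /andP[h _]; exfalso; move: x0.
      by rewrite (lt_le_trans _ h)// divr_gt0.
  apply: (@le_lt_trans _ _ (2 * r `^ 2^-1)%:E); last by rewrite ltry.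
  apply: ge0_integral_le_sets => //.
  - move=> n m nm; apply/subsetPset => x /=; rewrite !in_itv /= => /andP[+ ->]; rewrite andbT.
    by apply: le_trans; rewrite ler_pM2l// lef_pV2 ?posrE// ler_nat.
  - exact: measurable_invsqrt.
  - by move=> x; exact: invsqrt_ge0.
  move=> n.
  pose F (x : R) : R := 2 * x `^ 2^-1.
  pose f (x : R) : R := x `^ (- 2^-1).
  have a0 : 0 < r / n.+2%:R by rewrite divr_gt0.
  have -> : (\int[mu]_(x in `[(r / n.+2%:R)%R, r]) (invsqrt r x)%:E =
      \int[mu]_(x in `[(r / n.+2%:R)%R, r]) (f x)%:E)%E.
    apply: eq_integral => x /set_mem /=; rewrite in_itv /= /invsqrt /f => /andP[x0 xr].
    by rewrite ger0_norm ?xr// (le_trans (ltW a0)).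
  have ab : r / n.+2%:R < r by rewrite ltr_pdivrMr// ltr_pMr// ltr1n.
  have dF (x : R) : r / n.+2%:R <= x <= r -> is_derive x 1 F (f x).
    move=> /andP[x0 _]; have x1 := lt_le_trans a0 x0.
    have d := is_derive1_powR 2^-1 x1.
    apply: is_derive_eq.
    rewrite /f (_ : 2^-1 - 1 = - 2^-1); last by field.
    by rewrite [LHS]mulrA divff ?mul1r.
  have cf (x : R) : r / n.+2%:R <= x <= r -> {for x, continuous f}.
    move=> /andP[x0 _]; have x1 := lt_le_trans a0 x0.
    apply: differentiable_continuous; apply/derivable1_diffP.
    have d := is_derive1_powR (- 2^-1) x1; exact: (@ex_derive _ _ _ _ _ _ _ d).
  by rewrite (derivable_FTC2 ab dF cf) -EFinB lee_fin /F gerBl mulr_ge0// powR_ge0.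
have := integrable_symmetrized mg g0 goo.
move=> /integrable_dominated; apply; first exact: measurable_invsqrt.
move=> x; rewrite ger0_norm ?invsqrt_ge0// /g oppr_gt0 /invsqrt normrN.
have [x0|x0|<-] := ltgtP 0 x.
- by rewrite addr0.
- by rewrite add0r.
- by rewrite normr0 powR0 ?if_same ?addr0// oppr_eq0 invr_eq0 pnatr_eq0.
Qed.

End Line.

Section Plane.
Context {R : realType}.
Notation mu := (@lebesgue_measure R).
Implicit Types (f g : R * R -> R) (x y : R * R).

Lemma leb2_setX (A B : set (measurableTypeR R)) : measurable A -> measurable B ->
  (leb2 (A `*` B) = mu A * mu B)%E.
Proof. by move=> mA mB; exact: product_measure1E. Qed.

Lemma Rintegral_leb2_12 f : L1 f -> \int[leb2]_x f x = \int[mu]_a \int[mu]_b f (a, b).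
Proof.
move=> if_; have iF : (mu \x mu)%E.-integrable setT (EFin \o f) by [].
rewrite /Rintegral; congr fine.
rewrite -[LHS](integral12_prod_meas1 iF); apply: ae_eq_integral => //.
- exact: (measurable_fubini_F iF).
- by apply/measurable_EFinP; exact: (measurable_Rfubini1 iF).
- by have := Rfubini_ae1 iF; apply: filterS => a aE _; exact: esym aE.
Qed.

Lemma Rintegral_leb2_21 f : L1 f -> \int[leb2]_x f x = \int[mu]_b \int[mu]_a f (a, b).
Proof.
move=> if_; have iF : (mu \x mu)%E.-integrable setT (EFin \o f) by [].
by rewrite (Rintegral_leb2_12 if_) (Rfubini iF). Qed.

Lemma L1_prod (a b : R -> R) : mu.-integrable setT (EFin \o a) ->
  mu.-integrable setT (EFin \o b) -> L1 (fun x => a x.1 * b x.2).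
Proof.
move=> ia ib.
have [ma mb] := (integrable_measurable ia, integrable_measurable ib).
have mF : @measurable_fun _ _ (measurableTypeR R * measurableTypeR R)%type _ setT
    (EFin \o (fun x : R * R => a x.1 * b x.2)).
  apply/measurable_EFinP; apply: measurable_funM.
    exact: (measurableT_comp ma measurable_fst).
  exact: (measurableT_comp mb measurable_snd).
apply/(integrable12ltyP mu mu mF).
have /integrableP[_ aoo] := ia; have /integrableP[mb' boo] := ib.
have -> : (\int[mu]_x \int[mu]_y `|(EFin \o (fun x : R * R => (a x.1 * b x.2)%R)) (x, y)| =
    (\int[mu]_x `|(EFin \o a) x|) * (\int[mu]_x `|(EFin \o b) x|))%E.
  have ib0 : (0 <= \int[mu]_x `|(EFin \o b) x|)%E by exact: integral_ge0.
  rewrite -ge0_integralZr//; last first.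
    by apply: measurableT_comp => //; exact/measurable_EFinP.
  apply: eq_integral => x _; rewrite -ge0_integralZl//.
    by apply: eq_integral => y _ /=; rewrite -EFinM normrM.
  exact: measurableT_comp.
by rewrite lte_mul_pinfty ?integral_ge0// ge0_fin_numE ?integral_ge0.
Qed.

Lemma L1_ae_eq f g : L1 g -> meas2 f -> {ae leb2, forall x, f x = g x} -> L1 f.
Proof.
move=> /integrableP[mg goo] mf fg; apply/integrableP; split; first exact/measurable_EFinP.
apply: le_lt_trans goo; rewrite le_eqVlt; apply/orP; left; apply/eqP.
apply: ae_eq_integral => //.
- by apply: measurableT_comp => //; exact/measurable_EFinP.
- exact: measurableT_comp.
- by apply: filterS_ae fg => x /= -> _.
Qed.

(** A product of functions of one variable, so that its integrability over the
    plane follows from that of [tail] over the line. *)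
Definition weight (p : R) x : R := tail p x.1 * tail p x.2.

Lemma weight_gt0 p x : 0 < weight p x.
Proof. by rewrite mulr_gt0 ?tail_gt0. Qed.

Lemma L1_weight p : 1 < p -> L1 (weight p).
Proof. by move=> p1; apply: L1_prod; exact: integrable_tail. Qed.

Lemma L1_le_weight f p C : 1 < p -> meas2 f -> (forall x, `|f x| <= C * weight p x) -> L1 f.
Proof.
by move=> p1 mf fC; apply: (integrable_dominated (L1Z C (L1_weight p1)) mf fC).
Qed.

(** [|x|^-1] is locally integrable on the plane, because off the axes it is below
    [|x.1|^(-1/2) |x.2|^(-1/2)]. *)
Lemma L1_singular f (r C : R) : 0 < r -> meas2 f -> (forall x, r < `|x| -> f x = 0) ->
  (forall x, x != 0 -> `|f x| <= C / `|x|) -> L1 f.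
Proof.
move=> r0 mf fr fC.
(* The product bound holds off the axes, which form a null set. *)
pose f0 x := if (x.1 != 0) && (x.2 != 0) then f x else 0.
have mfst : @measurable_fun _ _ (measurableTypeR R * measurableTypeR R)%type R setT fst.
  exact: measurable_fst.
have msnd : @measurable_fun _ _ (measurableTypeR R * measurableTypeR R)%type R setT snd.
  exact: measurable_snd.
have mf0 : meas2 f0.
  apply: measurable_fun_ifT => //; apply: measurable_and.
  - by apply: measurable_neg; apply: measurable_fun_eqr.
  - by apply: measurable_neg; apply: measurable_fun_eqr.
have f0bound x : `|f0 x| <= C * (invsqrt r x.1 * invsqrt r x.2).
  have C0 : 0 <= C.
    have := fC (1, 0); rewrite -pair_eqE /= oner_eq0 /= => /(_ isT) /(le_trans (normr_ge0 _)).
    by rewrite pmulr_lge0// invr_gt0 normr_gt0 -pair_eqE /= oner_eq0.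
  have R0 : 0 <= C * (invsqrt r x.1 * invsqrt r x.2) by rewrite !mulr_ge0 ?invsqrt_ge0.
  rewrite /f0; case: ifP => [/andP[x1 x2]|_]; last by rewrite normr0.
  have [rx|xr] := ltP r `|x|; first by rewrite fr// normr0.
  have xN0 : x != 0 by rewrite -pair_eqE /= (negbTE x1).
  apply: (le_trans (fC _ xN0)); apply: ler_wpM2l => //.
  have n1 : `|x.1| <= `|x| by rewrite prod_normE le_max lexx.
  have n2 : `|x.2| <= `|x| by rewrite prod_normE le_max lexx orbT.
  rewrite /invsqrt (le_trans n1 xr) (le_trans n2 xr) -powRM//.
  have p1 : 0 < `|x.1| by rewrite normr_gt0.
  have p2 : 0 < `|x.2| by rewrite normr_gt0.
  have p0 : 0 < `|x| by rewrite normr_gt0.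
  rewrite powRN lef_pV2 ?posrE ?powR_gt0 ?mulr_gt0//.
  rewrite powR12_sqrt; last by rewrite mulr_ge0.
  rewrite -[leRHS](ger0_norm (ltW p0)) -(sqrtr_sqr `|x|).
  by apply: ler_wsqrtr; rewrite expr2 ler_pM.
have if0 : L1 f0.
  apply: (integrable_dominated _ mf0 f0bound); apply: L1Z; apply: L1_prod;
    exact: integrable_invsqrt.
apply: (L1_ae_eq if0 mf).
exists (([set 0] `*` setT) `|` (setT `*` [set 0])); split.
- by apply: measurableU; apply: measurableX => //; exact: measurable_set1.
- apply/eqP; rewrite -measure_le0 (le_trans (measureU2 _ _ _))//.
  + by apply: measurableX => //; exact: measurable_set1.
  + by apply: measurableX => //; exact: measurable_set1.
  + rewrite [X in (X + _)%E](leb2_setX (measurable_set1 0) measurableT).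
    rewrite [X in (_ + X)%E](leb2_setX measurableT (measurable_set1 0)).
    by rewrite lebesgue_measure_set1 mul0e mule0 adde0.
- move=> [a b] /=; rewrite /f0 /=.
  have [->|a0] := eqVneq a 0; first by move=> _; left.
  have [->|b0] := eqVneq b 0; first by move=> _; right.
  by [].
Qed.

End Plane.

(** * Integration by parts against compactly supported functions *)

Section TestFunctions.
Context {R : realType}.
Notation mu := (@lebesgue_measure R).
Implicit Types (f g : R * R -> R) (x y : R * R).

Lemma continuous_slice1 f (b : R) : continuous f -> continuous (fun a => f (a, b)).
Proof.
move=> cf a; have cp : {for a, continuous (fun a : R => (a, b))}.
  have dp : is_diff a (fun a : R => (a, b)) (fun h => (h, 0)) by apply: is_diff_eq.
  exact/differentiable_continuous/(@ex_diff _ _ _ _ _ _ _ dp).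
exact: (continuous_comp cp (cf _)).
Qed.

Lemma continuous_slice2 f (a : R) : continuous f -> continuous (fun b => f (a, b)).
Proof.
move=> cf b; have cp : {for b, continuous (fun b : R => (a, b))}.
  have dp : is_diff b (fun b : R => (a, b)) (fun h => (0, h)) by apply: is_diff_eq.
  exact/differentiable_continuous/(@ex_diff _ _ _ _ _ _ _ dp).
exact: (continuous_comp cp (cf _)).
Qed.

Lemma continuous_meas2 f : continuous f -> meas2 f.
Proof.
move=> cf; rewrite (_ : f = fun p => f (p.1, p.2)); last by apply/funext => -[].
apply: (@measurable_uncurry_continuous R _ (measurableTypeR R) (fun a b => f (a, b))).
- by move=> b; exact: continuous_slice1.
- by move=> a; apply: continuous_measurable_fun; exact: continuous_slice2.
Qed.

Lemma smooth_continuous (V : normedModType R) (f : V -> R) : smooth f -> continuous f.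
Proof. by move=> sf x; apply: differentiable_continuous; exact: (sf [::]). Qed.

Lemma Cn_continuous (V : normedModType R) n (f : V -> R) : Cn n setT f -> continuous f.
Proof. by move=> Cf x; apply: differentiable_continuous; exact: Cn_differentiable Cf I. Qed.

(** Supports are bounded by balls of the norm rather than by compact sets: this
    is stable under derivatives, and the radius enters later estimates. *)
Definition supp_in (V : normedModType R) (r : R) (f : V -> R) :=
  forall x : V, r < `|x| -> f x = 0.

Lemma supp_in_derive (V : normedModType R) (r : R) (f : V -> R) (v : V) :
  supp_in r f -> supp_in r ('D_v f).
Proof.
move=> fr x rx; rewrite (@near_eq_derive _ _ _ _ (cst 0)) ?derive_cst//.
have : \forall y \near x, r < `|y|.
  by apply: (cvgr_gt `|x|) => //; apply: cvg_norm; exact: cvg_id.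
by apply: filterS => y; exact: fr.
Qed.

Lemma supp_inM (V : normedModType R) (r : R) (f g : V -> R) :
  supp_in r f -> supp_in r (fun x : V => f x * g x).
Proof. by move=> fr x /fr ->; rewrite mul0r. Qed.

Lemma supp_inMr (V : normedModType R) (r : R) (f g : V -> R) :
  supp_in r f -> supp_in r (fun x : V => g x * f x).
Proof. by move=> fr x /fr ->; rewrite mulr0. Qed.

Lemma test_supp (V : normedModType R) (f : V -> R) : test f ->
  smooth f /\ exists2 r : R, 0 < r & supp_in r f.
Proof.
move=> [sf [K [cK _ fK]]]; split=> //.
have [M [_ KM]] := compact_bounded cK.
exists (`|M| + 1); first by rewrite ltr_wpDl.
move=> x Mx; apply: fK => Kx.
have MM : M < `|M| + 1 by rewrite (le_lt_trans (ler_norm M))// ltrDl.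
by have /= := KM _ MM x Kx; rewrite leNgt Mx.
Qed.

Lemma compact_box (r : R) : compact [set x : R * R | `|x| <= r].
Proof.
have -> : [set x : R * R | `|x| <= r] = `[- r, r]%classic `*` `[- r, r]%classic.
  apply/seteqP; split => -[a b] /=; rewrite prod_normE ge_max !ler_norml !in_itv /=.
    by move=> /andP[].
  by move=> [-> ->].
by apply: compact_setX; exact: segment_compact.
Qed.

Lemma test_of_supp f (r : R) : smooth f -> supp_in r f -> test f.
Proof.
move=> sf fr; split=> //; exists [set x : R * R | `|x| <= r]; split=> //.
  exact: compact_box.
by move=> x /negP; rewrite -ltNge; exact: fr.
Qed.

Lemma continuous_bounded_box f (r : R) : continuous f ->
  exists2 C : R, 0 < C & forall x, `|x| <= r -> `|f x| <= C.
Proof.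
move=> cf; have [r0|r0] := leP 0 r; last first.
  by exists 1 => // x xr; have := lt_le_trans r0 (normr_ge0 x); rewrite ltNge xr.
have [c _ fc] : exists2 c : R * R, c \in [set x : R * R | `|x| <= r] &
    forall t, t \in [set x : R * R | `|x| <= r] -> `|f t| <= `|f c|.
  apply: (@compact_EVT_max _ _ (fun x => `|f x|)).
  - by exists 0; rewrite /= normr0.
  - exact: compact_box.
  - by apply: continuous_subspaceT => x; apply: cvg_norm; exact: cf.
exists (`|f c| + 1); first by rewrite ltr_wpDl.
by move=> x xr; rewrite (le_trans (fc x _)) ?inE// lerDl.
Qed.

Lemma weight_ge (p r : R) x : 0 <= p -> `|x| <= r -> ((1 + r) `^ (- p)) ^+ 2 <= weight p x.
Proof.
move=> p0; rewrite prod_normE ge_max => /andP[x1 x2].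
have r0 : 0 <= r by exact: le_trans x1.
have H (t : R) : `|t| <= r -> (1 + r) `^ (- p) <= tail p t.
  move=> tr; rewrite /tail !powRN lef_pV2 ?posrE ?powR_gt0 ?ltr_pwDl//.
  by rewrite ge0_ler_powR ?nnegrE ?addr_ge0// lerD2l.
by rewrite expr2 ler_pM ?H ?powR_ge0.
Qed.

Lemma supp_le_weight f (r p : R) : 0 <= p -> continuous f -> supp_in r f ->
  exists2 C : R, 0 < C & forall x, `|f x| <= C * weight p x.
Proof.
move=> p0 cf fr; have [C C0 fC] := continuous_bounded_box r cf.
pose w := ((1 + `|r|) `^ (- p)) ^+ 2.
have w0 : 0 < w by rewrite exprn_gt0// powR_gt0// ltr_pwDl.
exists (C / w); first exact: divr_gt0.
move=> x; have [xr|rx] := leP `|x| r; last first.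
  by rewrite fr// normr0 mulr_ge0 ?ltW ?weight_gt0 ?divr_gt0.
apply: (le_trans (fC _ xr)); rewrite mulrAC ler_pdivlMr// ler_wpM2l//; first exact: ltW.
by apply: weight_ge => //; exact: le_trans xr (ler_norm r).
Qed.

Lemma supp_L1 f (r : R) : continuous f -> supp_in r f -> L1 f.
Proof.
move=> cf fr; have [C _ fC] := @supp_le_weight f r 2 (ler0n _ _) cf fr.
by apply: (@L1_le_weight _ f 2 C) => //; [exact: ltr1n|exact: continuous_meas2].
Qed.

Lemma supp_bounded f (r : R) : continuous f -> supp_in r f ->
  exists2 C : R, 0 < C & forall x, `|f x| <= C.
Proof.
move=> cf fr; have [C C0 fC] := continuous_bounded_box r cf; exists C => // x.
by have [/fC//|rx] := leP `|x| r; rewrite fr// normr0 ltW.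
Qed.

Lemma derive_line1 f (a b : R) : differentiable f (a, b) ->
  is_derive a 1 (fun a => f (a, b)) (partial 0 f (a, b)).
Proof.
move=> df; have dp : is_diff a (fun a : R => (a, b)) (fun h => (h, 0)).
  by apply: is_diff_eq.
have dc : differentiable (fun a : R => f (a, b)) a.
  by apply: (@differentiable_comp _ _ _ _ (fun a => (a, b))).
apply: DeriveDef; first by apply: diff_derivable.
have dp' := @ex_diff _ _ _ _ _ _ _ dp.
by rewrite (derive_compose (1 : R) dp' df) (deriveE (1 : R) dp') (@diff_val _ _ _ _ _ _ _ dp).
Qed.

Lemma derive_line2 f (a b : R) : differentiable f (a, b) ->
  is_derive b 1 (fun b => f (a, b)) (partial 1 f (a, b)).
Proof.
move=> df; have dp : is_diff b (fun b : R => (a, b)) (fun h => (0, h)).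
  by apply: is_diff_eq.
have dc : differentiable (fun b : R => f (a, b)) b.
  by apply: (@differentiable_comp _ _ _ _ (fun b => (a, b))).
apply: DeriveDef; first by apply: diff_derivable.
have dp' := @ex_diff _ _ _ _ _ _ _ dp.
by rewrite (derive_compose (1 : R) dp' df) (deriveE (1 : R) dp') (@diff_val _ _ _ _ _ _ _ dp).
Qed.

Lemma Rintegral_line_derive0 (F f : R -> R) (r : R) : 0 < r ->
  (forall t : R, is_derive t 1 F (f t)) -> continuous f ->
  (forall t : R, r < `|t| -> F t = 0) -> (forall t : R, r < `|t| -> f t = 0) ->
  \int[mu]_t f t = 0.
Proof.
move=> r0 dF cf F0 f0.
have -> : \int[mu]_t f t = \int[mu]_(t in `[- (r + 1), r + 1]) f t.
  rewrite [RHS]Rintegral_mkcond; apply: eq_Rintegral => t _; rewrite patchE.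
  case: ifPn => // /negP tr; apply: f0; rewrite ltNge; apply/negP => h; apply: tr.
  by rewrite inE /= in_itv /= -ler_norml (le_trans h)// lerDl.
have rr : - (r + 1) < r + 1 by lra.
rewrite /Rintegral (derivable_FTC2 rr (fun t _ => dF t) (fun t _ => cf t)).
by rewrite !F0 ?subee// ?normrN gtr0_norm; lra.
Qed.

Lemma Rintegral_eq0 d (T : measurableType d) (m : {measure set T -> \bar R}) (F : T -> R) :
  (forall x : T, F x = 0) -> \int[m]_x F x = 0.
Proof.
move=> F0; rewrite (_ : F = fun=> 0); last exact/funext.
by rewrite Rintegral_cst ?mul0r.
Qed.

(** On each line in the direction of the derivative the integral vanishes by the
    fundamental theorem of calculus. *)
Lemma Rintegral_partial i f (r : R) : 0 < r -> Cn 1 setT f -> supp_in r f ->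
  \int[leb2]_x partial i f x = 0.
Proof.
move=> r0 Cf fr.
have cpf : continuous (partial i f) := Cn_continuous (Cn_derive _ Cf).
have pfr : supp_in r (partial i f) := supp_in_derive (edir i) fr.
have iL := supp_L1 cpf pfr.
have le1 (a b : R) : `|a| <= `|(a, b)| by rewrite prod_normE le_max lexx.
have le2 (a b : R) : `|b| <= `|(a, b)| by rewrite prod_normE le_max lexx orbT.
have df (x : R * R) : differentiable f x := Cn_differentiable Cf I.
have [i0|i0] := eqVneq i 0.
  rewrite i0 in iL cpf pfr *; rewrite Rintegral_leb2_21//.
  apply: Rintegral_eq0 => b.
  apply: (@Rintegral_line_derive0 (fun a => f (a, b)) _ r r0).
  - by move=> a; exact: derive_line1.
  - exact: continuous_slice1.
  - by move=> a ra; apply: fr; exact: lt_le_trans (le1 a b).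
  - by move=> a ra; apply: pfr; exact: lt_le_trans (le1 a b).
have {}i0 : i = 1 by move: i0; case: i iL cpf pfr => -[//|[|//]] ? *; exact/val_inj.
rewrite i0 in iL cpf pfr *; rewrite Rintegral_leb2_12//.
apply: Rintegral_eq0 => a.
apply: (@Rintegral_line_derive0 (fun b => f (a, b)) _ r r0).
- by move=> b; exact: derive_line2.
- exact: continuous_slice2.
- by move=> b rb; apply: fr; exact: lt_le_trans (le2 a b).
- by move=> b rb; apply: pfr; exact: lt_le_trans (le2 a b).
Qed.

Lemma Rintegral_parts i f g (r : R) : 0 < r -> Cn 1 setT f -> Cn 1 setT g -> supp_in r g ->
  \int[leb2]_x (partial i f x * g x) = - \int[leb2]_x (f x * partial i g x).
Proof.
move=> r0 Cf Cg gr.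
have C1 := CnM openT Cf Cg.
have := @Rintegral_partial i (fun x => f x * g x) r r0 C1 (supp_inMr _ gr).
have -> : partial i (fun x => f x * g x) = fun x => partial i f x * g x + f x * partial i g x.
  apply/funext => x.
  rewrite /partial [LHS](@deriveM _ _ f g)//.
  - by rewrite addrC; congr (_ + _); rewrite [LHS]mulrC.
  - by apply: diff_derivable; exact: Cn_differentiable Cf I.
  - by apply: diff_derivable; exact: Cn_differentiable Cg I.
have cf := Cn_continuous Cf; have cg := Cn_continuous Cg.
have cpf := Cn_continuous (Cn_derive (edir i) Cf).
have cpg := Cn_continuous (Cn_derive (edir i) Cg).
rewrite RintegralD//.
- by move=> /eqP; rewrite addr_eq0 => /eqP.
- apply: (@supp_L1 _ r); last exact: supp_inMr.
  by move=> x; apply: cvgM; [exact: cpf|exact: cg].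
- apply: (@supp_L1 _ r); last by apply: supp_inMr; exact: supp_in_derive.
  by move=> x; apply: cvgM; [exact: cf|exact: cpg].
Qed.

End TestFunctions.

(** * The Biot-Savart kernel, the fundamental solution and their cut-offs *)

Section Kernels.
Context {R : realType}.
Implicit Types (f g G : R * R -> R) (x y v w : R * R).

Let proj1 : R * R -> R^o := fst.
Let proj2 : R * R -> R^o := snd.

Let proj1_linear : linear proj1. Proof. by []. Qed.
Let proj2_linear : linear proj2. Proof. by []. Qed.

HB.instance Definition _ := GRing.isLinear.Build R (R * R)%type R^o *:%R proj1 proj1_linear.
HB.instance Definition _ := GRing.isLinear.Build R (R * R)%type R^o *:%R proj2 proj2_linear.

Lemma is_diff_fst x : is_diff x (fst : R * R -> R) fst.
Proof.
have c1 : continuous proj1 by move=> y; exact: cvg_fst.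
have d1 := @linear_differentiable R _ _ proj1 x c1.
by apply: DiffDef; [exact: d1|exact: (@diff_lin R _ _ proj1 x c1)].
Qed.

Lemma is_diff_snd x : is_diff x (snd : R * R -> R) snd.
Proof.
have c1 : continuous proj2 by move=> y; exact: cvg_snd.
have d1 := @linear_differentiable R _ _ proj2 x c1.
by apply: DiffDef; [exact: d1|exact: (@diff_lin R _ _ proj2 x c1)].
Qed.

Lemma differentiable_fst x : differentiable (fst : R * R -> R) x.
Proof. exact: (@ex_diff _ _ _ _ _ _ _ (is_diff_fst x)). Qed.

Lemma differentiable_snd x : differentiable (snd : R * R -> R) x.
Proof. exact: (@ex_diff _ _ _ _ _ _ _ (is_diff_snd x)). Qed.

Lemma derive_fst v x : 'D_v (fst : R * R -> R) x = v.1.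
Proof. by rewrite (deriveE v (differentiable_fst x)) (@diff_val _ _ _ _ _ _ _ (is_diff_fst x)). Qed.

Lemma derive_snd v x : 'D_v (snd : R * R -> R) x = v.2.
Proof. by rewrite (deriveE v (differentiable_snd x)) (@diff_val _ _ _ _ _ _ _ (is_diff_snd x)). Qed.

Lemma Cn_fst n : Cn n setT (fst : R * R -> R).
Proof.
case: n => [|n]; first by apply/Cn0E => x _; exact: differentiable_fst.
apply/CnSE; split=> [x _|v]; first exact: differentiable_fst.
by apply: (Cn_eq openT _ (Cn_cst n v.1 openT)) => x _; rewrite derive_fst.
Qed.

Lemma Cn_snd n : Cn n setT (snd : R * R -> R).
Proof.
case: n => [|n]; first by apply/Cn0E => x _; exact: differentiable_snd.
apply/CnSE; split=> [x _|v]; first exact: differentiable_snd.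
by apply: (Cn_eq openT _ (Cn_cst n v.2 openT)) => x _; rewrite derive_snd.
Qed.

(** The square of the Euclidean norm is polynomial, hence smooth at the origin as
    well. *)
Definition sqn x : R := x.1 ^+ 2 + x.2 ^+ 2.

Lemma sqn_ge0 x : 0 <= sqn x.
Proof. by rewrite addr_ge0// sqr_ge0. Qed.

Lemma sqn_gt0 x : x != 0 -> 0 < sqn x.
Proof.
case: x => a b; rewrite -pair_eqE /= negb_and /sqn /= => /orP[] h.
  by rewrite ltr_pwDl ?sqr_ge0// exprn_even_gt0.
by rewrite ltr_wpDl ?sqr_ge0// exprn_even_gt0.
Qed.

Lemma sqnZ (c : R) x : sqn (c *: x) = c ^+ 2 * sqn x.
Proof. by rewrite /sqn /= !exprMn mulrDr. Qed.

Lemma enorm_sqr x : enorm x ^+ 2 = sqn x.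
Proof. by rewrite /enorm sqr_sqrtr /dot -!expr2//; exact: sqn_ge0. Qed.

Lemma enormE x : enorm x = Num.sqrt (sqn x).
Proof. by rewrite /enorm /dot -!expr2. Qed.

Lemma enormZ (c : R) x : enorm (c *: x) = `|c| * enorm x.
Proof. by rewrite !enormE sqnZ sqrtrM ?sqr_ge0// sqrtr_sqr. Qed.

Lemma norm_fst_le x : `|x.1| <= `|x|.
Proof. by rewrite prod_normE le_max lexx. Qed.

Lemma norm_snd_le x : `|x.2| <= `|x|.
Proof. by rewrite prod_normE le_max lexx orbT. Qed.

Lemma norm_le_enorm x : `|x| <= enorm x.
Proof.
rewrite prod_normE ge_max enormE -!sqrtr_sqr !ler_wsqrtr//.
  by rewrite lerDr sqr_ge0.
by rewrite lerDl sqr_ge0.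
Qed.

Lemma enorm_le_norm x : enorm x <= 2 * `|x|.
Proof.
rewrite enormE -[leRHS]ger0_norm ?mulr_ge0// -sqrtr_sqr ler_wsqrtr//.
have h1 := norm_fst_le x; have h2 := norm_snd_le x.
rewrite /sqn -(real_normK (num_real x.1)) -(real_normK (num_real x.2)).
have := normr_ge0 x.1; have := normr_ge0 x.2; nra.
Qed.

Lemma sqn_ge_norm x : `|x| ^+ 2 <= sqn x.
Proof. by rewrite -enorm_sqr lerXn2r ?nnegrE ?norm_le_enorm// enormE sqrtr_ge0. Qed.

Lemma enorm_gt0 x : x != 0 -> 0 < enorm x.
Proof. by move=> x0; rewrite enormE sqrtr_gt0 sqn_gt0. Qed.

Definition punctured : set (R * R) := [set x | x != 0].

Lemma open_punctured : open punctured.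
Proof.
rewrite (_ : punctured = [set x : R * R | 0 < `|x|]); last first.
  by apply/seteqP; split => x /=; rewrite /punctured /= normr_gt0.
apply: (@open_comp _ _ (fun x : R * R => `|x|) [set t | 0 < t]); last exact: open_gt.
by move=> x _; exact: norm_continuous.
Qed.

Lemma biot_savartE i x : biot_savart i x = (2 * pi)^-1 * cpnt i (perp x) * (sqn x)^-1.
Proof. by rewrite /biot_savart enorm_sqr invfM mulrCA mulrA. Qed.

Lemma fundsolE x : fundsol x = - (4 * pi)^-1 * ln (sqn x).
Proof.
rewrite /fundsol enormE.
have [->|x0] := eqVneq (sqn x) 0; first by rewrite sqrtr0 ln0// ?mulr0.
have q0 : 0 < sqn x by rewrite lt_neqAle eq_sym x0 sqn_ge0.
have -> : ln (sqn x) = 2 * ln (Num.sqrt (sqn x)).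
  by rewrite -{1}(sqr_sqrtr (ltW q0)) lnXn ?sqrtr_gt0// mulr_natl.
have p0 : (pi : R) != 0 by rewrite gt_eqF// pi_gt0.
by move: (pi : R) p0 => p p0; rewrite mulrA; congr (_ * _); field.
Qed.

Lemma Cn_sqn n : Cn n setT sqn.
Proof.
apply: CnD; [exact: openT| |]; [rewrite (_ : (fun x => _) = fun x => x.1 * x.1)|
  rewrite (_ : (fun x => _) = fun x => x.2 * x.2)]; try (by apply/funext => x; rewrite expr2).
- by apply: CnM; [exact: openT|exact: Cn_fst|exact: Cn_fst].
- by apply: CnM; [exact: openT|exact: Cn_snd|exact: Cn_snd].
Qed.

Lemma Cn_cpnt_perp n i : Cn n setT (fun x : R * R => cpnt i (perp x)).
Proof.
rewrite /cpnt; case: (i == 0) => /=; last exact: Cn_fst.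
by apply: CnN; [exact: openT|exact: Cn_snd].
Qed.

Lemma Cn_biot_savart n i : Cn n punctured (biot_savart i).
Proof.
have oU := open_punctured.
apply: (Cn_eq oU (fun x _ => esym (biot_savartE i x))).
apply: CnM => //; first by apply: CnZ => //; exact: Cn_sub (Cn_cpnt_perp n i).
apply: CnV => //; first by move=> x /sqn_gt0/lt0r_neq0.
exact: Cn_sub (Cn_sqn n).
Qed.

Lemma Cn_fundsol n : Cn n punctured fundsol.
Proof.
have oU := open_punctured.
apply: (Cn_eq oU (fun x _ => esym (fundsolE x))).
apply: CnZ => //; apply: Cn_ln => //; first by move=> x /sqn_gt0.
exact: Cn_sub (Cn_sqn n).
Qed.

Lemma biot_savartZ i (c : R) x : c != 0 -> biot_savart i (c *: x) = c^-1 * biot_savart i x.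
Proof.
move=> c0; rewrite !biot_savartE sqnZ.
have -> : cpnt i (perp (c *: x)) = c * cpnt i (perp x).
  by rewrite /cpnt /perp /=; case: ifP => _ //=; rewrite mulrN.
have [->|q0] := eqVneq (sqn x) 0; first by rewrite mulr0 invr0 !mulr0.
have p0 : (pi : R) != 0 by rewrite gt_eqF// pi_gt0.
by move: (pi : R) p0 => p p0; field; rewrite ?c0 ?q0 ?p0.
Qed.

Lemma fundsolZ (c : R) x : c != 0 -> x != 0 ->
  fundsol (c *: x) = fundsol x - (2 * pi)^-1 * ln `|c|.
Proof.
move=> c0 x0; rewrite /fundsol enormZ lnM ?posrE ?normr_gt0// ?enorm_gt0//.
by rewrite mulrDr addrC mulNr mulNr.
Qed.

Lemma punctured_scale (c : R) x : c != 0 -> punctured x -> punctured (c *: x).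
Proof. by rewrite /punctured /= scaler_eq0 negb_or => -> ->. Qed.

(** Each derivative lowers the degree of homogeneity by one; an additive
    constant, as for the logarithm, disappears. *)
Lemma derive_homogeneous G (k : R -> R) (e : R -> R) v :
  Cn 0 punctured G ->
  (forall c x, c != 0 -> punctured x -> G (c *: x) = e c * G x + k c) ->
  forall c x, c != 0 -> punctured x -> 'D_v G (c *: x) = c^-1 * e c * 'D_v G x + 0.
Proof.
move=> CG GZ c x c0 x0.
have dG y : punctured y -> differentiable G y := Cn_differentiable CG.
have E : 'D_v (fun x => G (c *: x + 0)) x = e c * 'D_v G x.
  rewrite (@near_eq_derive _ _ _ _ (fun x => e c * G x + k c)); last first.
    have : \forall y \near x, punctured y by apply: open_nbhs_nbhs; split => //; exact: open_punctured.
    by apply: filterS => y y0; rewrite addr0 GZ.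
  have dGx := diff_derivable (v := v) (dG _ x0).
  rewrite [LHS](deriveD (derivableZ (k := e c) dGx) (derivable_cst (k c) x v)) derive_cst addr0.
  exact: deriveZ.
rewrite derive_comp_affine ?addr0 in E; last by apply: dG; exact: punctured_scale.
by rewrite addr0 -mulrA -E mulKf.
Qed.

(** Scaling to the unit sphere of the max norm, which is compact. *)
Lemma homogeneous_bound g : (forall x, punctured x -> {for x, continuous g}) ->
  (forall (c : R) x, c != 0 -> punctured x -> g (c *: x) = c ^- 3 * g x) ->
  exists2 C : R, 0 < C & forall x, punctured x -> `|g x| <= C / `|x| ^+ 3.
Proof.
move=> cg gZ; pose S := [set x : R * R | `|x| = 1].
have cS : compact S.
  apply: (@subclosed_compact _ _ [set x : R * R | `|x| <= 1]).
  - apply: (@closed_comp _ _ (fun x : R * R => `|x|) [set t | t = 1]).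
      by move=> x _; exact: norm_continuous.
    exact: closed_eq.
  - exact: compact_box.
  - by move=> x; rewrite /S /= => ->.
have S1 : S (1, 0) by rewrite /S /= prod_normE normr1 normr0; apply/max_idPl.
have Sp x : S x -> punctured x.
  by rewrite /S /punctured /= => x1; rewrite -normr_gt0 x1.
have [c _ gc] : exists2 c : R * R, c \in S & forall t, t \in S -> `|g t| <= `|g c|.
  apply: (@compact_EVT_max _ _ (fun x => `|g x|)) => //; first by exists (1, 0).
  apply: continuous_in_subspaceT => x /set_mem Sx.
  by apply: cvg_norm; apply: cg; exact: Sp.
exists (`|g c| + 1); first by rewrite ltr_wpDl.
move=> x x0; have nx0 : 0 < `|x| by rewrite normr_gt0.
have nx : `|x| != 0 by rewrite gt_eqF.
pose y := `|x|^-1 *: x.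
have Sy : S y by rewrite /S /y /= normrZ ger0_norm ?invr_ge0// mulVf.
have xy : x = `|x| *: y by rewrite /y scalerA divff// scale1r.
rewrite {1}xy gZ//; last exact: Sp.
have n3 : 0 <= `|x| ^- 3 by rewrite invr_ge0 exprn_ge0.
rewrite normrM mulrC (ger0_norm n3).
rewrite ler_wpM2r ?invr_ge0 ?exprn_ge0//.
by rewrite (le_trans (gc _ _)) ?lerDl// inE.
Qed.

Lemma CnU (U U' : set (R * R)) n f : Cn n U f -> Cn n U' f -> Cn n (U `|` U') f.
Proof.
elim: n f => [|n IH] f.
  by move=> /Cn0E h /Cn0E h'; apply/Cn0E => x [/h|/h'].
move=> /CnSE[h H] /CnSE[h' H']; apply/CnSE; split=> [x [/h|/h']//|v].
by apply: IH.
Qed.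

Lemma derive_eq_open (U : set (R * R)) f g v : open U -> (forall x, U x -> f x = g x) ->
  forall x, U x -> 'D_v f x = 'D_v g x.
Proof.
move=> oU fg x Ux; apply: near_eq_derive.
have : \forall y \near x, U y by apply: open_nbhs_nbhs.
by apply: filterS => y /fg.
Qed.

Lemma open_outside (r : R) : open [set x : R * R | r < `|x|].
Proof.
apply: (@open_comp _ _ (fun x : R * R => `|x|) [set t | r < t]); last exact: open_gt.
by move=> x _; exact: norm_continuous.
Qed.

(** Near the origin the product vanishes, whatever the singularity of [G]; away
    from it both factors are regular. *)
Lemma Cn_cut theta G n : cutoff theta -> Cn n punctured G ->
  Cn n setT (fun x => (1 - theta x) * G x).
Proof.
move=> [[st _] _ t1] CG.
have [e /= e0 te] : exists2 e : R, 0 < e & forall x, `|x| < e -> theta x = 1.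
  move/nbhs_ballP : t1 => [e /= e0 be]; exists e => // x xe; apply: be.
  by rewrite -ball_normE /= sub0r normrN.
have oV : open [set x : R * R | `|x| < e].
  apply: (@open_comp _ _ (fun x : R * R => `|x|) [set t | t < e]); last exact: open_lt.
  by move=> x _; exact: norm_continuous.
rewrite (_ : setT = [set x : R * R | `|x| < e] `|` punctured); last first.
  apply/esym/seteqP; split=> // x _ /=; have [->|x0] := eqVneq x 0.
    by left; rewrite normr0.
  by right; exact: x0.
apply: CnU.
  by apply: (Cn_eq oV _ (Cn_cst n 0 oV)) => x /te ->; rewrite subrr mul0r.
have oU := open_punctured.
apply: CnM => //; apply: CnD => //; first exact: Cn_cst.
by apply: CnN => //; exact: smooth_Cn.
Qed.

Lemma cutoff_supp theta : cutoff theta -> exists2 r : R, 0 < r & supp_in r theta.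
Proof. by move=> [/test_supp[_ h] _ _]. Qed.

(** The decay of the derivatives of order two of [K] and of order three of [E];
    in the plane it is integrable with room to spare. *)
Definition decay3 g := exists2 C : R, 0 < C & forall x, `|g x| <= C * (1 + `|x|) ^- 3.

(** Homogeneity of degree -3 controls the function at infinity, continuity on
    the remaining compact set. *)
Lemma decay3_of_homogeneous g h (r : R) : continuous g ->
  (forall x, punctured x -> {for x, continuous h}) ->
  (forall (c : R) x, c != 0 -> punctured x -> h (c *: x) = c ^- 3 * h x) ->
  (forall x, r < `|x| -> g x = h x) -> decay3 g.
Proof.
move=> cg ch hZ gh.
have [C C0 hC] := homogeneous_bound ch hZ.
have [C' C'0 gC] := continuous_bounded_box (Num.max r 1) cg.
pose m : R := (1 + Num.max r 1) ^+ 3.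
have m0 : 0 < m by rewrite exprn_gt0// ltr_pwDl// le_max ler01 orbT.
exists (C' * m + C * 8) => [|x]; first by rewrite addr_gt0// mulr_gt0.
have n0 : 0 < 1 + `|x| by rewrite ltr_pwDl.
have n3 : 0 < (1 + `|x|) ^+ 3 by rewrite exprn_gt0.
rewrite ler_pdivlMr//.
have [xr|xr] := leP `|x| (Num.max r 1).
  apply: (@le_trans _ _ (C' * m)); last by rewrite lerDl mulr_ge0// ltW.
  rewrite ler_pM ?gC// ?(ltW n3)// /m lerXn2r ?nnegrE ?(ltW n0)//.
    by rewrite addr_ge0// le_max ler01 orbT.
  by rewrite lerD2l.
move: xr; rewrite gt_max => /andP[xr x1].
have x0 : punctured x by rewrite /punctured /= -normr_gt0 (lt_trans _ x1).
apply: (@le_trans _ _ (C * 8)); last by rewrite lerDr mulr_ge0// ltW.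
rewrite gh//; have xn0 : 0 < `|x| by rewrite (lt_trans _ x1).
apply: (@le_trans _ _ (C / `|x| ^+ 3 * (1 + `|x|) ^+ 3)).
  by rewrite ler_wpM2r ?(ltW n3)// hC.
rewrite -mulrA ler_wpM2l ?(ltW C0)// mulrC ler_pdivrMr ?exprn_gt0//.
rewrite (_ : 8 = 2 ^+ 3); last by rewrite -natrX.
rewrite -exprMn lerXn2r ?nnegrE ?mulr_ge0 ?(ltW n0)//.
by rewrite mulrDl mul1r lerD2r ltW.
Qed.

Lemma decay3_le_weight g (a : R) : 0 <= a -> a < 1 -> decay3 g ->
  exists2 C : R, 0 < C & forall x, `|g x| * `|x| `^ a <= C * weight ((3 - a) / 2) x.
Proof.
move=> a0 a1 [C C0 gC]; exists C => // x.
have n0 : 0 < 1 + `|x| by rewrite ltr_pwDl.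
apply: (@le_trans _ _ (C * (1 + `|x|) ^- 3 * (1 + `|x|) `^ a)).
  rewrite ler_pM ?gC ?powR_ge0//.
  by rewrite ge0_ler_powR ?nnegrE ?(ltW n0)// lerDr.
rewrite -mulrA ler_wpM2l ?(ltW C0)//.
rewrite -powR_mulrn ?(ltW n0)// -powRN -powRD; last by rewrite (gt_eqF n0) implybT.
have -> : - 3%:R + a = - ((3 - a) / 2) + - ((3 - a) / 2) :> R by field.
rewrite powRD; last by rewrite (gt_eqF n0) implybT.
have H (t : R) : `|t| <= `|x| -> (1 + `|x|) `^ (- ((3 - a) / 2)) <= tail ((3 - a) / 2) t.
  move=> tx; rewrite /tail !powRN lef_pV2 ?posrE ?powR_gt0 ?ltr_pwDl//.
  by rewrite ge0_ler_powR ?nnegrE ?addr_ge0// ?lerD2l//; lra.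
by rewrite ler_pM ?powR_ge0// H ?norm_fst_le ?norm_snd_le.
Qed.

(** Splitting the exponent [a - 3] evenly between the coordinates leaves
    [(3 - a) / 2 > 1] for each of them; this is where [a < 1] is needed. *)
Lemma decay3_moment_L1 g (a : R) : 0 <= a -> a < 1 -> continuous g -> decay3 g ->
  L1 (fun x => g x * `|x| `^ a).
Proof.
move=> a0 a1 cg dg; have [C _ gC] := decay3_le_weight a0 a1 dg.
apply: (@L1_le_weight _ _ ((3 - a) / 2) C); first by lra.
  apply: measurable_funM; first exact: continuous_meas2.
  apply: (measurableT_comp (measurable_powR a)).
  by apply: continuous_meas2; exact: norm_continuous.
by move=> x; rewrite normrM (ger0_norm (powR_ge0 _ _)).
Qed.

Lemma decay3_L1 g : continuous g -> decay3 g -> L1 g.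
Proof.
move=> cg dg; have := @decay3_moment_L1 g 0 (lexx _) ltr01 cg dg.
by under eq_fun do rewrite /= powRr0 mulr1.
Qed.

Lemma decay3Z (k : R) g : decay3 g -> decay3 (fun x => k * g x).
Proof.
move=> [C C0 gC]; exists ((`|k| + 1) * C) => [|x]; first by rewrite mulr_gt0// ltr_wpDl.
by rewrite normrM -mulrA ler_pM// lerDl.
Qed.

(** [N] is a truncation of a kernel [G] homogeneous of degree -1: its second
    derivatives are homogeneous of degree -3 beyond the truncation. *)
Lemma derive2_decay3 N G (r : R) v w : Cn 2 setT N -> Cn 2 punctured G ->
  (forall x, r < `|x| -> N x = G x) ->
  (forall c x, c != 0 -> punctured x -> G (c *: x) = c^-1 * G x) ->
  decay3 ('D_v ('D_w N)).
Proof.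
move=> CN CG NG GZ; have oU := open_punctured.
have oO := @open_outside r.
have CG1 := Cn_derive w CG; have CG0 := Cn_derive v CG1.
have GZ' c x : c != 0 -> punctured x -> G (c *: x) = c^-1 * G x + 0.
  by move=> c0 x0; rewrite addr0; exact: GZ.
have Z1 := derive_homogeneous w (CnS (CnS CG)) GZ'.
have Z2 := derive_homogeneous v (CnS CG1) Z1.
apply: (@decay3_of_homogeneous _ ('D_v ('D_w G)) r).
- exact: (Cn_continuous (Cn_derive v (Cn_derive w CN))).
- move=> x x0; apply: differentiable_continuous; exact: Cn_differentiable CG0 x0.
- move=> c x c0 x0; rewrite Z2// addr0 mulrA; congr (_ * _).
  by field.
- by apply: derive_eq_open => //; apply: derive_eq_open.
Qed.

Lemma derive_odd (s : R) f v x : differentiable f (- x) ->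
  (forall x, f (- x) = s * f x) -> derivable f x v -> 'D_v f (- x) = - s * 'D_v f x.
Proof.
move=> df fN df'; have E : 'D_v (fun x => f (-1 *: x + 0)) x = s * 'D_v f x.
  rewrite (_ : (fun x => f (-1 *: x + 0)) = fun x => s * f x); last first.
    by apply/funext => y; rewrite scaleN1r addr0 fN.
  exact: deriveZ.
rewrite derive_comp_affine scaleN1r addr0// in E.
by rewrite mulNr -E mulN1r opprK.
Qed.

(** With [pidx], the rotation by a quarter turn as a sign and an exchange of the
    two indices: both [perp] and [gradperp] are expressed through them. *)
Definition psign (l : 'I_2) : R := if l == 0 then -1 else 1.
Definition pidx (l : 'I_2) : 'I_2 := if l == 0 then 1 else 0.

Lemma gradperpE l f : gradperp l f = fun x => psign l * partial (pidx l) f x.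
Proof.
rewrite /gradperp /psign /pidx; case: ifP => _; apply/funext => x.
  by rewrite mulN1r.
by rewrite mul1r.
Qed.

Section Cutoff.
Variable theta : R * R -> R.
Hypothesis cth : cutoff theta.

Definition cutK i x : R := (1 - theta x) * biot_savart i x.
(** The kernel that acts on [u_k u_l] in component [i] of the Serfati
    identity. *)
Definition kerM i k l : R * R -> R := partial k (gradperp l (cutK i)).
(** The integrable part of [Gamma_jkl]. *)
Definition kerG j k l : R * R -> R :=
  partial j (partial k (partial l (fun x => (1 - theta x) * fundsol x))).

Lemma Cn_cutK n i : Cn n setT (cutK i).
Proof. exact/Cn_cut/Cn_biot_savart. Qed.

Lemma Cn_cutE n : Cn n setT (fun x => (1 - theta x) * fundsol x).
Proof. exact/Cn_cut/Cn_fundsol. Qed.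

Lemma Cn_gradperp n l f : Cn n.+1 setT f -> Cn n setT (gradperp l f).
Proof. by move=> Cf; rewrite gradperpE; apply: CnZ; [exact: openT|exact: Cn_derive]. Qed.

Lemma kerME i k l : kerM i k l = fun x => psign l * partial k (partial (pidx l) (cutK i)) x.
Proof.
apply/funext => x; rewrite /kerM gradperpE.
apply: deriveZ; apply: diff_derivable.
exact: (Cn_differentiable (Cn_derive _ (Cn_cutK 1 i)) I).
Qed.

Lemma continuous_kerM i k l : continuous (kerM i k l).
Proof.
exact: (Cn_continuous (Cn_derive _ (Cn_gradperp l (Cn_cutK 2 i)))).
Qed.

Lemma continuous_kerG j k l : continuous (kerG j k l).
Proof.
exact: (Cn_continuous (Cn_derive _ (Cn_derive _ (Cn_derive _ (Cn_cutE 3))))).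
Qed.

Lemma decay3_kerM i k l : decay3 (kerM i k l).
Proof.
have [r _ tr] := cutoff_supp cth; rewrite kerME; apply: decay3Z.
apply: (@derive2_decay3 _ (biot_savart i) r).
- exact: Cn_cutK.
- exact: Cn_biot_savart.
- by move=> x rx; rewrite /cutK tr// subr0 mul1r.
- by move=> c x c0 _; exact: biot_savartZ.
Qed.

Lemma decay3_kerG j k l : decay3 (kerG j k l).
Proof.
have [r _ tr] := cutoff_supp cth.
apply: (@derive2_decay3 _ (partial l fundsol) r).
- exact: Cn_derive (Cn_cutE 3).
- exact: Cn_derive (Cn_fundsol 3).
- apply: derive_eq_open; first exact: open_outside.
  by move=> x rx; rewrite tr// subr0 mul1r.
- move=> c x c0 x0.
  have EZ (a : R) y : a != 0 -> punctured y ->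
      fundsol (a *: y) = 1 * fundsol y + - ((2 * pi)^-1 * ln `|a|).
    by move=> a0 y0; rewrite mul1r fundsolZ.
  have Z := derive_homogeneous (e := fun=> 1) (k := fun a => - ((2 * pi)^-1 * ln `|a|))
    (edir l) (Cn_fundsol 0) EZ.
  by rewrite [LHS]Z// mulr1 addr0.
Qed.

Lemma L1_kerM i k l : L1 (kerM i k l).
Proof. by apply: decay3_L1; [exact: continuous_kerM|exact: decay3_kerM]. Qed.

Lemma L1_kerG j k l : L1 (kerG j k l).
Proof. by apply: decay3_L1; [exact: continuous_kerG|exact: decay3_kerG]. Qed.

Lemma enormN x : enorm (- x) = enorm x.
Proof. by rewrite -scaleN1r enormZ normrN1 mul1r. Qed.

Lemma cutoff_even x : theta (- x) = theta x.
Proof. by have [_ rt _] := cth; apply: rt; exact: enormN. Qed.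

Lemma biot_savart_odd i x : biot_savart i (- x) = - biot_savart i x.
Proof. by rewrite -scaleN1r biot_savartZ ?invrN1 ?mulN1r// oppr_eq0 oner_neq0. Qed.

(** An odd kernel with two derivatives is odd, hence of mean zero. *)
Lemma kerM_odd i k l x : kerM i k l (- x) = - kerM i k l x.
Proof.
rewrite kerME; have C := Cn_cutK 2 i; have C1 := Cn_derive (edir (pidx l)) C.
have odd0 y : cutK i (- y) = -1 * cutK i y.
  by rewrite /cutK cutoff_even biot_savart_odd mulrN mulN1r.
have odd1 y : partial (pidx l) (cutK i) (- y) = 1 * partial (pidx l) (cutK i) y.
  rewrite /partial (@derive_odd (-1)) ?opprK//.
    exact: Cn_differentiable C I.
  by apply: diff_derivable; exact: Cn_differentiable C I.
rewrite /partial (@derive_odd 1)//.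
- by rewrite mulN1r mulrN.
- exact: Cn_differentiable C1 I.
- by apply: diff_derivable; exact: Cn_differentiable C1 I.
Qed.

Lemma cutoff_bounded : exists2 C : R, 0 < C & forall x, `|theta x| <= C.
Proof.
have [r _ tr] := cutoff_supp cth; have [[st _] _ _] := cth.
exact: (supp_bounded (smooth_continuous st) tr).
Qed.

Lemma meas2_sqn : meas2 sqn.
Proof. by apply: continuous_meas2; exact: (Cn_continuous (Cn_sqn 0)). Qed.

Lemma meas2_biot_savart i : meas2 (@biot_savart R i).
Proof.
have -> : biot_savart i = fun x : R * R => (2 * pi)^-1 * cpnt i (perp x) * (sqn x)^-1.
  by apply/funext; exact: biot_savartE.
apply: measurable_funM; last exact: (measurable_funV meas2_sqn).
apply: measurable_funM => //; apply: continuous_meas2.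
exact: (Cn_continuous (Cn_cpnt_perp 0 i)).
Qed.

Lemma meas2_fundsol : meas2 (@fundsol R).
Proof.
have -> : fundsol = fun x : R * R => - (4 * pi)^-1 * ln (sqn x).
  by apply/funext; exact: fundsolE.
apply: measurable_funM => //; exact: (measurableT_comp (@measurable_ln R) meas2_sqn).
Qed.

Lemma meas2_cutoff : meas2 theta.
Proof. by have [[st _] _ _] := cth; apply: continuous_meas2; exact: smooth_continuous. Qed.

Lemma biot_savart_bound i x : punctured x -> `|biot_savart i x| <= (2 * pi)^-1 / `|x|.
Proof.
move=> x0; have n0 : 0 < `|x| by rewrite normr_gt0.
have p0 : 0 < (2 * pi)^-1 :> R by rewrite invr_gt0 mulr_gt0// pi_gt0.
rewrite biot_savartE -mulrA normrM (gtr0_norm p0) ler_wpM2l ?(ltW p0)//.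
rewrite normrM normfV (ger0_norm (sqn_ge0 x)) ler_pdivrMr ?sqn_gt0//.
have c1 : `|cpnt i (perp x)| <= `|x|.
  by rewrite /cpnt /perp; case: (i == 0) => /=; rewrite ?normrN ?norm_fst_le ?norm_snd_le.
apply: (le_trans c1); rewrite mulrC ler_pdivlMr// -expr2; exact: sqn_ge_norm.
Qed.

(** [ln s <= s] for [s] and for its inverse; the constant only has to cover a
    ball, where the logarithm is used. *)
Lemma fundsol_bound (r : R) x : 0 < r -> punctured x -> `|x| <= r ->
  `|fundsol x| <= (2 * pi)^-1 * (2 * r ^+ 2 + 1) / `|x|.
Proof.
move=> r0 x0 xr; have n0 : 0 < `|x| by rewrite normr_gt0.
have p0 : 0 < (2 * pi)^-1 :> R by rewrite invr_gt0 mulr_gt0// pi_gt0.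
have e0 := enorm_gt0 x0.
rewrite /fundsol normrM normrN (gtr0_norm p0) -mulrA ler_wpM2l ?(ltW p0)//.
have ln_le (s : R) : 0 < s -> ln s <= s by move=> s0; exact: ltW (ln_sublinear s0).
have h1 : enorm x <= (2 * r ^+ 2 + 1) / `|x|.
  rewrite (le_trans (enorm_le_norm x))// ler_pdivlMr// -mulrA -expr2.
  by rewrite (@le_trans _ _ (2 * r ^+ 2)) ?lerDl// ler_wpM2l// lerXn2r ?nnegrE ?(ltW r0).
have h2 : (enorm x)^-1 <= (2 * r ^+ 2 + 1) / `|x|.
  apply: (@le_trans _ _ `|x|^-1).
    by rewrite lef_pV2 ?posrE// norm_le_enorm.
  by rewrite -[leLHS]mul1r ler_wpM2r ?invr_ge0// lerDr mulr_ge0// sqr_ge0.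
rewrite ler_norml; apply/andP; split; last exact: le_trans (ln_le _ e0) h1.
by rewrite lerNl -lnV ?posrE// (le_trans _ h2)// ln_le// invr_gt0.
Qed.

Lemma L1_cut_biot_savart i : L1 (theta \* biot_savart i).
Proof.
have [r r0 tr] := cutoff_supp cth; have [C C0 tC] := cutoff_bounded.
apply: (@L1_singular _ _ r (C * (2 * pi)^-1)) => //.
- by apply: measurable_funM; [exact: meas2_cutoff|exact: meas2_biot_savart].
- by move=> x rx; rewrite /= tr// mul0r.
- by move=> x x0; rewrite /= normrM -mulrA ler_pM// biot_savart_bound.
Qed.

Lemma L1_cut_fundsol : L1 (theta \* fundsol).
Proof.
have [r r0 tr] := cutoff_supp cth; have [C C0 tC] := cutoff_bounded.
apply: (@L1_singular _ _ r (C * ((2 * pi)^-1 * (2 * r ^+ 2 + 1)))) => //.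
- by apply: measurable_funM; [exact: meas2_cutoff|exact: meas2_fundsol].
- by move=> x rx; rewrite /= tr// mul0r.
- move=> x x0; rewrite /= normrM.
  have p0 : 0 < (2 * pi)^-1 :> R by rewrite invr_gt0 mulr_gt0// pi_gt0.
  have [xr|rx] := leP `|x| r; first by rewrite -mulrA ler_pM// fundsol_bound.
  rewrite tr// normr0 mul0r divr_ge0// mulr_ge0 ?(ltW C0)// mulr_ge0 ?(ltW p0)//.
  by rewrite addr_ge0// mulr_ge0// sqr_ge0.
Qed.

Lemma cut_biot_savart_odd i x : (theta \* biot_savart i) (- x) = - (theta \* biot_savart i) x.
Proof. by rewrite /= cutoff_even biot_savart_odd mulrN. Qed.

Lemma cut_biot_savart_moment_L1 i (a : R) : 0 <= a ->
  L1 (fun x => (theta \* biot_savart i) x * `|x| `^ a).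
Proof.
move=> a0; have [r r0 tr] := cutoff_supp cth.
have ig := L1Z (r `^ a) (L1_norm (L1_cut_biot_savart i)).
apply: (integrable_dominated ig).
- apply: measurable_funM; first exact: (L1_measurable (L1_cut_biot_savart i)).
  apply: (measurableT_comp (measurable_powR a)).
  by apply: continuous_meas2; exact: norm_continuous.
- move=> x; rewrite normrM (ger0_norm (powR_ge0 _ _)) mulrC.
  have [xr|rx] := leP `|x| r; last by rewrite /= tr// mul0r normr0 !mulr0.
  by rewrite ler_wpM2r// ge0_ler_powR ?nnegrE// ltW.
Qed.

End Cutoff.

Lemma cutoff_scale theta (e : R) : 0 < e -> cutoff theta ->
  cutoff (fun x => theta (e^-1 *: x)).
Proof.
move=> e0 ct; have [[st _] rt t1] := ct; have [r r0 tr] := cutoff_supp ct.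
split.
- apply: (@test_of_supp _ _ (e * r)).
    have := @smooth_affine R _ theta e^-1 0 st.
    by under eq_fun do rewrite addr0.
  move=> x rx; apply: tr; rewrite normrZ ger0_norm ?invr_ge0 ?(ltW e0)//.
  by rewrite mulrC ltr_pdivlMr// mulrC.
- by move=> x y xy; apply: rt; rewrite !enormZ xy.
- have c0 : (fun x : R * R => e^-1 *: x) @ (0 : R * R) --> (0 : R * R).
    rewrite -[X in _ --> X](scaler0 _ e^-1).
    by apply: cvgZr; exact: cvg_id.
  exact: (c0 _ t1).
Qed.

(** [K] has degree -1 in dimension 2.  This is what makes the vorticity term of
    the Serfati identity negligible when the cut-off shrinks. *)
Lemma cut_biot_savart_scale theta i (e : R) : 0 < e -> cutoff theta ->
  \int[leb2]_x `|((fun x => theta (e^-1 *: x)) \* biot_savart i) x| =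
  e * \int[leb2]_x `|(theta \* biot_savart i) x|.
Proof.
move=> e0 ct; have en0 : e != 0 by rewrite gt_eqF.
have ct' := cutoff_scale e0 ct.
rewrite (Rintegral_affine2 0 en0 (L1_norm (L1_cut_biot_savart ct' i))).
have -> : \int[leb2]_x `|((fun x => theta (e^-1 *: x)) \* biot_savart i) (e *: x + 0)| =
    \int[leb2]_x (e^-1 * `|(theta \* biot_savart i) x|).
  apply: eq_Rintegral => x _; rewrite /= addr0 scalerA mulVf// scale1r biot_savartZ//.
  by rewrite mulrCA normrM ger0_norm// invr_ge0 ltW.
rewrite RintegralZl//; last exact: L1_norm (L1_cut_biot_savart ct i).
by rewrite mulrA expr2 mulfK.
Qed.

(** Hence [chi] may also serve as the cut-off in the Serfati identity. *)
Lemma lowpass_cutoff (chi : R * R -> R) : lowpass_symbol chi -> cutoff chi.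
Proof.
move=> [sc rc c2 c1 _]; split=> //.
  apply: (@test_of_supp _ _ 2) => // x x2; apply: c2.
  by rewrite (le_trans _ (norm_le_enorm x))// ltW.
apply/nbhs_ballP; exists 2^-1 => /= [|x]; first by rewrite invr_gt0.
rewrite -ball_normE /= sub0r normrN => x2; apply: c1.
by rewrite (le_trans (enorm_le_norm x))// mulrC -ler_pdivlMr// mul1r ltW.
Qed.

End Kernels.

(** * The derivatives of the Biot-Savart kernel as distributions *)

Section NewtonianPotential.
Context {R : realType}.
Notation mu := (@lebesgue_measure R).
Implicit Types (f g : R * R -> R) (x y : R * R).

(** The primitive is [t / (a^2 (a^2 + t^2)) + atan (t / a) / a^3]. *)
Lemma integral_lorentzian_sq (a : R) : 0 < a ->
  (\int[mu]_t (2 * (a ^+ 2 + t ^+ 2) ^- 2)%:E = (pi * a ^- 3)%:E)%E.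
Proof.
move=> a0.
pose f t : R := 2 * (a ^+ 2 + t ^+ 2) ^- 2.
have d0 (t : R) : 0 < a ^+ 2 + t ^+ 2 by rewrite ltr_pwDl ?sqr_ge0// exprn_gt0.
have f0 t : 0 <= f t by rewrite /f mulr_ge0// invr_ge0 exprn_ge0// ltW.
have cf : continuous f.
  move=> t; apply: cvgM; first exact: cvg_cst.
  apply: cvgV; first by rewrite expf_neq0// gt_eqF.
  rewrite [X in X @ _ --> _](_ : _ = fun t : R => (a ^+ 2 + t ^+ 2) * (a ^+ 2 + t ^+ 2)); last first.
    by apply/funext => z; rewrite expr2.
  rewrite expr2.
  have h : (a ^+ 2 + x ^+ 2) @[x --> t] --> a ^+ 2 + t ^+ 2.
    by apply: cvgD; [exact: cvg_cst|apply: exprn_continuous].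
  by apply: cvgM.
rewrite (@ge0_symfun_integralT _ f)//; last first.
  by move=> t /=; rewrite /f sqrrN.
rewrite -set_itvcy.
pose F t : R := a ^- 2 * (t * (a ^+ 2 + t ^+ 2)^-1) + a ^- 3 * atan (a^-1 * t).
have dF (t : R) : is_derive t (1 : R) F (f t).
  have d1 : is_derive t (1 : R) (fun t : R => a ^+ 2 + t ^+ 2) (2 * t).
    by apply: is_derive_eq; rewrite /GRing.scale /=; ring.
  have d2 : is_derive t (1 : R) (fun t : R => (a ^+ 2 + t ^+ 2)^-1)
      (- (a ^+ 2 + t ^+ 2) ^- 2 * (2 * t)).
    by apply: is_deriveV; rewrite gt_eqF.
  have d3 : is_derive t (1 : R) (fun t : R => atan (a^-1 * t))
      ((1 + (a^-1 * t) ^+ 2)^-1 * (a^-1)).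
    have d4 : is_derive t (1 : R) (fun t : R => a^-1 * t) (a^-1).
      by apply: is_derive_eq; rewrite /GRing.scale /= ?mulr1; ring.
    have := @is_derive1_comp _ atan (fun t : R => a^-1 * t) t _ _ (is_derive1_atan _) d4.
    by rewrite mulrC.
  rewrite /F; apply: is_derive_eq; rewrite /f.
  have an : a != 0 by rewrite gt_eqF.
  have dn : a ^+ 2 + t ^+ 2 != 0 by rewrite gt_eqF.
  have en : 1 + (a^-1 * t) ^+ 2 = (a ^+ 2 + t ^+ 2) / a ^+ 2 by field.
  rewrite en; rewrite /GRing.scale /=. 
  by field; rewrite an dn.
have lF : F x @[x --> +oo%R] --> a ^- 3 * (pi / 2).
  rewrite -[X in _ --> X]add0r; apply: cvgD.
    rewrite -[X in _ --> X](mulr0 (a ^- 2)); apply: cvgM; first exact: cvg_cst.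
    apply: (@squeeze_cvgr _ _ _ _ (fun=> 0) (fun t : R => t^-1)).
    - near=> t. have t0 : 0 < t by near: t; exact: nbhs_pinfty_gt.
      rewrite mulr_ge0 ?invr_ge0 ?(ltW t0) ?(ltW (d0 t))//=.
      rewrite ler_pdivrMr// mulrDr [X in _ + X](_ : _ = t); last by field; rewrite gt_eqF.
      by rewrite lerDr mulr_ge0 ?invr_ge0 ?sqr_ge0 ?(ltW t0).
    - exact: cvg_cst.
    - apply/gtr0_cvgV0; last exact: cvg_id.
      by near=> t; near: t; exact: nbhs_pinfty_gt.
  apply: cvgM; first exact: cvg_cst.
  apply: (cvg_comp (fun t : R => a^-1 * t) atan _ (@cvgy_atan R)).
  apply: gt0_cvgMry; first by rewrite invr_gt0.
  exact: cvg_id.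
rewrite (ge0_continuous_FTC2y _ _ lF)//.
- rewrite /F mul0r mulr0 mulr0 atan0 mulr0 addr0 sube0 -EFinM; congr (_%:E).
  by move: (pi : R) => p; field; rewrite gt_eqF.
- by apply: continuous_subspaceT.
- have d := dF 0; have := @ex_derive _ _ _ _ _ _ _ d.
  by move=> /derivable1_diffP/differentiable_continuous; exact: cvg_at_right_filter.
- by move=> t _; have d := dF t; rewrite derive1E (@derive_val _ _ _ _ _ _ _ d).
Unshelve. all: by end_near. Qed.

(** The primitive [t / sqrt (1 + t^2)] is the sine of the arctangent. *)
Lemma integral_lorentzian_cube :
  (\int[mu]_t (Num.sqrt (1 + t ^+ 2) ^- 3)%:E = (2 : R)%:E)%E.
Proof.
pose f (t : R) : R := cos (atan t) * (1 + t ^+ 2)^-1.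
have d0 (t : R) : 0 < 1 + t ^+ 2 by rewrite ltr_pwDl ?sqr_ge0.
have fE t : Num.sqrt (1 + t ^+ 2) ^- 3 = f t.
  rewrite /f cos_atan; rewrite -[in X in _ = _ * X](sqr_sqrtr (ltW (d0 t))).
  by field; rewrite gt_eqF// sqrtr_gt0.
have -> : (fun t : R => (Num.sqrt (1 + t ^+ 2) ^- 3)%:E) = fun t => (f t)%:E.
  by apply/funext => t; rewrite fE.
have f0 t : 0 <= f t by rewrite -fE invr_ge0 exprn_ge0// sqrtr_ge0.
have cf : continuous f.
  move=> t; apply: cvgM.
    by apply: (continuous_comp (@continuous_atan R t)); exact: continuous_cos.
  apply: cvgV; first by rewrite gt_eqF.
  by apply: cvgD; [exact: cvg_cst|apply: exprn_continuous].
rewrite (@ge0_symfun_integralT _ f)//; last first.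
  by move=> t /=; rewrite /f sqrrN atanN cosN.
rewrite -set_itvcy.
pose F (t : R) : R := sin (atan t).
have dF (t : R) : is_derive t (1 : R) F (f t).
  have := @is_derive1_comp _ sin atan t _ _ (is_derive_sin _) (is_derive1_atan _).
  exact.
have lF : F x @[x --> +oo%R] --> (1 : R).
  rewrite -(sin_pihalf R).
  by apply: (cvg_comp atan sin (@cvgy_atan R)); exact: continuous_sin.
rewrite (ge0_continuous_FTC2y _ _ lF)//.
- by rewrite /F atan0 sin0 sube0 mule1.
- by apply: continuous_subspaceT.
- have d := dF 0; have := @ex_derive _ _ _ _ _ _ _ d.
  by move=> /derivable1_diffP/differentiable_continuous; exact: cvg_at_right_filter.
- by move=> t _; have d := dF t; rewrite derive1E (@derive_val _ _ _ _ _ _ _ d).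
Qed.

(** Half the Laplacian of [ln (1 + |x|^2)], whence its total mass; it is the
    profile of the approximate identity that appears below. *)
Definition bump x : R := 2 * (1 + sqn x) ^- 2.

Lemma bump_ge0 x : 0 <= bump x.
Proof. by rewrite mulr_ge0// invr_ge0 exprn_ge0// addr_ge0// sqn_ge0. Qed.

Lemma meas2_bump : meas2 bump.
Proof.
apply: measurable_funM; first exact: measurable_cst.
apply: measurable_funV; apply: measurable_funX.
by apply: measurable_funD; [exact: measurable_cst|exact: meas2_sqn].
Qed.

Lemma integral_bump : (\int[leb2]_x (bump x)%:E = (2 * pi : R)%:E)%E.
Proof.
rewrite ge0_leb2E1//; last first.
- by move=> x; rewrite lee_fin bump_ge0.
- by apply/measurable_EFinP; exact: meas2_bump.
have E (a : R) : (\int[mu]_b (bump (a, b))%:E =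
    pi%:E * (Num.sqrt (1 + a ^+ 2) ^- 3)%:E)%E.
  have s0 : 0 < 1 + a ^+ 2 by rewrite ltr_pwDl ?sqr_ge0.
  have := @integral_lorentzian_sq (Num.sqrt (1 + a ^+ 2)).
  rewrite sqrtr_gt0 => /(_ s0) h; rewrite -EFinM -h; apply: eq_integral => b _.
  by rewrite /bump /sqn /= sqr_sqrtr ?(ltW s0)// addrA.
have -> : (fun a : R => \int[mu]_b (bump (a, b))%:E)%E =
  (fun a : R => pi%:E * (Num.sqrt (1 + a ^+ 2) ^- 3)%:E)%E by apply/funext.
rewrite ge0_integralZl//.
- by rewrite integral_lorentzian_cube -EFinM mulrC.
- apply/measurable_EFinP; apply: measurable_funV; apply: measurable_funX.
  apply: continuous_measurable_fun => t.
  apply: (continuous_comp (f := fun t : R => 1 + t ^+ 2)); last exact: sqrt_continuous.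
  by apply: cvgD; [exact: cvg_cst|apply: exprn_continuous].
- by rewrite lee_fin pi_ge0.
Qed.

Lemma L1_bump : L1 bump.
Proof.
apply/integrableP; split; first by apply/measurable_EFinP; exact: meas2_bump.
have -> : (\int[leb2]_x `|(EFin \o bump) x| = \int[leb2]_x (bump x)%:E)%E.
  by apply: eq_integral => x _; rewrite /= ger0_norm// bump_ge0.
by rewrite integral_bump ltry.
Qed.

Lemma Rintegral_bump : \int[leb2]_x bump x = 2 * pi.
Proof. by rewrite /Rintegral integral_bump. Qed.

Lemma ae_nonzero : {ae leb2, forall x, x != 0}.
Proof.
exists ([set 0] `*` [set 0]); split.
- by apply: measurableX; exact: measurable_set1.
- by rewrite leb2_setX ?lebesgue_measure_set1 ?mul0e//; exact: measurable_set1.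
- by move=> [a b] /= /negP; rewrite negbK => /eqP[-> ->].
Qed.

Lemma cpntE j : (cpnt j : R * R -> R) = if j == 0 then fst else snd.
Proof. by rewrite /cpnt; case: ifP. Qed.

Lemma Cn_cpnt n j : Cn n setT (cpnt j : R * R -> R).
Proof. by rewrite cpntE; case: ifP => _; [exact: Cn_fst|exact: Cn_snd]. Qed.

Lemma meas2_cpnt j : meas2 (cpnt j : R * R -> R).
Proof. by apply: continuous_meas2; exact: Cn_continuous (@Cn_cpnt 0 j). Qed.

Lemma partial_cpnt i j x : partial i (cpnt j) x = (i == j)%:R.
Proof.
rewrite /partial cpntE /edir.
by case: i => [[|[|//]]] ?; case: j => [[|[|//]]] ? /=; rewrite ?derive_fst ?derive_snd.
Qed.

Lemma partialM i f g x : differentiable f x -> differentiable g x ->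
  partial i (fun y => f y * g y) x = partial i f x * g x + f x * partial i g x.
Proof.
move=> df dg; rewrite /partial [LHS](@deriveM _ _ f g); try exact: diff_derivable.
by rewrite addrC; congr (_ + _); rewrite [LHS]mulrC.
Qed.

Lemma sqnE x : sqn x = cpnt 0 x * cpnt 0 x + cpnt 1 x * cpnt 1 x.
Proof. by []. Qed.

Lemma partial_sqn i x : partial i sqn x = 2 * cpnt i x.
Proof.
have -> : sqn = fun x : R * R => cpnt 0 x * cpnt 0 x + cpnt 1 x * cpnt 1 x by [].
have dc j : differentiable (cpnt j : R * R -> R) x := Cn_differentiable (@Cn_cpnt 0 j) I.
have dcc j := @diff_derivable _ _ _ _ _ (edir i) (Cn_differentiable
  (CnM openT (@Cn_cpnt 0 j) (@Cn_cpnt 0 j)) (I : setT x)).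
rewrite /partial [LHS]deriveD// -!/(partial _ _ _) !partialM// !partial_cpnt.
by case: i {dcc} => [[|[|//]]] ? /=; rewrite /cpnt /=; ring.
Qed.

Section Regularized.
Variable e : R.
Hypothesis e0 : 0 < e.

(** [|x|^-2] regularised by [e > 0]: integrations by parts then hold without
    boundary terms at the origin, and [e] tends to 0 afterwards. *)
Definition reg x : R := (sqn x + e)^-1.

Lemma reg_den x : 0 < sqn x + e.
Proof. by rewrite ltr_wpDl// sqn_ge0. Qed.

Lemma Cn_reg_den n : Cn n setT (fun x => sqn x + e).
Proof. by apply: CnD; [exact: openT|exact: Cn_sqn|exact: Cn_cst openT]. Qed.

Lemma Cn_reg n : Cn n setT reg.
Proof.
apply: CnV; [exact: openT| |exact: Cn_reg_den].
by move=> x _; rewrite gt_eqF// reg_den.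
Qed.

Lemma partial_reg_den i x : partial i (fun x => sqn x + e) x = 2 * cpnt i x.
Proof.
rewrite -partial_sqn /partial [LHS]deriveD//.
- by rewrite derive_cst addr0.
- exact: diff_derivable (Cn_differentiable (@Cn_sqn R 0) I).
Qed.

Lemma partial_reg i x : partial i reg x = - (2 * cpnt i x) * reg x ^+ 2.
Proof.
have d0 : sqn x + e != 0 by rewrite gt_eqF// reg_den.
have dd := @diff_derivable _ _ _ _ _ (edir i) (Cn_differentiable (@Cn_reg_den 0) (I : setT x)).
rewrite /partial /reg [LHS](@deriveV _ _ (fun x => sqn x + e))//.
by rewrite -/(partial _ _ _) partial_reg_den /GRing.scale /= exprVn; ring.
Qed.

Lemma partial_reg_cpnt i j x : partial i (fun y => reg y * cpnt j y) x =
  (i == j)%:R * reg x - 2 * cpnt i x * cpnt j x * reg x ^+ 2.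
Proof.
rewrite partialM ?partial_reg ?partial_cpnt; first by ring.
- exact: Cn_differentiable (@Cn_reg 0) I.
- exact: Cn_differentiable (@Cn_cpnt 0 j) I.
Qed.

Lemma partial_ln_reg i x : partial i (fun y => ln (sqn y + e)) x = 2 * (reg x * cpnt i x).
Proof.
have dd := Cn_differentiable (@Cn_reg_den 0) (I : setT x).
have dl : differentiable (@ln R) (sqn x + e).
  apply/derivable1_diffP; have d := is_derive1_ln (reg_den x).
  exact: (@ex_derive _ _ _ _ _ _ _ d).
rewrite /partial [LHS](@derive_compose _ _ _ (fun y => sqn y + e) (@ln R))//.
rewrite -/(partial _ _ _) partial_reg_den.
have d := is_derive1_ln (reg_den x).
rewrite -[2 * _]mulr1 [X in 'D_X _ _](_ : _ = (2 * cpnt i x) *: (1 : R))//.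
by rewrite deriveZdir// (@derive_val _ _ _ _ _ _ _ d) /reg; ring.
Qed.

Lemma reg_parts i j f (r : R) : 0 < r -> Cn 1 setT f -> supp_in r f ->
  \int[leb2]_x (reg x * cpnt j x * partial i f x) =
  - \int[leb2]_x (((i == j)%:R * reg x - 2 * cpnt i x * cpnt j x * reg x ^+ 2) * f x).
Proof.
move=> r0 Cf fr.
have C1 : Cn 1 setT (fun x => reg x * cpnt j x).
  by apply: CnM; [exact: openT|exact: Cn_reg|exact: Cn_cpnt].
rewrite -[LHS]opprK -(Rintegral_parts i r0 C1 Cf fr); congr (- _).
by apply: eq_Rintegral => x _; rewrite partial_reg_cpnt.
Qed.

Lemma ln_reg_parts i f (r : R) : 0 < r -> Cn 1 setT f -> supp_in r f ->
  \int[leb2]_x (ln (sqn x + e) * partial i f x) =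
  - (2 * \int[leb2]_x (reg x * cpnt i x * f x)).
Proof.
move=> r0 Cf fr.
have C1 : Cn 1 setT (fun x => ln (sqn x + e)).
  by apply: Cn_ln; [exact: openT|by move=> x _; exact: reg_den|exact: Cn_reg_den].
rewrite -[LHS]opprK -(Rintegral_parts i r0 C1 Cf fr) -RintegralZl//; last first.
  apply: (@supp_L1 _ _ r); last exact: supp_inMr.
  apply: Cn_continuous (_ : Cn 0 setT _); apply: CnM; [exact: openT| |exact: CnS].
  by apply: CnM; [exact: openT|exact: Cn_reg|exact: Cn_cpnt].
by congr (- _); apply: eq_Rintegral => x _; rewrite partial_ln_reg// -!mulrA.
Qed.

End Regularized.

(** A test function cuts off a singularity [C / |x|]. *)
Lemma singular_mul_L1 (g f : R * R -> R) (C r : R) : 0 < r -> 0 <= C -> meas2 g ->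
  (forall x, x != 0 -> `|x| <= r -> `|g x| <= C / `|x|) -> continuous f -> supp_in r f ->
  L1 (fun x => g x * f x).
Proof.
move=> r0 C0 mg gC cf fr.
have [B B0 fB] := supp_bounded cf fr.
apply: (@L1_singular _ _ r (C * B)) => //.
- by apply: measurable_funM => //; exact: continuous_meas2.
- by move=> x rx; rewrite fr// mulr0.
- move=> x x0; have [rx|xr] := ltP r `|x|.
    by rewrite fr// mulr0 normr0 divr_ge0// mulr_ge0 ?(ltW B0).
  by rewrite normrM mulrAC; apply: ler_pM => //; exact: gC.
Qed.

(** Both [K] and the gradient of [E] are made of these two functions, up to
    constants. *)
Definition radial_kernel j x : R := (sqn x)^-1 * cpnt j x.

Lemma meas2_radial_kernel j : meas2 (radial_kernel j).
Proof. by apply: measurable_funM; [apply: measurable_funV; exact: meas2_sqn|exact: meas2_cpnt]. Qed.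

Lemma norm_cpnt_le j x : `|cpnt j x| <= `|x|.
Proof. by rewrite cpntE; case: ifP => _; [exact: norm_fst_le|exact: norm_snd_le]. Qed.

Lemma reg_cpnt_bound e j x : 0 <= e -> x != 0 -> `|reg e x * cpnt j x| <= 1 / `|x|.
Proof.
move: e => e' e0 x0; have n0 : 0 < `|x| by rewrite normr_gt0.
have s0 : 0 < sqn x + e' by rewrite ltr_pwDl// sqn_gt0.
rewrite normrM /reg normfV (gtr0_norm s0) ler_pdivlMr// -mulrA mulrC ler_pdivrMr// mul1r mulrC.
apply: (le_trans _ (_ : sqn x <= _)); last by rewrite lerDl.
by apply: le_trans (sqn_ge_norm x); rewrite expr2 ler_pM2l// norm_cpnt_le.
Qed.

Lemma radial_kernel_bound j x : x != 0 -> `|radial_kernel j x| <= 1 / `|x|.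
Proof. by have := @reg_cpnt_bound 0 j x (lexx _); rewrite /reg addr0. Qed.

Lemma meas2_reg e j : meas2 (fun x => reg e x * cpnt j x).
Proof.
apply: measurable_funM; last exact: meas2_cpnt.
by apply: measurable_funV; apply: measurable_funD; [exact: meas2_sqn|exact: measurable_cst].
Qed.

(** The square makes [x |-> x / (n+1)] the similarity that carries [reg (eps n)]
    back to a fixed profile. *)
Definition eps (n : nat) : R := (n.+1%:R^-1) ^+ 2.

Lemma eps_gt0 n : 0 < eps n. Proof. by rewrite exprn_gt0// invr_gt0. Qed.

Lemma eps_le1 n : eps n <= 1.
Proof. by rewrite expr_le1// invf_le1// ler1n. Qed.

Lemma cvg_eps : eps n @[n --> \oo] --> 0.
Proof.
rewrite -[X in _ --> X](expr0n R 2) /eps; rewrite (_ : (fun n => _) = fun n => n.+1%:R^-1 * n.+1%:R^-1).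
  by rewrite expr2; apply: cvgM; exact: cvg_harmonic.
by apply/funext => n; rewrite expr2.
Qed.

Lemma cvg_sqn_eps x : sqn x + eps n @[n --> \oo] --> sqn x.
Proof. by rewrite -[X in _ --> X]addr0; apply: cvgD; [exact: cvg_cst|exact: cvg_eps]. Qed.

Lemma cvg_reg_integral j f (r : R) : 0 < r -> continuous f -> supp_in r f ->
  \int[leb2]_x (reg (eps n) x * cpnt j x * f x) @[n --> \oo] -->
  \int[leb2]_x (radial_kernel j x * f x).
Proof.
move=> r0 cf fr.
have mf := continuous_meas2 cf.
apply: (@Rdominated_cvg _ _ _ leb2 setT _ _ (fun x => `|1 / `|x| * f x|)).
- by [].
- by move=> n; apply: measurable_funM => //; exact: meas2_reg.
- by apply: measurable_funM => //; exact: meas2_radial_kernel.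
- apply: L1_norm; apply: (@singular_mul_L1 _ _ 1 r) => //.
  + apply: measurable_funM; first exact: measurable_cst.
    apply: measurable_funV; apply: continuous_meas2; exact: norm_continuous.
  + by move=> x _ _; rewrite ger0_norm// divr_ge0.
- apply: filterS_ae ae_nonzero => x x0 _.
  apply: cvgM; last exact: cvg_cst.
  apply: cvgM; last exact: cvg_cst.
  by apply: cvgV; [rewrite gt_eqF// sqn_gt0|exact: cvg_sqn_eps].
- apply: filterS_ae ae_nonzero => x x0 n _.
  rewrite !normrM ler_wpM2r// -normrM (le_trans (reg_cpnt_bound _ (ltW (eps_gt0 n)) x0))//.
  by rewrite normr1 normfV normr_id.
Qed.

(** The pairing of [radial_kernel j] with [d_i f]. *)
Definition radial_pairing i j f : R := \int[leb2]_x (radial_kernel j x * partial i f x).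

(** The field [x / |x|^2] is a gradient, hence has no curl, even at the
    origin. *)
Lemma radial_pairing_sym i j f (r : R) : 0 < r -> Cn 1 setT f -> supp_in r f ->
  i != j -> radial_pairing i j f = radial_pairing j i f.
Proof.
move=> r0 Cf fr ij.
have cp k : continuous (partial k f) := Cn_continuous (Cn_derive (edir k) Cf).
have c1 := @cvg_reg_integral j _ r r0 (cp i) (supp_in_derive (edir i) fr).
have c2 := @cvg_reg_integral i _ r r0 (cp j) (supp_in_derive (edir j) fr).
apply: (Rcvg_unique c1); apply: cvg_trans c2; apply: near_eq_cvg; apply: nearW => n.
rewrite !(reg_parts (eps_gt0 n) _ _ r0 Cf fr); congr (- _); apply: eq_Rintegral => x _.
by rewrite eq_sym (negbTE ij); ring.
Qed.

(** The divergence of [x / |x|^2] is [2 pi delta_0]: regularised, it is twice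
    [e / (|x|^2 + e)^2], an approximate identity with profile [bump]. *)
Lemma radial_pairing_trace f (r : R) : 0 < r -> Cn 1 setT f -> supp_in r f ->
  radial_pairing 0 0 f + radial_pairing 1 1 f = - (2 * pi) * f 0.
Proof.
move=> r0 Cf fr.
have cp k : continuous (partial k f) := Cn_continuous (Cn_derive (edir k) Cf).
have cf := Cn_continuous Cf.
have cv k := @cvg_reg_integral k _ r r0 (cp k) (supp_in_derive (edir k) fr).
have c01 := cvgD (cv 0) (cv 1).
(* After scaling by [1/(n+1)] the approximate identity is [bump], and the test
   function is evaluated closer and closer to the origin. *)
have c2 : \int[leb2]_x (bump x * f (n.+1%:R^-1 *: x)) @[n --> \oo] -->
    \int[leb2]_x (bump x * f 0).
  have [B B0 fB] := supp_bounded cf fr.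
  apply: (@Rdominated_cvg _ _ _ leb2 setT _ _ (fun x => B * bump x)).
  - by [].
  - move=> n; apply: measurable_funM; first exact: meas2_bump.
    apply: continuous_meas2 => x; apply: (@continuous_comp _ _ _ (fun x => n.+1%:R^-1 *: x) f).
      exact: scaler_continuous.
    exact: cf.
  - by apply: measurable_funM; [exact: meas2_bump|exact: measurable_cst].
  - by apply: L1Z; exact: L1_bump.
  - apply: aeW => x _; apply: cvgM; first exact: cvg_cst.
    apply: (@cvg_comp _ _ _ (fun n => n.+1%:R^-1 *: x) f _ (nbhs (0 : R * R))); last exact: cf.
    rewrite -(scale0r x).
    apply: (@continuous_cvg _ _ _ _ _ _ (fun c : R => c *: x)); last exact: cvg_harmonic.
    by move: (@scalel_continuous R (R * R)%type x 0).
  - apply: aeW => x n _; rewrite normrM mulrC.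
    by rewrite (ger0_norm (bump_ge0 x)) ler_wpM2r ?bump_ge0.
have E n : \int[leb2]_x (reg (eps n) x * cpnt 0 x * partial 0 f x) +
   \int[leb2]_x (reg (eps n) x * cpnt 1 x * partial 1 f x) =
   - \int[leb2]_x (bump x * f (n.+1%:R^-1 *: x)).
  rewrite !(reg_parts (eps_gt0 n) _ _ r0 Cf fr) -opprD; congr (- _).
  have I k : L1 (fun x => ((k == k)%:R * reg (eps n) x -
      2 * cpnt k x * cpnt k x * reg (eps n) x ^+ 2) * f x).
    apply: (@supp_L1 _ _ r); last exact: supp_inMr.
    have C1 : Cn 1 setT (fun x => reg (eps n) x * cpnt k x).
      by apply: CnM; [exact: openT|exact: (Cn_reg (eps_gt0 n) _)|exact: Cn_cpnt].
    have -> : (fun x => ((k == k)%:R * reg (eps n) x -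
        2 * cpnt k x * cpnt k x * reg (eps n) x ^+ 2) * f x) =
      (fun x => partial k (fun x => reg (eps n) x * cpnt k x) x * f x).
      by apply/funext => x; rewrite partial_reg_cpnt//; exact: eps_gt0.
    by move=> x; apply: cvgM; [exact: (Cn_continuous (Cn_derive (edir k) C1))|exact: cf].
  rewrite -RintegralD//.
  set g := (fun x => _ + _ in LHS).
  have gE : g = fun x => 2 * eps n * reg (eps n) x ^+ 2 * f x.
    apply/funext => x; rewrite /g !eqxx !mul1r.
    have d0 : sqn x + eps n != 0 by rewrite gt_eqF// reg_den// eps_gt0.
    rewrite /reg -mulrDl; congr (_ * _).
    by move: (eps n) d0 => e0 d0; move: d0; rewrite sqnE => d0; field.
  have Ig : L1 g by apply: L1D; exact: I.
  clearbody g.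
  rewrite (Rintegral_affine2 (c := n.+1%:R^-1) 0)// -RintegralZl//; last first.
    by apply: (@L1_affine _ (n.+1%:R^-1) 0 g) => //; rewrite invr_eq0 pnatr_eq0.
  apply: eq_Rintegral => x _; rewrite gE addr0 /bump /reg sqnZ /eps.
  have n0 : (n.+1%:R : R) != 0 by rewrite pnatr_eq0.
  have d0 : 1 + sqn x != 0 by rewrite gt_eqF// ltr_pwDl// sqn_ge0.
  set F := f _; move: (n.+1%:R : R) n0 F => N n0 F.
  move: (sqn x) d0 => q d0.
  have -> : N^-1 ^+ 2 * q + N^-1 ^+ 2 = (1 + q) / N ^+ 2 by field.
  by field; rewrite n0 d0.
have c3 := cvgN c2.
rewrite RintegralZr ?Rintegral_bump -?mulNr// in c3; last exact: L1_bump.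
rewrite -mulNr; apply: Rcvg_unique (c3 _); apply: cvg_trans (c01 _).
by apply: near_eq_cvg; apply: nearW => n; rewrite /= -[RHS]E.
Qed.

(** The logarithm of the regularised square is dominated, uniformly in the
    regularisation, by a multiple of [1/|x|]. *)
Lemma ln_bound (r s a : R) : 0 < a -> a <= r -> a ^+ 2 <= s -> s <= 2 * r ^+ 2 + 1 ->
  `|ln s| <= 2 * (1 + r * (2 * r ^+ 2 + 1)) / a.
Proof.
move=> a0 ar as_ sr; set T := 2 * r ^+ 2 + 1.
have s0 : 0 < s by apply: lt_le_trans as_; rewrite exprn_gt0.
have r0 := lt_le_trans a0 ar.
have T1 : 1 <= T by rewrite lerDr mulr_ge0// sqr_ge0.
pose q := Num.sqrt s; have q0 : 0 < q by rewrite sqrtr_gt0.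
have qE : s = q ^+ 2 by rewrite sqr_sqrtr// ltW.
have aq : a <= q by rewrite -(@ler_pXn2r _ 2) ?nnegrE ?(ltW a0) ?(ltW q0)// -qE.
have qT : q <= T.
  rewrite -(@ler_pXn2r _ 2) ?nnegrE ?(ltW q0)//; last exact: le_trans T1.
  by rewrite -qE (le_trans sr)// expr2 ler_peMl// (le_trans _ T1).
have lnq : `|ln q| <= q^-1 + q.
  rewrite ler_norml; apply/andP; split.
    rewrite lerNl -lnV ?posrE//.
    apply: (@le_trans _ _ q^-1); first by apply/ltW/ln_sublinear; rewrite invr_gt0.
    by rewrite lerDl ltW.
  apply: (@le_trans _ _ q); first exact/ltW/ln_sublinear.
  by rewrite lerDr invr_ge0 ltW.
have -> : ln s = 2 * ln q by rewrite qE lnXn// mulr_natl.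
rewrite normrM ger0_norm// -mulrA ler_wpM2l//.
apply: (le_trans lnq); rewrite ler_pdivlMr// mulrDl; apply: lerD.
  by rewrite mulrC ler_pdivrMr// mul1r.
by rewrite mulrC ler_pM// ltW.
Qed.

(** The logarithmic singularity is too weak to contribute a boundary term. *)
Lemma fundsol_parts i f (r : R) : 0 < r -> Cn 1 setT f -> supp_in r f ->
  \int[leb2]_x (fundsol x * partial i f x) =
  (2 * pi)^-1 * \int[leb2]_x (radial_kernel i x * f x).
Proof.
move=> r0 Cf fr.
have cp k : continuous (partial k f) := Cn_continuous (Cn_derive (edir k) Cf).
have cf := Cn_continuous Cf.
have fp := supp_in_derive (edir i) fr.
have c1 := @cvg_reg_integral i _ r r0 cf fr.
have ml (e : R) : meas2 (fun x => ln (sqn x + e)).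
  apply: (@measurableT_comp _ _ _ _ _ _ (@ln R)); first exact: measurable_ln.
  by apply: measurable_funD; [exact: meas2_sqn|exact: measurable_cst].
have mln : meas2 (fun x => ln (sqn x)).
  by apply: (@measurableT_comp _ _ _ _ _ _ (@ln R)); [exact: measurable_ln|exact: meas2_sqn].
have c2 : \int[leb2]_x (ln (sqn x + eps n) * partial i f x) @[n --> \oo] -->
   \int[leb2]_x (ln (sqn x) * partial i f x).
  have mp := continuous_meas2 (cp i).
  pose C := 2 * (1 + r * (2 * r ^+ 2 + 1)).
  have C0 : 0 <= C.
    by rewrite /C mulr_ge0// addr_ge0// mulr_ge0 ?(ltW r0)// addr_ge0// mulr_ge0// sqr_ge0.
  apply: (@Rdominated_cvg _ _ _ leb2 setT _ _ (fun x => `|C / `|x| * partial i f x|)).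
  - by [].
  - by move=> n; apply: measurable_funM => //; exact: ml.
  - by apply: measurable_funM => //; exact: mln.
  - apply: L1_norm; apply: (@singular_mul_L1 _ _ C r) => //.
    + apply: measurable_funM; first exact: measurable_cst.
      apply: measurable_funV; apply: continuous_meas2; exact: norm_continuous.
    + by move=> x _ _; rewrite ger0_norm// divr_ge0.
  - apply: filterS_ae ae_nonzero => x x0 _.
    apply: cvgM; last exact: cvg_cst.
    apply: (@continuous_cvg _ _ _ _ _ _ (@ln R)); last exact: cvg_sqn_eps.
    by apply: continuous_ln; exact: sqn_gt0.
  - apply: filterS_ae ae_nonzero => x x0 n _.
    have [rx|xr] := ltP r `|x|; first by rewrite /partial (fp x rx) !mulr0.
    rewrite !normrM ler_wpM2r//; apply: (le_trans (_ : _ <= C / `|x|)); last first.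
      by rewrite -normrM -normrM ler_norm.
    have xs := sqn_ge_norm x.
    apply: ln_bound => //; first by rewrite normr_gt0.
      by apply: (le_trans xs); rewrite lerDl (ltW (eps_gt0 n)).
    apply: lerD (eps_le1 n); rewrite /sqn mulr_natl mulr2n.
    by apply: lerD; rewrite -real_normK ?num_real// lerXn2r ?nnegrE ?(ltW r0)//
      (le_trans _ xr)// ?norm_fst_le ?norm_snd_le.
have c3 : \int[leb2]_x (ln (sqn x + eps n) * partial i f x) @[n --> \oo] -->
   - (2 * \int[leb2]_x (radial_kernel i x * f x)).
  under eq_fun do rewrite (ln_reg_parts (eps_gt0 _) i r0 Cf fr).
  by apply: cvgN; apply: cvgM; [exact: cvg_cst|exact: c1].
have E := Rcvg_unique c2 c3.
have If : L1 (fun x => fundsol x * partial i f x).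
  apply: (@singular_mul_L1 _ _ ((2 * pi)^-1 * (2 * r ^+ 2 + 1)) r) => //.
  - by rewrite mulr_ge0 ?invr_ge0 ?mulr_ge0 ?pi_ge0// addr_ge0// mulr_ge0// sqr_ge0.
  - exact: meas2_fundsol.
  - by move=> x x0 xr; exact: fundsol_bound.
have F : \int[leb2]_x (ln (sqn x) * partial i f x) =
    - (4 * pi) * \int[leb2]_x (fundsol x * partial i f x).
  rewrite -RintegralZl//; apply: eq_Rintegral => x _.
  by rewrite fundsolE; have := pi_gt0 R; move: (pi : R) => p p0; field; rewrite gt_eqF.
have -> : \int[leb2]_x (fundsol x * partial i f x) =
    - (4 * pi)^-1 * (- (4 * pi) * \int[leb2]_x (fundsol x * partial i f x)).
  by have := pi_gt0 R; move: (pi : R) => p p0; field; rewrite gt_eqF.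
rewrite -F E; have := pi_gt0 R; move: (pi : R) => p p0; field.
by rewrite gt_eqF.
Qed.

Lemma ord2P (i : 'I_2) : i = 0 \/ i = 1.
Proof. by case: i => [[|[|//]]] h; [left|right]; apply: val_inj. Qed.

(** As [K = - nabla^perp E], the left side is the pairing of [E] with
    [d^perp_i d^perp_l f], and [d^perp_i d^perp_l = delta_il Laplacian - d_i d_l]
    with [- Laplacian E = delta_0]. *)
Lemma biot_savart_fundsol i l f (r : R) : 0 < r -> Cn 2 setT f -> supp_in r f ->
  \int[leb2]_x (biot_savart i x * gradperp l f x) =
  - (i == l)%:R * f 0 - \int[leb2]_x (fundsol x * partial i (partial l f) x).
Proof.
move=> r0 Cf fr.
have C1 k : Cn 1 setT (partial k f) := Cn_derive (edir k) Cf.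
rewrite (fundsol_parts i r0 (C1 l) (supp_in_derive (edir l) fr)) -/(radial_pairing l i f).
have -> : \int[leb2]_x (biot_savart i x * gradperp l f x) =
   (2 * pi)^-1 * psign i * psign l * radial_pairing (pidx l) (pidx i) f.
  rewrite /radial_pairing -RintegralZl//; last first.
    apply: (@singular_mul_L1 _ _ 1 r) => //.
    - exact: meas2_radial_kernel.
    - by move=> x x0 _; exact: radial_kernel_bound.
    - exact: Cn_continuous (C1 _).
    - exact: supp_in_derive.
  apply: eq_Rintegral => x _; rewrite biot_savartE gradperpE /radial_kernel.
  have -> : cpnt i (perp x) = psign i * cpnt (pidx i) x.
    by rewrite /cpnt /psign /pidx /perp; case: ifP => _ /=; ring.
  by ring.
have T := radial_pairing_trace r0 (CnS Cf) fr.
have S := @radial_pairing_sym 0 1 _ r r0 (CnS Cf) fr isT.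
have := pi_gt0 R; move: (pi : R) T => p T p0.
have pn : p != 0 by rewrite gt_eqF.
have T' : f 0 = - (2 * p)^-1 * (radial_pairing 0 0 f + radial_pairing 1 1 f) by rewrite T; field.
rewrite T' {T T'}.
move: ((2 * p)^-1) {p0 pn} => q; move: S.
have [->|->] := ord2P i; have [->|->] := ord2P l; rewrite /psign /pidx /=;
  move: (radial_pairing 0 0 f) (radial_pairing 0 1 f) (radial_pairing 1 0 f) (radial_pairing 1 1 f) => a b c d E; rewrite ?E ?mul0r; ring.
Qed.

End NewtonianPotential.

(** * The Serfati kernels and the Leray projection *)

Section DistributionIdentity.
Context {R : realType}.
Implicit Types (f g h phi psi : R * R -> R) (x y : R * R).

(** The integrability of the right side of [convol_transpose], which allows
    identities between kernels to be integrated. *)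
Lemma convol_transpose_L1 h f phi B P : L1 h -> meas2 f -> (forall y, `|f y| <= B) ->
  L1 phi -> (forall y, `|phi y| <= P) ->
  L1 (fun y => f y * \int[leb2]_x (h (x - y) * phi x)).
Proof.
move=> ih mf fB iphi phiP.
have iF := convol_triple_integrable ih mf fB iphi.
have := Rfubini_integrable2 iF.
have -> // : (fun y => \int[leb2s]_x (h ((x, y).1 - (x, y).2) * f (x, y).2 * phi (x, y).1)) =
  (fun y => f y * \int[leb2]_x (h (x - y) * phi x)).
apply/funext => y /=.
have ihy := integrable_mul_bounded (L1_shift (- y) ih) (L1_measurable iphi) phiP.
rewrite -[RHS](RintegralZl _ measurableT ihy).
by apply: eq_Rintegral => x _; ring.
Qed.

Lemma Rintegral_translate h phi P y : L1 h -> meas2 phi -> (forall y, `|phi y| <= P) ->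
  \int[leb2]_x (h (x - y) * phi x) = \int[leb2]_x (h x * phi (x + y)).
Proof.
move=> ih mphi phiP.
have iz := integrable_mul_bounded (L1_shift (- y) ih) mphi phiP.
by rewrite -(Rintegral_shift y iz); apply: eq_Rintegral => x _; rewrite addrK.
Qed.

Lemma partial_translate i f y : (forall x, differentiable f x) ->
  partial i (fun x => f (x + y)) = fun x => partial i f (x + y).
Proof.
move=> df; apply/funext => x; rewrite /partial.
have -> : (fun x => f (x + y)) = (fun x => f (1 *: x + y)).
  by apply/funext => z; rewrite scale1r.
by rewrite derive_comp_affine// mul1r scale1r.
Qed.

Lemma gradperp_translate l f y : (forall x, differentiable f x) ->
  gradperp l (fun x => f (x + y)) = fun x => gradperp l f (x + y).
Proof. by move=> df; rewrite !gradperpE partial_translate. Qed.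

Lemma supp_translate f (r : R) y : 0 < r -> supp_in r f ->
  exists2 r' : R, 0 < r' & supp_in r' (fun x => f (x + y)).
Proof.
move=> r0 fr; exists (r + `|y|); first by rewrite ltr_pwDl.
move=> x; rewrite -ltrBrDr => h; apply: fr; apply: lt_le_trans h _.
by rewrite lerBlDr -[X in `|X| <= _](addrK y) (le_trans (ler_normD _ _))// normrN.
Qed.

(** A linear relation between pairings of kernels with the translates of test
    functions integrates to the same relation between convolutions. *)
Lemma convol_combine (hM hG hE hK f p pk p3 p4 : R * R -> R) (c B P P3 P4 : R) :
  L1 hM -> L1 hG -> L1 hE -> L1 hK -> meas2 f -> (forall x, `|f x| <= B) ->
  L1 p -> L1 pk -> L1 p3 -> L1 p4 ->
  (forall x, `|p x| <= P) -> (forall x, `|p3 x| <= P3) -> (forall x, `|p4 x| <= P4) ->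
  (forall y, \int[leb2]_x (hM x * p (x + y)) =
     c * pk y + \int[leb2]_x (hG x * p (x + y)) - \int[leb2]_x (hE x * p3 (x + y))
     - \int[leb2]_x (hK x * p4 (x + y))) ->
  \int[leb2]_x (convol hM f x * p x) =
  c * (\int[leb2]_x (f x * pk x))
  + (- (\int[leb2]_x (convol hE f x * p3 x)) + \int[leb2]_x (convol hG f x * p x))
  - \int[leb2]_x (convol hK f x * p4 x).
Proof.
move=> kM kG kE kK mf fB i1 ik i3 i4 b1 b3 b4 H.
rewrite (convol_transpose kM mf fB i1 b1) (convol_transpose kG mf fB i1 b1).
rewrite (convol_transpose kE mf fB i3 b3) (convol_transpose kK mf fB i4 b4).
have t2 := convol_transpose_L1 kG mf fB i1 b1.
have t3 := convol_transpose_L1 kE mf fB i3 b3.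
have t4 := convol_transpose_L1 kK mf fB i4 b4.
have t0 : L1 (fun x => f x * pk x).
  have := integrable_mul_bounded ik mf fB; congr (leb2.-integrable setT (EFin \o _)).
  by apply/funext => x; rewrite mulrC.
rewrite -RintegralZl// -[X in _ + (X + _) - _]mulN1r -RintegralZl//.
rewrite -RintegralD//; last exact: (L1Z (-1) t3).
rewrite -RintegralD//; [|exact: L1Z|by apply: L1D => //; exact: (L1Z (-1) t3)].
rewrite -RintegralB//; last by apply: L1D; [exact: L1Z|apply: L1D => //; exact: (L1Z (-1) t3)].
apply: eq_Rintegral => y _.
rewrite (Rintegral_translate y kM (L1_measurable i1) b1) H.
rewrite (Rintegral_translate y kG (L1_measurable i1) b1).
rewrite (Rintegral_translate y kE (L1_measurable i3) b3).
rewrite (Rintegral_translate y kK (L1_measurable i4) b4).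
ring.
Qed.

Section Identity.
Variables (theta theta' : R * R -> R).
Hypotheses (cth : cutoff theta) (cth' : cutoff theta').

(** All derivatives are moved onto [psi], where [biot_savart_fundsol] applies;
    the pairings of [K] and [E] are then split again by their cut-offs, which
    need not be the same. *)
Lemma kernel_identity i k l psi (r : R) : 0 < r -> smooth psi -> supp_in r psi ->
  \int[leb2]_x (kerM theta' i k l x * psi x) =
  - (i == l)%:R * partial k psi 0
  + \int[leb2]_x (kerG theta k l i x * psi x)
  - \int[leb2]_x ((theta \* fundsol) x * partial i (partial l (partial k psi)) x)
  - \int[leb2]_x ((theta' \* biot_savart i) x * gradperp l (partial k psi) x).
Proof.
move=> r0 spsi psir.
have sk : smooth (partial k psi) := smooth_derive (edir k) spsi.
have kr : supp_in r (partial k psi) := supp_in_derive (edir k) psir.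
have sp : smooth (partial (pidx l) (partial k psi)) := smooth_derive (edir (pidx l)) sk.
have pr : supp_in r (partial (pidx l) (partial k psi)) := supp_in_derive (edir (pidx l)) kr.
have sl : smooth (partial l (partial k psi)) := smooth_derive (edir l) sk.
have lr : supp_in r (partial l (partial k psi)) := supp_in_derive (edir l) kr.
have sil : smooth (partial i (partial l (partial k psi))) := smooth_derive (edir i) sl.
have ilr : supp_in r (partial i (partial l (partial k psi))) := supp_in_derive (edir i) lr.
have M : \int[leb2]_x (kerM theta' i k l x * psi x) =
    \int[leb2]_x (biot_savart i x * gradperp l (partial k psi) x)
    - \int[leb2]_x ((theta' \* biot_savart i) x * gradperp l (partial k psi) x).
  have gE : gradperp l (partial k psi) = fun x => psign l * partial (pidx l) (partial k psi) x.
    exact: gradperpE.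
  have Cc n := Cn_cutK cth' n i.
  transitivity (\int[leb2]_x (cutK theta' i x * gradperp l (partial k psi) x)).
    rewrite gE (kerME cth').
    have -> : \int[leb2]_x (psign l * partial k (partial (pidx l) (cutK theta' i)) x * psi x) =
        \int[leb2]_x (partial k (fun x => psign l * partial (pidx l) (cutK theta' i) x) x * psi x).
      apply: eq_Rintegral => x _; congr (_ * _); rewrite /partial [RHS]deriveZ//.
      exact: diff_derivable (Cn_differentiable (Cn_derive (edir (pidx l)) (Cc 1%N)) I).
    rewrite (Rintegral_parts k r0 _ (smooth_Cn 1 _ spsi) psir); last first.
      by apply: CnZ; [exact: openT|exact: Cn_derive (Cc 2%N)].
    transitivity (- \int[leb2]_x (partial (pidx l) (cutK theta' i) x * (psign l * partial k psi x))).
      by congr (- _); apply: eq_Rintegral => x _; rewrite mulrCA mulrA.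
    rewrite (Rintegral_parts (pidx l) r0 (Cc 1%N)); last 2 first.
    - by apply: CnZ; [exact: openT|exact: smooth_Cn].
    - by move=> x /kr h; rewrite h mulr0.
    rewrite opprK; apply: eq_Rintegral => x _; congr (_ * _); rewrite /partial [LHS]deriveZ//.
    exact: diff_derivable (Cn_differentiable (smooth_Cn 0 setT sk) I).
  have gc : continuous (gradperp l (partial k psi)).
    by rewrite gE => x; apply: cvgM; [exact: cvg_cst|exact: (smooth_continuous sp)].
  have gr : supp_in r (gradperp l (partial k psi)).
    by rewrite gE => x /pr h; rewrite h mulr0.
  have [P P0 gP] := supp_bounded gc gr.
  rewrite -RintegralB//; last 2 first.
  - apply: (@singular_mul_L1 _ _ _ ((2 * pi)^-1) r) => //.
    + by rewrite invr_ge0 mulr_ge0// pi_ge0.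
    + exact: meas2_biot_savart.
    + by move=> x x0 _; exact: biot_savart_bound.
  - exact: (integrable_mul_bounded (L1_cut_biot_savart cth' i) (continuous_meas2 gc) gP).
  by apply: eq_Rintegral => x _; rewrite /cutK /=; ring.
have G : \int[leb2]_x (kerG theta k l i x * psi x) =
    \int[leb2]_x ((theta \* fundsol) x * partial i (partial l (partial k psi)) x)
    - \int[leb2]_x (fundsol x * partial i (partial l (partial k psi)) x).
  have Cc n := Cn_cutE cth n.
  have gc : continuous (partial i (partial l (partial k psi))) := smooth_continuous sil.
  have [P P0 gP] := supp_bounded gc ilr.
  rewrite /kerG (Rintegral_parts k r0 _ (smooth_Cn 1 _ spsi) psir); last first.
    exact: Cn_derive (Cn_derive _ (Cc 3%N)).
  rewrite (Rintegral_parts l r0 _ (smooth_Cn 1 _ sk) kr); last first.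
    exact: Cn_derive (Cc 2%N).
  have E3 := Rintegral_parts i r0 (Cc 1%N) (smooth_Cn 1 setT sl) lr.
  rewrite [X in - - X = _]E3.
  rewrite [LHS]opprK.
  rewrite -RintegralB//; last 2 first.
  - exact: (integrable_mul_bounded (L1_cut_fundsol cth) (continuous_meas2 gc) gP).
  - apply: (@singular_mul_L1 _ _ _ ((2 * pi)^-1 * (2 * r ^+ 2 + 1)) r) => //.
    + by rewrite mulr_ge0 ?invr_ge0 ?mulr_ge0 ?pi_ge0// addr_ge0// mulr_ge0// sqr_ge0.
    + exact: meas2_fundsol.
    + by move=> x x0 xr; exact: fundsol_bound.
  have I1 := integrable_mul_bounded (L1_cut_fundsol cth) (continuous_meas2 gc) gP.
  have I2 : L1 (fun x => fundsol x * partial i (partial l (partial k psi)) x).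
    apply: (@singular_mul_L1 _ _ _ ((2 * pi)^-1 * (2 * r ^+ 2 + 1)) r) => //.
    + by rewrite mulr_ge0 ?invr_ge0 ?mulr_ge0 ?pi_ge0// addr_ge0// mulr_ge0// sqr_ge0.
    + exact: meas2_fundsol.
    + by move=> x x0 xr; exact: fundsol_bound.
  rewrite -[LHS]mulN1r -RintegralZl//; last first.
    have := L1B I2 I1; congr (leb2.-integrable setT (EFin \o _)).
    by apply/funext => x /=; ring.
  by apply: eq_Rintegral => x _ /=; ring.
rewrite M G (biot_savart_fundsol i l r0 (smooth_Cn 2 _ sk) kr).
have key (a b c d : R) : a - b - d = a + (c - b) - c - d by ring.
exact: key.
Qed.

(** Summed over [k] and [l], the first two terms on the right are the Leray
    projection of the divergence; the last one is small when [theta'] is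
    concentrated near the origin, with [theta] fixed. *)
Lemma convol_identity i k l f phi (B : R) : meas2 f -> (forall x, `|f x| <= B) -> test phi ->
  \int[leb2]_x (convol (kerM theta' i k l) f x * phi x) =
  - (i == l)%:R * (\int[leb2]_x (f x * partial k phi x))
  + gamma_conv theta k l i f phi
  - \int[leb2]_x (convol (theta' \* biot_savart i) f x * gradperp l (partial k phi) x).
Proof.
move=> mf fB tphi; have [sphi [r r0 phir]] := test_supp tphi.
have sk : smooth (partial k phi) := smooth_derive (edir k) sphi.
have kr : supp_in r (partial k phi) := supp_in_derive (edir k) phir.
have sp : smooth (partial (pidx l) (partial k phi)) := smooth_derive (edir (pidx l)) sk.
have pr : supp_in r (partial (pidx l) (partial k phi)) := supp_in_derive (edir (pidx l)) kr.
have sl : smooth (partial l (partial k phi)) := smooth_derive (edir l) sk.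
have sil : smooth (partial i (partial l (partial k phi))) := smooth_derive (edir i) sl.
have ilr : supp_in r (partial i (partial l (partial k phi))) := supp_in_derive (edir i) (supp_in_derive (edir l) kr).
have [P1 _ b1] := supp_bounded (smooth_continuous sphi) phir.
have [P3 _ b3] := supp_bounded (smooth_continuous sil) ilr.
have gE : gradperp l (partial k phi) = fun x => psign l * partial (pidx l) (partial k phi) x.
  exact: gradperpE.
have gc : continuous (gradperp l (partial k phi)).
  by rewrite gE => x; apply: cvgM; [exact: cvg_cst|exact: (smooth_continuous sp)].
have gr : supp_in r (gradperp l (partial k phi)).
  by rewrite gE => x /pr h; rewrite h mulr0.
have [P4 _ b4] := supp_bounded gc gr.
have i1 := supp_L1 (smooth_continuous sphi) phir.
have ik := supp_L1 (smooth_continuous sk) kr.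
have i3 : L1 (partial i (partial l (partial k phi))) := supp_L1 (smooth_continuous sil) ilr.
have i4 := supp_L1 gc gr.
have kM := L1_kerM cth' i k l.
have kG := L1_kerG cth k l i.
have kE := L1_cut_fundsol cth.
have kK := L1_cut_biot_savart cth' i.
have -> : gamma_conv theta k l i f phi =
    - (\int[leb2]_x (convol (theta \* fundsol) f x * partial i (partial l (partial k phi)) x))
    + \int[leb2]_x (convol (kerG theta k l i) f x * phi x).
  by rewrite /gamma_conv /dderive /fun_dist opprK.
apply: (convol_combine kM kG kE kK mf fB i1 ik i3 i4 b1 b3 b4) => y.
have [r' r'0 psir] := supp_translate y r0 phir.
have spsi : smooth (fun x => phi (x + y)).
  have := smooth_affine 1 y sphi; congr smooth; apply/funext => x.
  by rewrite scale1r.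
have dphi x : differentiable phi x := Cn_differentiable (smooth_Cn 0 setT sphi) I.
have dk x : differentiable (partial k phi) x := Cn_differentiable (smooth_Cn 0 setT sk) I.
have dl x : differentiable (partial l (partial k phi)) x :=
  Cn_differentiable (smooth_Cn 0 setT sl) I.
have K := @kernel_identity i k l _ r' r'0 spsi psir.
have E1 := partial_translate k y dphi.
have E4 := gradperp_translate l y dk.
have E2 := partial_translate l y dk.
have E3 := partial_translate i y dl.
by rewrite E1 E2 E3 E4 add0r in K.
Qed.

End Identity.
End DistributionIdentity.

(** * Cosine transforms of test functions *)

Section CosineTransform.
Context {R : realType}.
Notation mu := (@lebesgue_measure R).
Implicit Types (f g h : R * R -> R) (x y v xi : R * R).

(** For an even [g] this is the Fourier transform, which is then real. *)
Definition cosT g x : R := \int[leb2]_xi (g xi * cos (dot x xi)).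
Definition sinT g x : R := \int[leb2]_xi (g xi * sin (dot x xi)).

Lemma dotC x y : dot x y = dot y x.
Proof. by rewrite /dot mulrC [X in _ + X]mulrC. Qed.

Lemma dotBl x y z : dot (x - y) z = dot x z - dot y z.
Proof. by rewrite /dot /=; ring. Qed.

Lemma dotZl (c : R) x y : dot (c *: x) y = c * dot x y.
Proof. by rewrite /dot /= /GRing.scale /=; ring. Qed.

Lemma dotZr (c : R) x y : dot x (c *: y) = c * dot x y.
Proof. by rewrite dotC dotZl dotC. Qed.

Lemma dotNr x y : dot x (- y) = - dot x y.
Proof. by rewrite /dot /=; ring. Qed.

Lemma norm_dot_le x y : `|dot x y| <= 2 * `|x| * `|y|.
Proof.
rewrite /dot (le_trans (ler_normD _ _))// !normrM -mulrA mulr_natl mulr2n.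
by apply: lerD; apply: ler_pM => //; rewrite ?norm_fst_le ?norm_snd_le.
Qed.

Lemma Cn_dot n x : Cn n setT (dot x).
Proof.
by apply: CnD; [exact: openT| |]; apply: CnM; first [exact: openT|exact: (Cn_cst _ _ openT)
  |exact: Cn_fst|exact: Cn_snd].
Qed.

Lemma derive_dot x v xi : 'D_v (dot x) xi = dot x v.
Proof.
have d1 : derivable (fun y : R * R => x.1 * y.1) xi v.
  by apply: diff_derivable; apply: (Cn_differentiable (n := 0) (U := setT)) => //;
    apply: CnM; [exact: openT|exact: (Cn_cst _ _ openT)|exact: Cn_fst].
have d2 : derivable (fun y : R * R => x.2 * y.2) xi v.
  by apply: diff_derivable; apply: (Cn_differentiable (n := 0) (U := setT)) => //;
    apply: CnM; [exact: openT|exact: (Cn_cst _ _ openT)|exact: Cn_snd].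
transitivity ('D_v (fun y : R * R => x.1 * y.1) xi + 'D_v (fun y : R * R => x.2 * y.2) xi).
  exact: (@deriveD _ _ _ (fun y : R * R => x.1 * y.1) (fun y : R * R => x.2 * y.2) xi v d1 d2).
have e1 := deriveZ x.1 (@diff_derivable _ _ _ _ _ v (differentiable_fst xi)).
have e2 := deriveZ x.2 (@diff_derivable _ _ _ _ _ v (differentiable_snd xi)).
rewrite [X in X + _]e1 [X in _ + X]e2.
by rewrite derive_fst derive_snd.
Qed.

Lemma derive_scalar_comp (s : R -> R) (a ds : R) f v xi : differentiable f xi ->
  f xi = a -> is_derive a (1 : R) s ds -> 'D_v (fun y => s (f y)) xi = 'D_v f xi * ds.
Proof.
move=> df <- d.
have dl : differentiable s (f xi).
  by apply/derivable1_diffP; exact: (@ex_derive _ _ _ _ _ _ _ d).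
rewrite [LHS](@derive_compose _ _ _ f s)//.
rewrite [X in 'D_X _ _](_ : _ = ('D_v f xi) *: (1 : R)); last by rewrite /GRing.scale /= mulr1.
by rewrite deriveZdir// (@derive_val _ _ _ _ _ _ _ d).
Qed.

Lemma derive_sin_dot x v xi : 'D_v (fun y => sin (dot x y)) xi = dot x v * cos (dot x xi).
Proof.
by rewrite (derive_scalar_comp _ (Cn_differentiable (Cn_dot 0 x) I) erefl (is_derive_sin _))
  derive_dot.
Qed.

Lemma derive_cos_dot x v xi : 'D_v (fun y => cos (dot x y)) xi = - (dot x v * sin (dot x xi)).
Proof.
by rewrite (derive_scalar_comp _ (Cn_differentiable (Cn_dot 0 x) I) erefl (is_derive_cos _))
  derive_dot mulrN.
Qed.

Lemma differentiable_sin_dot x xi : differentiable (fun y => sin (dot x y)) xi.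
Proof.
apply: (@differentiable_comp _ _ _ _ (dot x) sin); first exact: Cn_differentiable (Cn_dot 0 x) I.
by apply/derivable1_diffP; exact: (@ex_derive _ _ _ _ _ _ _ (is_derive_sin _)).
Qed.

Lemma differentiable_cos_dot x xi : differentiable (fun y => cos (dot x y)) xi.
Proof.
apply: (@differentiable_comp _ _ _ _ (dot x) cos); first exact: Cn_differentiable (Cn_dot 0 x) I.
by apply/derivable1_diffP; exact: (@ex_derive _ _ _ _ _ _ _ (is_derive_cos _)).
Qed.

Lemma Cn1_sin_dot x : Cn 1 setT (fun y => sin (dot x y)).
Proof.
apply/CnSE; split=> [xi _|v]; first exact: differentiable_sin_dot.
have -> : 'D_v (fun y => sin (dot x y)) = fun xi => dot x v * cos (dot x xi).
  by apply/funext => xi; rewrite derive_sin_dot.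
by apply: CnZ; [exact: openT|apply/Cn0E => xi _; exact: differentiable_cos_dot].
Qed.

Lemma Cn1_cos_dot x : Cn 1 setT (fun y => cos (dot x y)).
Proof.
apply/CnSE; split=> [xi _|v]; first exact: differentiable_cos_dot.
have -> : 'D_v (fun y => cos (dot x y)) = fun xi => - (dot x v * sin (dot x xi)).
  by apply/funext => xi; rewrite derive_cos_dot.
apply: CnN; first exact: openT.
by apply: CnZ; [exact: openT|apply/Cn0E => xi _; exact: differentiable_sin_dot].
Qed.

Lemma dot_edir x i : dot x (edir i) = cpnt i x.
Proof. by rewrite /dot /edir /cpnt; case: ifP => _ /=; rewrite mulr1 mulr0 ?addr0 ?add0r. Qed.

Lemma meas2_cos_dot x : meas2 (fun xi => cos (dot x xi)).
Proof. by apply: continuous_meas2; exact: Cn_continuous (Cn1_cos_dot x). Qed.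

Lemma meas2_sin_dot x : meas2 (fun xi => sin (dot x xi)).
Proof. by apply: continuous_meas2; exact: Cn_continuous (Cn1_sin_dot x). Qed.

Lemma norm_cos_le (t : R) : `|cos t| <= 1.
Proof. by rewrite ler_norml cos_geN1 cos_le1. Qed.

Lemma norm_sin_le (t : R) : `|sin t| <= 1.
Proof. by rewrite ler_norml sin_geN1 sin_le1. Qed.

Lemma L1_mul_cos g x : L1 g -> L1 (fun xi => g xi * cos (dot x xi)).
Proof. by move=> ig; apply: integrable_mul_bounded ig (meas2_cos_dot x) (fun y => norm_cos_le _). Qed.

Lemma L1_mul_sin g x : L1 g -> L1 (fun xi => g xi * sin (dot x xi)).
Proof. by move=> ig; apply: integrable_mul_bounded ig (meas2_sin_dot x) (fun y => norm_sin_le _). Qed.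

Lemma cosT_bound g x : L1 g -> `|cosT g x| <= \int[leb2]_xi `|g xi|.
Proof.
move=> ig; apply: le_norm_Rintegral2; first exact: L1_norm.
  exact: L1_measurable (L1_mul_cos x ig).
by move=> xi; rewrite normrM ler_piMr// norm_cos_le.
Qed.

(** Integration by parts exchanges a factor [x_i] for a derivative of [g]. *)
Lemma cosT_parts i g (r : R) x : 0 < r -> Cn 1 setT g -> supp_in r g ->
  cpnt i x * cosT g x = - sinT (partial i g) x.
Proof.
move=> r0 Cg gr.
have := Rintegral_parts i r0 (Cn1_sin_dot x) Cg gr.
have ig := supp_L1 (Cn_continuous Cg) gr.
have -> : \int[leb2]_xi (partial i (fun y => sin (dot x y)) xi * g xi) = cpnt i x * cosT g x.
  rewrite -RintegralZl//; last exact: L1_mul_cos.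
  by apply: eq_Rintegral => xi _; rewrite /partial derive_sin_dot dot_edir; ring.
by move=> ->; congr (- _); apply: eq_Rintegral => xi _; rewrite mulrC.
Qed.

Lemma sinT_parts i g (r : R) x : 0 < r -> Cn 1 setT g -> supp_in r g ->
  cpnt i x * sinT g x = cosT (partial i g) x.
Proof.
move=> r0 Cg gr.
have := Rintegral_parts i r0 (Cn1_cos_dot x) Cg gr.
have ig := supp_L1 (Cn_continuous Cg) gr.
have -> : \int[leb2]_xi (partial i (fun y => cos (dot x y)) xi * g xi) = - (cpnt i x * sinT g x).
  rewrite -mulNr -RintegralZl//; last exact: L1_mul_sin.
  by apply: eq_Rintegral => xi _; rewrite /partial derive_cos_dot dot_edir; ring.
move=> /eqP; rewrite eqr_opp => /eqP ->.
by apply: eq_Rintegral => xi _; rewrite mulrC.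
Qed.

(** The operator [1 - d_i^2]; on the Fourier side it is the multiplication by
    [1 + x_i^2]. *)
Definition helmholtz i g : R * R -> R := fun xi => g xi - partial i (partial i g) xi.

Lemma smooth_sub f g : smooth f -> smooth g -> smooth (fun x => f x - g x).
Proof.
move=> sf sg; apply: Cn_smooth => n; apply: CnD; [exact: openT|exact: smooth_Cn|].
by apply: CnN; [exact: openT|exact: smooth_Cn].
Qed.

Lemma smooth_helmholtz i g : smooth g -> smooth (helmholtz i g).
Proof. by move=> sg; apply: smooth_sub => //; do 2 apply: smooth_derive. Qed.

Lemma supp_helmholtz i (r : R) g : supp_in r g -> supp_in r (helmholtz i g).
Proof.
move=> gr x rx; rewrite /helmholtz gr// sub0r /partial.
by rewrite (supp_in_derive (edir i) (supp_in_derive (edir i) gr) rx) oppr0.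
Qed.

Lemma cosT_helmholtz i g (r : R) x : 0 < r -> smooth g -> supp_in r g ->
  (1 + cpnt i x ^+ 2) * cosT g x = cosT (helmholtz i g) x.
Proof.
move=> r0 sg gr.
have sp : smooth (partial i g) := smooth_derive (edir i) sg.
have pr : supp_in r (partial i g) := supp_in_derive (edir i) gr.
have sq : smooth (partial i (partial i g)) := smooth_derive (edir i) sp.
have qr : supp_in r (partial i (partial i g)) := supp_in_derive (edir i) pr.
have ig := supp_L1 (smooth_continuous sg) gr.
have iq := supp_L1 (smooth_continuous sq) qr.
rewrite mulrDl mul1r expr2 -mulrA (cosT_parts i x r0 (smooth_Cn 1 _ sg) gr) mulrN.
rewrite (sinT_parts i x r0 (smooth_Cn 1 _ sp) pr) /cosT -RintegralB//; try exact: L1_mul_cos.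
by apply: eq_Rintegral => xi _; rewrite -mulrBl.
Qed.

(** Induction on [n], replacing [g] by [(1 - d_1^2) (1 - d_2^2) g]. *)
Lemma cosT_decay n g (r : R) : 0 < r -> smooth g -> supp_in r g ->
  exists2 M : R, 0 < M & forall x,
    ((1 + x.1 ^+ 2) * (1 + x.2 ^+ 2)) ^+ n * `|cosT g x| <= M.
Proof.
move=> r0; elim: n g => [|n IH] g sg gr.
  have ig := supp_L1 (smooth_continuous sg) gr.
  exists (1 + \int[leb2]_xi `|g xi|); first by rewrite ltr_pwDl// Rintegral_norm_ge0.
  by move=> x; rewrite expr0 mul1r (le_trans (cosT_bound x ig))// lerDr.
have s0 := smooth_helmholtz 0 sg; have r0' := supp_helmholtz 0 gr.
have [M M0 h] := IH _ (smooth_helmholtz 1 s0) (supp_helmholtz 1 r0').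
exists M => // x; apply: le_trans (h x).
rewrite -(cosT_helmholtz 1 x r0 s0 r0') -(cosT_helmholtz 0 x r0 sg gr) !normrM.
rewrite /cpnt /= !(@ger0_norm _ (1 + _)) ?addr_ge0 ?sqr_ge0// exprSr.
by rewrite -!mulrA [X in _ <= _ * X]mulrCA.
Qed.

Lemma ler_norm_cosB (a b : R) : `|cos a - cos b| <= `|a - b|.
Proof.
wlog ab : a b / a <= b.
  by move=> W; have [/W//|/ltW/W] := leP a b; rewrite distrC [leRHS]distrC.
have [|c _ E] := @MVT_segment _ cos (fun t => - sin t) a b ab.
  by apply: continuous_subspaceT; exact: continuous_cos.
by rewrite distrC E normrM normrN distrC ler_piMl// norm_sin_le.
Qed.

Lemma cosT_lipschitz g (r : R) : continuous g -> supp_in r g ->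
  exists2 L : R, 0 < L & forall x y, `|cosT g x - cosT g y| <= L * `|x - y|.
Proof.
move=> cg gr; have ig := supp_L1 cg gr.
have cn : continuous (fun xi : R * R => `|xi|) by exact: norm_continuous.
have cgn : continuous (fun xi => g xi * `|xi|) by move=> x; apply: cvgM; [exact: cg|exact: cn].
have im : L1 (fun xi => g xi * `|xi|) := supp_L1 cgn (supp_inM _ gr).
have I0 := Rintegral_norm_ge0 (fun xi => g xi * `|xi|).
exists (1 + 2 * \int[leb2]_xi `|g xi * `|xi| |).
  by rewrite ltr_pwDl// mulr_ge0.
move=> x y; rewrite /cosT -RintegralB//; try exact: L1_mul_cos.
have iz := L1Z (2 * `|x - y|) (L1_norm im).
apply: (@le_trans _ _ (\int[leb2]_xi (2 * `|x - y| * `|g xi * `|xi| |))).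
  apply: le_norm_Rintegral2 => //.
    by apply: L1_measurable; apply: L1B; exact: L1_mul_cos.
  move=> xi; rewrite -mulrBr !normrM normr_id mulrCA ler_wpM2l//.
  apply: (le_trans (ler_norm_cosB _ _)); rewrite -dotBl; exact: norm_dot_le.
rewrite RintegralZl//; last exact: L1_norm.
by rewrite mulrAC ler_wpM2r// lerDr.
Qed.

Lemma cosT_continuous g (r : R) : continuous g -> supp_in r g -> continuous (cosT g).
Proof.
move=> cg gr x; have [L L0 lip] := cosT_lipschitz cg gr.
apply/cvgrPdist_le => e e0; near=> y.
apply: (le_trans (lip _ _)); rewrite mulrC -ler_pdivlMr//.
near: y; apply: cvgr_dist_le => //; exact: divr_gt0.
Unshelve. all: by end_near. Qed.

Lemma tail_sqr_le (t : R) : (1 + t ^+ 2)^-1 <= 2 * (1 + `|t|) ^- 2.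
Proof.
have t0 : 0 < 1 + t ^+ 2 by rewrite ltr_pwDl// sqr_ge0.
have a0 : 0 < 1 + `|t| by rewrite ltr_pwDl.
rewrite ler_pdivlMr ?exprn_gt0// mulrC ler_pdivrMr//.
have h : 0 <= (1 - `|t|) ^+ 2 by exact: sqr_ge0.
by rewrite -[t ^+ 2]real_normK ?num_real//; move: (`|t|) h => a; nra.
Qed.

(** The transform decays faster than any power, so that its small powers are
    integrable too. *)
Lemma cosT_power_L1 g (r s : R) : 0 < r -> smooth g -> supp_in r g -> 0 < s ->
  L1 (fun x => `|cosT g x| `^ s).
Proof.
move=> r0 sg gr s0.
have mk := continuous_meas2 (cosT_continuous (smooth_continuous sg) gr).
(* With [n s >= 1] one factor [(1 + x.1^2) (1 + x.2^2)] is gained. *)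
pose n := (Num.truncn s^-1).+1.
have ns : 1 <= n%:R * s.
  by rewrite -ler_pdivrMr// mul1r ltW// truncnS_gt.
have [M M0 h] := cosT_decay n r0 sg gr.
apply: (@L1_le_weight _ _ 2 (M `^ s * 4)); first by rewrite ltr1n.
  apply: (@measurableT_comp _ _ _ _ _ _ (fun t : R => `|t| `^ s)) => //.
  by apply: (measurableT_comp (measurable_powR s)); exact: normr_measurable.
move=> x; rewrite ger0_norm ?powR_ge0//.
have q1 : 1 <= 1 + x.1 ^+ 2 by rewrite lerDl sqr_ge0.
have q2 : 1 <= 1 + x.2 ^+ 2 by rewrite lerDl sqr_ge0.
have qq : 1 <= (1 + x.1 ^+ 2) * (1 + x.2 ^+ 2) by apply: mulr_ege1.
have qp := lt_le_trans ltr01 qq.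
apply: (@le_trans _ _ (M `^ s * ((1 + x.1 ^+ 2) * (1 + x.2 ^+ 2))^-1)).
  rewrite ler_pdivlMr// -[X in _ * X]powRr1 ?(ltW qp)//.
  apply: (@le_trans _ _ (`|cosT g x| `^ s * ((1 + x.1 ^+ 2) * (1 + x.2 ^+ 2)) `^ (n%:R * s))).
    by rewrite ler_wpM2l ?powR_ge0// ler_powR.
  rewrite powRrM -powRM ?powR_ge0// powR_mulrn ?(ltW qp)// mulrC.
  by rewrite ge0_ler_powR ?nnegrE ?(ltW s0) ?(ltW M0)// mulr_ge0// exprn_ge0// ltW.
rewrite -mulrA ler_wpM2l ?powR_ge0// invfM /weight.
have te t : tail 2 t = (1 + `|t|) ^- 2 :> R by rewrite /tail powRN powR_mulrn// addr_ge0.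
rewrite !te (_ : 4 = 2 * 2 :> R); last by ring.
rewrite mulrACA; apply: ler_pM; rewrite ?invr_ge0 ?tail_sqr_le//; exact: le_trans ler01 _.
Qed.

(** The geometric mean of two upper bounds is an upper bound. *)
Lemma interpolate (d A X a : R) : 0 <= a -> a < 1 -> 0 <= d -> d <= A -> d <= X ->
  d <= A `^ a * X `^ (1 - a).
Proof.
move=> a0 a1 d0 dA dX; have s0 : 0 < 1 - a by rewrite subr_gt0.
have [->|dn] := eqVneq d 0; first by rewrite mulr_ge0// powR_ge0.
have -> : d = d `^ a * d `^ (1 - a).
  rewrite -powRD; first by rewrite addrC subrK powRr1.
  by apply/implyP => _.
have A0 := le_trans d0 dA; have X0 := le_trans d0 dX.
by apply: ler_pM; rewrite ?powR_ge0//; apply: ge0_ler_powR; rewrite ?nnegrE ?(ltW s0).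
Qed.

Lemma powR_add_le (p q s : R) : 0 <= p -> 0 <= q -> 0 <= s -> s <= 1 ->
  (p + q) `^ s <= 2 * (p `^ s + q `^ s).
Proof.
move=> p0 q0 s0 s1; wlog pq : p q p0 q0 / p <= q.
  by move=> W; have [/W|/ltW/W] := leP p q; [apply|rewrite addrC [X in _ <= 2 * X]addrC; apply].
apply: (@le_trans _ _ ((2 * q) `^ s)).
  rewrite ge0_ler_powR ?nnegrE ?addr_ge0 ?mulr_ge0//.
  by rewrite mulr_natl mulr2n lerD2r.
rewrite powRM//; apply: ler_pM; rewrite ?powR_ge0//; last by rewrite lerDr powR_ge0.
by rewrite -[leRHS]powRr1// ler_powR// ler1n.
Qed.

(** Interpolation between the Lipschitz bound [L |w|] and the size of the two
    values, the latter raised to the power [1 - a], which is still integrable. *)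
Lemma cosT_modulus g (r a : R) : 0 < r -> smooth g -> supp_in r g -> 0 <= a -> a < 1 ->
  exists2 C : R, 0 < C & forall w,
    \int[leb2]_b `|cosT g (b - w) - cosT g b| <= C * `|w| `^ a.
Proof.
move=> r0 sg gr a0 a1.
have cg := smooth_continuous sg.
have [L L0 lip] := cosT_lipschitz cg gr.
have ck := cosT_continuous cg gr.
have mk := continuous_meas2 ck.
have s0 : 0 < 1 - a by rewrite subr_gt0.
have ip := cosT_power_L1 r0 sg gr s0.
have I0 : 0 <= \int[leb2]_x (`|cosT g x| `^ (1 - a)).
  by apply: Rintegral_ge0 => x _; exact: powR_ge0.
exists (1 + 4 * L `^ a * \int[leb2]_x (`|cosT g x| `^ (1 - a))).
  by rewrite ltr_pwDl// !mulr_ge0// powR_ge0.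
move=> w.
have ipw : L1 (fun b => `|cosT g (b - w)| `^ (1 - a)) := L1_shift (- w) ip.
have isum := L1Z (L `^ a * `|w| `^ a * 2) (L1D ipw ip).
apply: (@le_trans _ _ (\int[leb2]_b (L `^ a * `|w| `^ a * 2 *
   (`|cosT g (b - w)| `^ (1 - a) + `|cosT g b| `^ (1 - a))))).
  have mkw : meas2 (fun b => cosT g (b - w)).
    have := meas2_affine 1 (- w) mk; congr (measurable_fun _ _).
    by apply/funext => b; rewrite scale1r.
  have id : meas2 (fun b => `|cosT g (b - w) - cosT g b|).
    by apply: measurableT_comp => //; exact: measurable_funB.
  apply: (le_trans (ler_norm _)); apply: le_norm_Rintegral2 => // b.
  rewrite normr_id -mulrA -powRM ?(ltW L0)//.
  apply: (@le_trans _ _ ((L * `|w|) `^ a * (`|cosT g (b - w)| + `|cosT g b|) `^ (1 - a))).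
    apply: interpolate => //; last exact: ler_normB.
    by apply: (le_trans (lip _ _)); rewrite addrAC subrr add0r normrN.
  by rewrite ler_wpM2l ?powR_ge0// powR_add_le ?(ltW s0)// gerBl.
rewrite [leLHS](RintegralZl _ measurableT (L1D ipw ip)).
rewrite [X in _ * X <= _](RintegralD measurableT ipw ip) [X in _ * (X + _) <= _](Rintegral_shift (- w) ip).
rewrite mulrDl.
rewrite [X in _ <= _ + X](_ : _ = L `^ a * `|w| `^ a * 2 *
    (\int[leb2]_x `|cosT g x| `^ (1 - a) + \int[leb2]_x `|cosT g x| `^ (1 - a))).
  by rewrite lerDr mul1r powR_ge0.
move: (\int[leb2]_x _) => I; ring.
Qed.

End CosineTransform.

(** * The low-pass kernel *)

Section Lowpass.
Context {R : realType}.
Notation mu := (@lebesgue_measure R).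
Implicit Types (f g h p : R * R -> R) (x y v w z xi : R * R).

Variable chi : R * R -> R.
Hypothesis chi_symbol : lowpass_symbol chi.

Let cchi : cutoff chi := lowpass_cutoff chi_symbol.

Lemma chi_smooth : smooth chi.
Proof. by case: chi_symbol. Qed.

Lemma chi_supp : exists2 r : R, 0 < r & supp_in r chi.
Proof. exact: cutoff_supp cchi. Qed.

Lemma chi_L1 : L1 chi.
Proof. by have [r r0 h] := chi_supp; exact: supp_L1 (smooth_continuous chi_smooth) h. Qed.

(** The inverse Fourier transform of [chi (lam .)], real because [chi] is
    even. *)
Definition lowpass_kernel (lam : R) x : R :=
  (2 * pi) ^- 2 * cosT (fun xi => chi (lam *: xi)) x.

Lemma lowpass_kernel_scale (lam : R) x : 0 < lam ->
  lowpass_kernel lam x = lam ^- 2 * lowpass_kernel 1 (lam^-1 *: x).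
Proof.
move=> l0; have ln : lam != 0 by rewrite gt_eqF.
rewrite /lowpass_kernel mulrCA; congr (_ * _).
have e1 : (fun xi => chi (1 *: xi)) = chi by apply/funext => xi; rewrite scale1r.
rewrite e1 /cosT (Rintegral_affine2 0 ln (L1_mul_cos (lam^-1 *: x) chi_L1)).
rewrite mulrA mulVf ?expf_neq0// mul1r; apply: eq_Rintegral => xi _.
by rewrite addr0 dotZl dotZr mulrA mulVf// mul1r.
Qed.

Lemma lowpass_kernel_cosT (lam : R) : 0 < lam ->
  lowpass_kernel lam = fun x => ((2 * pi) ^- 2 * lam ^- 2) * cosT chi (lam^-1 *: x + 0).
Proof.
move=> l0; apply/funext => x; rewrite lowpass_kernel_scale// /lowpass_kernel addr0.
have e1 : (fun xi => chi (1 *: xi)) = chi by apply/funext => xi; rewrite scale1r.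
by rewrite e1; ring.
Qed.

Lemma L1_cosT_chi : L1 (cosT chi).
Proof.
have [r r0 h] := chi_supp.
have ip := cosT_power_L1 r0 chi_smooth h ltr01.
have mk := continuous_meas2 (cosT_continuous (smooth_continuous chi_smooth) h).
by apply: (integrable_dominated ip mk) => x; rewrite powRr1.
Qed.

Lemma lowpass_kernel_L1 (lam : R) : 0 < lam -> L1 (lowpass_kernel lam).
Proof.
move=> l0; rewrite lowpass_kernel_cosT//; apply: L1Z; apply: L1_affine L1_cosT_chi.
by rewrite invr_eq0 gt_eqF.
Qed.

Lemma lowpass_kernel_bounded (lam : R) : 0 < lam ->
  exists2 P : R, 0 < P & forall x, `|lowpass_kernel lam x| <= P.
Proof.
move=> l0; pose c : R := (2 * pi) ^- 2 * lam ^- 2.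
exists (1 + `|c| * \int[leb2]_xi `|chi xi|).
  by rewrite ltr_pwDl// mulr_ge0// Rintegral_norm_ge0.
move=> x; rewrite lowpass_kernel_cosT// normrM -/c.
by rewrite (le_trans _ (_ : `|c| * \int[leb2]_xi `|chi xi| <= _)) ?lerDr// ler_wpM2l// cosT_bound//
  ; exact: chi_L1.
Qed.

(** By scaling, the modulus of continuity at [w] is that of the kernel for
    [lam = 1] at [w / lam]. *)
Lemma lowpass_modulus (a : R) : 0 <= a -> a < 1 ->
  exists2 C : R, 0 < C & forall (lam : R) w, 0 < lam ->
  \int[leb2]_b `|lowpass_kernel lam (b - w) - lowpass_kernel lam b|
    <= C * lam `^ (- a) * `|w| `^ a.
Proof.
move=> a0 a1; have [r r0 h] := chi_supp.
have [C C0 CM] := cosT_modulus r0 chi_smooth h a0 a1.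
have pn : (2 * pi) ^- 2 > 0 :> R by rewrite invr_gt0 exprn_gt0// mulr_gt0// pi_gt0.
exists ((2 * pi) ^- 2 * C); first exact: mulr_gt0.
move=> lam w l0; have ln : lam^-1 != 0 by rewrite invr_eq0 gt_eqF.
have mk := cosT_continuous (smooth_continuous chi_smooth) h.
pose F b := `|cosT chi (b - lam^-1 *: w) - cosT chi b|.
have iF : L1 F.
  apply: L1_norm; apply: L1B; last exact: L1_cosT_chi.
  exact: (L1_shift (- (lam^-1 *: w)) L1_cosT_chi).
have E : \int[leb2]_b F b = lam ^- 2 * \int[leb2]_b F (lam^-1 *: b + 0).
  by rewrite (Rintegral_affine2 0 ln iF) exprVn.
apply: (@le_trans _ _ ((2 * pi) ^- 2 * \int[leb2]_b F b)); last first.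
  rewrite -!mulrA ler_wpM2l ?(ltW pn)// (le_trans (CM _))//.
  rewrite normrZ gtr0_norm ?invr_gt0// powRM ?invr_ge0 ?(ltW l0)//.
  by rewrite -powR_inv1 ?(ltW l0)// -powRrM mulN1r.
rewrite E mulrA -RintegralZl//; last exact: L1_affine.
apply: le_Rintegral => //.
- apply: L1_norm; apply: L1B; last exact: lowpass_kernel_L1.
  exact: (L1_shift (- w) (lowpass_kernel_L1 l0)).
- by apply: L1Z; exact: L1_affine.
move=> b _; rewrite !lowpass_kernel_cosT// -mulrBr normrM ger0_norm; last first.
  by rewrite mulr_ge0 ?(ltW pn)// invr_ge0 exprn_ge0// ltW.
by rewrite /F scalerBr !addr0.
Qed.

(** Since [h] has mean zero, the convolution of [h] with the kernel only sees
    increments of the latter; the powers of [|w|] they produce are absorbed by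
    the moment of [h]. *)
Lemma lowpass_error (a : R) : 0 <= a -> a < 1 ->
  exists2 C : R, 0 < C & forall (lam B : R) h f x, 0 < lam -> L1 h ->
    \int[leb2]_w h w = 0 -> L1 (fun w => h w * `|w| `^ a) ->
    meas2 f -> (forall z, `|f z| <= B) ->
    `|convol (lowpass_kernel lam) (convol h f) x| <=
      C * lam `^ (- a) * (B * \int[leb2]_w `|h w * `|w| `^ a|).
Proof.
move=> a0 a1; have [C C0 CM] := lowpass_modulus a0 a1.
exists C => // lam B h f x l0 ih h0 iha mf fB.
have B0 : 0 <= B := le_trans (normr_ge0 _) (fB 0).
have ik := lowpass_kernel_L1 l0; have mk := L1_measurable ik.
have [P P0 kP] := lowpass_kernel_bounded l0.
pose k := lowpass_kernel lam.
have iphi : L1 (fun y => k (x - y)) := L1_reflect x ik.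
pose F (q : (R * R) * (R * R)) : R := `|h q.1| * `|k (q.2 - q.1) - k q.2|.
have mF : measurable_fun setT (F : (measurableTypeR R * measurableTypeR R) *
   (measurableTypeR R * measurableTypeR R) -> R).
  have mr := meas2_reflect 0 mk.
  have -> : F = fun q => `|h q.1| * `|k (0 - (q.1 - q.2)) - k q.2|.
    by apply/funext => q; rewrite /F sub0r opprB.
  apply: measurable_funM; apply: measurableT_comp => //.
    exact: (measurableT_comp (L1_measurable ih) measurable_fst).
  apply: measurable_funB; last exact: (measurableT_comp mk measurable_snd).
  exact: (measurableT_comp mr measurable_sub2).
have CMl := CM lam ^~ l0.
have idk w : L1 (fun b => k (b - w) - k b).
  by apply: L1B => //; exact: (L1_shift (- w) ik).
have Fw w : \int[leb2s]_y `|F (w, y)| <= C * lam `^ (- a) * `|h w * `|w| `^ a|.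
  rewrite /F /=.
  have -> : \int[leb2s]_y `| `|h w| * `|k (y - w) - k y| | =
      `|h w| * \int[leb2]_y `|k (y - w) - k y|.
    rewrite -RintegralZl//; last exact: L1_norm.
    by apply: eq_Rintegral => y _; rewrite ger0_norm// mulr_ge0.
  rewrite normrM (ger0_norm (powR_ge0 _ _)) mulrCA ler_wpM2l//; exact: CMl.
have iF : (leb2s \x leb2s)%E.-integrable setT (EFin \o F).
  apply: (@integrable_iterated _ _ _ _ _ leb2s leb2s F
      (fun w => C * lam `^ (- a) * `|h w * `|w| `^ a|)) => //.
  - by move=> w; exact: (L1Z `|h w| (L1_norm (idk w))).
  - by apply: L1Z; apply: L1_norm.
pose G b := \int[leb2]_w F (w, b).
have iG : L1 G := Rfubini_integrable2 iF.
have G0 b : 0 <= G b by apply: Rintegral_ge0 => w _; rewrite mulr_ge0.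
have -> : convol k (convol h f) x = \int[leb2]_y (convol h f y * k (x - y)).
  by apply: eq_Rintegral => y _; rewrite mulrC.
rewrite (convol_transpose ih mf fB iphi (fun y => kP _)).
have inner z : `|\int[leb2]_y (h (y - z) * k (x - y))| <= G (x - z).
  rewrite (Rintegral_translate z ih (L1_measurable iphi) (fun y => kP _)).
  have ib : L1 (fun w => h w * k (x - z - w)).
    apply: (integrable_mul_bounded ih) (fun y => kP _).
    exact: meas2_reflect.
  have ic : L1 (fun w => h w * k (x - z)).
    have := L1Z (k (x - z)) ih; congr (leb2.-integrable setT (EFin \o _)).
    by apply/funext => w; rewrite mulrC.
  (* The mean of [h] is zero: a constant may be subtracted from the kernel. *)
  have E0 : \int[leb2]_w (h w * k (x - z)) = 0 by rewrite RintegralZr// h0 mul0r.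
  have -> : \int[leb2]_w (h w * k (x - (w + z))) =
      \int[leb2]_w (h w * k (x - z - w) - h w * k (x - z)).
    rewrite RintegralB// E0 subr0; apply: eq_Rintegral => w _; congr (_ * k _).
    by rewrite opprD addrCA addrC.
  apply: le_norm_Rintegral2.
  - have := L1_norm (L1B ib ic); congr (leb2.-integrable setT (EFin \o _)).
    by apply/funext => w; rewrite -mulrBr normrM.
  - exact: L1_measurable (L1B ib ic).
  - by move=> w; rewrite -mulrBr normrM.
have it := convol_transpose_L1 ih mf fB iphi (fun y => kP _).
apply: (@le_trans _ _ (\int[leb2]_z (B * G (x - z)))).
  apply: le_norm_Rintegral2.
  - by apply: L1Z; exact: L1_reflect.
  - exact: L1_measurable it.
  - by move=> z; rewrite normrM; apply: ler_pM => //; exact: inner.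
rewrite [leLHS](RintegralZl _ measurableT (L1_reflect x iG)).
rewrite [X in _ * X <= _](Rintegral_reflect x iG) [leRHS]mulrCA ler_wpM2l//.
rewrite /G -[leLHS](Rfubini iF) -[leRHS]RintegralZl//; last exact: L1_norm.
pose T w : R := \int[leb2s]_y F (w, y).
have iT : L1 T := Rfubini_integrable1 iF.
have iU := L1Z (C * lam `^ (- a)) (L1_norm iha).
change (\int[leb2]_w T w <= \int[leb2]_w (C * lam `^ (- a) * `|h w * `|w| `^ a|)).
apply: (le_Rintegral measurableT iT iU) => w _; apply: le_trans (Fw w).
by rewrite le_eqVlt; apply/orP; left; apply/eqP; apply: eq_Rintegral => y _; rewrite ger0_norm// mulr_ge0.
Qed.

End Lowpass.

(** * Convolution with the low-pass kernel as a Fourier multiplier *)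

Section FourierMultiplier.
Context {R : realType}.
Implicit Types (f g m p a b : R * R -> R) (x y v xi : R * R).
Local Open Scope complex_scope.

Lemma Re_mulc (z w : R[i]) :
  complex.Re (z * w) = complex.Re z * complex.Re w - complex.Im z * complex.Im w.
Proof. by case: z; case: w. Qed.

Lemma Im_mulc (z w : R[i]) :
  complex.Im (z * w) = complex.Re z * complex.Im w + complex.Im z * complex.Re w.
Proof. by case: z; case: w. Qed.

Lemma schwartz_continuous p : schwartz_real p -> continuous p.
Proof. by case=> sp _; exact: smooth_continuous. Qed.

Lemma schwartz_bounded p : schwartz_real p -> exists P : R, forall x, `|p x| <= P.
Proof. by case=> _ /(_ [::] 0%N) [C h]; exists C => x; have := h x; rewrite expr0 mul1r. Qed.

(** The seminorms of order 0 and 4 control [(1 + |x|)^4], which dominates the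
    inverse of [weight 2]. *)
Lemma schwartz_L1 p : schwartz_real p -> L1 p.
Proof.
move=> sp; have mp := continuous_meas2 (schwartz_continuous sp).
case: sp => _ sp; have [C0 h0] := sp [::] 0%N; have [C4 h4] := sp [::] 4%N.
apply: (@L1_le_weight _ _ 2 (8 * (C0 + C4))) => //; first by rewrite ltr1n.
move=> x; have := h0 x; have := h4 x; rewrite /= expr0 mul1r => h4x h0x.
have e0 : 0 <= enorm x by rewrite sqrtr_ge0.
(* Convexity, twice. *)
have key : (1 + enorm x) ^+ 4 <= 8 * (1 + enorm x ^+ 4).
  move: (enorm x) e0 => e e0.
  have k1 : (1 + e) ^+ 2 <= 2 * (1 + e ^+ 2).
    by have := sqr_ge0 (1 - e); nra.
  have k2 : (1 + e ^+ 2) ^+ 2 <= 2 * (1 + e ^+ 4).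
    by have := sqr_ge0 (1 - e ^+ 2); rewrite (_ : e ^+ 4 = (e ^+ 2) ^+ 2) -?exprM//; nra.
  rewrite (_ : (1 + e) ^+ 4 = ((1 + e) ^+ 2) ^+ 2); last by rewrite -exprM.
  apply: (@le_trans _ _ ((2 * (1 + e ^+ 2)) ^+ 2)).
    by rewrite lerXn2r ?nnegrE ?mulr_ge0 ?addr_ge0 ?sqr_ge0// exprn_ge0// addr_ge0.
  by rewrite exprMn; move: k2; set u := (1 + e ^+ 2) ^+ 2; lra.
have te t : tail 2 t = (1 + `|t|) ^- 2 :> R by rewrite /tail powRN powR_mulrn// addr_ge0.
rewrite /weight !te.
have n1 : 1 + `|x.1| <= 1 + enorm x.
  by rewrite lerD2l (le_trans (norm_fst_le x))// norm_le_enorm.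
have n2 : 1 + `|x.2| <= 1 + enorm x.
  by rewrite lerD2l (le_trans (norm_snd_le x))// norm_le_enorm.
have p1 : 0 < 1 + `|x.1| by rewrite ltr_pwDl.
have p2 : 0 < 1 + `|x.2| by rewrite ltr_pwDl.
rewrite -invfM ler_pdivlMr ?mulr_gt0 ?exprn_gt0//.
apply: (@le_trans _ _ (`|p x| * (1 + enorm x) ^+ 4)).
  rewrite ler_wpM2l// -exprMn (_ : 4%N = (2 * 2)%N)// exprM.
  rewrite lerXn2r ?nnegrE ?mulr_ge0 ?(ltW p1) ?(ltW p2)//.
  - by rewrite addr_ge0.
  - by rewrite addr_ge0.
  - by rewrite expr2; apply: ler_pM => //; exact: ltW.
apply: (@le_trans _ _ (`|p x| * (8 * (1 + enorm x ^+ 4)))); first by rewrite ler_wpM2l.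
rewrite mulrCA ler_wpM2l// mulrDr mulr1; apply: lerD => //.
by rewrite mulrC.
Qed.

(** With [sinS], the real and imaginary parts of the transform of [p] after the
    translation by [y]: multiplication by a character is undone by the addition
    formulas. *)
Definition cosS p y xi : R := \int[leb2]_x (p x * cos (dot xi (x - y))).
Definition sinS p y xi : R := \int[leb2]_x (p x * sin (dot xi (x - y))).

Lemma dotBr x y z : dot x (y - z) = dot x y - dot x z.
Proof. by rewrite dotC dotBl dotC [X in _ - X]dotC. Qed.

Lemma cosSE p y xi : L1 p ->
  cosS p y xi = cos (dot xi y) * cosT p xi + sin (dot xi y) * sinT p xi.
Proof.
move=> ip; have ic := L1_mul_cos xi ip; have is_ := L1_mul_sin xi ip.
rewrite /cosT /sinT -!RintegralZl// -RintegralD//; try exact: L1Z.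
by apply: eq_Rintegral => x _; rewrite dotBr cosB; ring.
Qed.

Lemma sinSE p y xi : L1 p ->
  sinS p y xi = cos (dot xi y) * sinT p xi - sin (dot xi y) * cosT p xi.
Proof.
move=> ip; have ic := L1_mul_cos xi ip; have is_ := L1_mul_sin xi ip.
rewrite /cosT /sinT -!RintegralZl// -RintegralB//; try exact: L1Z.
by apply: eq_Rintegral => x _; rewrite dotBr sinB; ring.
Qed.

Section Trig.
Variables (m p : R * R -> R) (y : R * R).
Hypotheses (im : L1 m) (ip : L1 p).

Lemma trig_slice_L1 (s : R -> R) xi : measurable_fun setT s -> (forall t, `|s t| <= 1) ->
  L1 (fun x => p x * s (dot xi (x - y))).
Proof.
move=> ms s1; apply: (integrable_mul_bounded ip) (fun x => s1 _).
have md : meas2 (fun x => dot xi x - dot xi y).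
  by apply: measurable_funB => //; apply: continuous_meas2; exact: Cn_continuous (Cn_dot 0 xi).
have := measurableT_comp ms md; congr (measurable_fun _ _).
by apply/funext => x /=; rewrite dotBr.
Qed.

Lemma trig_integrable (s : R -> R) : measurable_fun setT s -> (forall t, `|s t| <= 1) ->
  (leb2s \x leb2s)%E.-integrable setT
    (EFin \o (fun q : (R * R) * (R * R) => m q.1 * (p q.2 * s (dot q.1 (q.2 - y))))).
Proof.
move=> ms s1.
have mm := L1_measurable im; have mp := L1_measurable ip.
have mdot : @measurable_fun _ _ ((measurableTypeR R * measurableTypeR R) *
   (measurableTypeR R * measurableTypeR R))%type R setT
   (fun q : (R * R) * (R * R) => dot q.1 (q.2 - y)).
  have c11 := measurableT_comp (measurable_fst : @measurable_fun _ _ (measurableTypeR R * measurableTypeR R)%type (measurableTypeR R) setT fst) (measurable_fst : @measurable_fun _ _ ((measurableTypeR R * measurableTypeR R) *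
   (measurableTypeR R * measurableTypeR R))%type (measurableTypeR R * measurableTypeR R)%type setT fst).
  have c12 := measurableT_comp (measurable_snd : @measurable_fun _ _ (measurableTypeR R * measurableTypeR R)%type (measurableTypeR R) setT snd) (measurable_fst : @measurable_fun _ _ ((measurableTypeR R * measurableTypeR R) *
   (measurableTypeR R * measurableTypeR R))%type (measurableTypeR R * measurableTypeR R)%type setT fst).
  have c21 := measurableT_comp (measurable_fst : @measurable_fun _ _ (measurableTypeR R * measurableTypeR R)%type (measurableTypeR R) setT fst) (measurable_snd : @measurable_fun _ _ ((measurableTypeR R * measurableTypeR R) *
   (measurableTypeR R * measurableTypeR R))%type (measurableTypeR R * measurableTypeR R)%type setT snd).
  have c22 := measurableT_comp (measurable_snd : @measurable_fun _ _ (measurableTypeR R * measurableTypeR R)%type (measurableTypeR R) setT snd) (measurable_snd : @measurable_fun _ _ ((measurableTypeR R * measurableTypeR R) *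
   (measurableTypeR R * measurableTypeR R))%type (measurableTypeR R * measurableTypeR R)%type setT snd).
  apply: measurable_funD; apply: measurable_funM => //; apply: measurable_funB => //;
    exact: measurable_cst.
apply: (@integrable_iterated _ _ _ _ _ leb2s leb2s _
   (fun xi => `|m xi| * \int[leb2]_x `|p x|)).
- apply: measurable_funM; first exact: (measurableT_comp mm measurable_fst).
  apply: measurable_funM; first exact: (measurableT_comp mp measurable_snd).
  exact: (measurableT_comp ms mdot).
- by move=> xi; exact: (L1Z (m xi) (trig_slice_L1 xi ms s1)).
- have := L1Z (\int[leb2]_x `|p x|) (L1_norm im).
  by congr (leb2.-integrable setT (EFin \o _)); apply/funext => xi; rewrite mulrC.
move=> xi /=; have i1 := L1_norm (L1Z (m xi) (trig_slice_L1 xi ms s1)).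
have i2 := L1Z `|m xi| (L1_norm ip).
rewrite -[leRHS](RintegralZl _ measurableT (L1_norm ip)).
apply: (le_Rintegral measurableT i1 i2) => x _.
by rewrite !normrM ler_wpM2l// ler_piMr.
Qed.

Lemma measurable_cosR : measurable_fun setT (@cos R).
Proof. by apply: continuous_measurable_fun; exact: continuous_cos. Qed.

Lemma measurable_sinR : measurable_fun setT (@sin R).
Proof. by apply: continuous_measurable_fun; exact: continuous_sin. Qed.

Let icos := trig_integrable measurable_cosR norm_cos_le.
Let isin := trig_integrable measurable_sinR norm_sin_le.
Let scos xi := trig_slice_L1 xi measurable_cosR norm_cos_le.
Let ssin xi := trig_slice_L1 xi measurable_sinR norm_sin_le.

Lemma trig_swap :
  \int[leb2]_xi (m xi * cosS p y xi) = \int[leb2]_x (cosT m (x - y) * p x).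
Proof.
have E := Rfubini icos; rewrite /= in E.
transitivity (\int[leb2s]_xi \int[leb2s]_x (m xi * (p x * cos (dot xi (x - y))))).
  by apply: eq_Rintegral => xi _; rewrite -[LHS](RintegralZl _ measurableT (scos xi)).
rewrite [LHS]E; apply: eq_Rintegral => x _.
rewrite -[RHS](RintegralZr _ measurableT (L1_mul_cos (x - y) im)).
by apply: eq_Rintegral => xi _; rewrite dotC; ring.
Qed.

Lemma integrable_cosT_mul : L1 (fun x => cosT m (x - y) * p x).
Proof.
have := Rfubini_integrable2 icos; congr (leb2.-integrable setT (EFin \o _)).
apply/funext => x; rewrite /cosT -[RHS](RintegralZr _ measurableT (L1_mul_cos (x - y) im)).
by apply: eq_Rintegral => xi _; rewrite /= dotC; ring.
Qed.

Lemma cosS_L1 : L1 (fun xi => m xi * cosS p y xi).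
Proof.
have := Rfubini_integrable1 icos; congr (leb2.-integrable setT (EFin \o _)).
by apply/funext => xi; rewrite -[RHS](RintegralZl _ measurableT (scos xi)).
Qed.

Lemma sinS_L1 : L1 (fun xi => m xi * sinS p y xi).
Proof.
have := Rfubini_integrable1 isin; congr (leb2.-integrable setT (EFin \o _)).
by apply/funext => xi; rewrite -[RHS](RintegralZl _ measurableT (ssin xi)).
Qed.

(** An even symbol kills the sine part, which is odd in the frequency. *)
Lemma sinS_odd : (forall xi, m (- xi) = m xi) -> \int[leb2]_xi (m xi * sinS p y xi) = 0.
Proof.
move=> em; apply: Rintegral_odd; first exact: sinS_L1.
move=> xi; rewrite em -mulrN; congr (_ * _).
rewrite -mulN1r -[RHS](RintegralZl _ measurableT (ssin xi)).
by apply: eq_Rintegral => x _; rewrite dotC dotNr sinN dotC; ring.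
Qed.

End Trig.

(** Exchanging the integrals over frequency and space turns the multiplier into
    the convolution with its inverse transform. *)
Lemma fourier_multiplier_kernel m phi y : L1 m -> (forall xi, m (- xi) = m xi) ->
  schwartz phi ->
  fourier (fun xi => (m xi)%:C * inv_fourier phi xi) y =
  (\int[leb2]_x ((2 * pi) ^- 2 * cosT m (x - y) * complex.Re (phi x))) +i*
  (\int[leb2]_x ((2 * pi) ^- 2 * cosT m (x - y) * complex.Im (phi x))).
Proof.
move=> im em [sa sb].
set a := (fun x => complex.Re (phi x)) in sa; set b := (fun x => complex.Im (phi x)) in sb.
have ia := schwartz_L1 sa; have ib := schwartz_L1 sb.
pose q : R := (2 * pi) ^- 2.
have invE xi : inv_fourier phi xi =
    (q * (cosT a xi - sinT b xi)) +i* (q * (cosT b xi + sinT a xi)).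
  rewrite /inv_fourier /cintegral.
  have -> : \int[leb2]_x complex.Re (expi (dot xi x) * phi x) = cosT a xi - sinT b xi.
    rewrite /cosT /sinT -RintegralB//; [|exact: L1_mul_cos|exact: L1_mul_sin].
    by apply: eq_Rintegral => x _; rewrite Re_mulc /= /a /b; ring.
  have -> : \int[leb2]_x complex.Im (expi (dot xi x) * phi x) = cosT b xi + sinT a xi.
    rewrite /cosT /sinT -RintegralD//; [|exact: L1_mul_cos|exact: L1_mul_sin].
    by apply: eq_Rintegral => x _; rewrite Im_mulc /= /a /b; ring.
  by apply/eqP; rewrite eq_complex Re_mulc Im_mulc /= !mul0r subr0 addr0 !eqxx.
have ca := cosS_L1 y im ia; have cb := cosS_L1 y im ib.
have sa' := sinS_L1 y im ia; have sb' := sinS_L1 y im ib.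
rewrite /fourier /cintegral; congr (_ +i* _).
- transitivity (q * \int[leb2]_xi (m xi * cosS a y xi - m xi * sinS b y xi)).
    rewrite -[RHS](RintegralZl _ measurableT (L1B ca sb')).
    apply: eq_Rintegral => xi _; rewrite invE !(Re_mulc, Im_mulc) /= cosN sinN.
    by rewrite (cosSE y xi ia) (sinSE y xi ib); ring.
  rewrite (RintegralB measurableT ca sb') (sinS_odd y im ib em) subr0 (trig_swap y im ia).
  have ict := integrable_cosT_mul y im ia.
  rewrite -(RintegralZl _ measurableT ict); apply: eq_Rintegral => x _.
  by rewrite mulrA.
- transitivity (q * \int[leb2]_xi (m xi * cosS b y xi + m xi * sinS a y xi)).
    rewrite -[RHS](RintegralZl _ measurableT (L1D cb sa')).
    apply: eq_Rintegral => xi _; rewrite invE !(Re_mulc, Im_mulc) /= cosN sinN.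
    by rewrite (cosSE y xi ib) (sinSE y xi ia); ring.
  rewrite (RintegralD measurableT cb sa') (sinS_odd y im ia em) addr0 (trig_swap y im ib).
  have ict := integrable_cosT_mul y im ib.
  rewrite -(RintegralZl _ measurableT ict); apply: eq_Rintegral => x _.
  by rewrite mulrA.
Qed.

Lemma is_fourier_multiplier_convol m f B : L1 m -> (forall xi, m (- xi) = m xi) ->
  L1 (cosT m) -> meas2 f -> (forall x, `|f x| <= B) ->
  is_fourier_multiplier (fun xi => (m xi)%:C) (fun x => (f x)%:C)
    (fun x => (convol (fun z => (2 * pi) ^- 2 * cosT m z) f x)%:C).
Proof.
move=> im em ic mf fB phi sphi.
have ik := L1Z ((2 * pi) ^- 2) ic.
have [sa sb] := sphi.
have ia := schwartz_L1 sa; have ib := schwartz_L1 sb.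
have [Pa ha] := schwartz_bounded sa; have [Pb hb] := schwartz_bounded sb.
rewrite /cintegral; congr (_ +i* _).
- transitivity (\int[leb2]_x (convol (fun z => (2 * pi) ^- 2 * cosT m z) f x * complex.Re (phi x))).
    by apply: eq_Rintegral => x _; rewrite Re_mulc /= mul0r subr0.
  rewrite (convol_transpose ik mf fB ia ha); apply: eq_Rintegral => y _.
  by rewrite Re_mulc (fourier_multiplier_kernel y im em sphi) /= mul0r subr0.
- transitivity (\int[leb2]_x (convol (fun z => (2 * pi) ^- 2 * cosT m z) f x * complex.Im (phi x))).
    by apply: eq_Rintegral => x _; rewrite Im_mulc /= mul0r addr0.
  rewrite (convol_transpose ik mf fB ib hb); apply: eq_Rintegral => y _.
  by rewrite Im_mulc (fourier_multiplier_kernel y im em sphi) /= mul0r addr0.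
Qed.

End FourierMultiplier.

(** * Bounded representatives and the flux of a Serfati solution *)

Section EssentialBounds.
Context {R : realType}.
Implicit Types (f g : R * R -> R) (v : R * R -> R * R) (x y : R * R).

Lemma leb2_setT_gt0 : (0 < @leb2 R setT)%E.
Proof.
have mI : measurable (`[0%R, 1%R]%classic : set (measurableTypeR R)) by [].
have h : (@leb2 R (`[0%R, 1%R] `*` `[0%R, 1%R]) = 1)%E.
  by rewrite leb2_setX// lebesgue_measure_itv/= lte_fin ltr01 oppr0 adde0 mule1.
apply: (@lt_le_trans _ _ 1%E); first by rewrite lte_fin.
rewrite -h; apply: le_measure => //; rewrite inE; last exact: measurableT.
exact: measurableX.
Qed.

(** [Lnorm] at infinity is an essential supremum only for a measure of positive
    total mass. *)
Lemma linf_normP v (M : R) :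
  (linf_norm v <= M%:E)%E <-> {ae leb2, forall x, enorm (v x) <= M}.
Proof.
rewrite /linf_norm Lnorm.unlock leb2_setT_gt0; split.
  move=> /ess_supP; apply: filterS_ae => x /=.
  by rewrite lee_fin ger0_norm ?sqrtr_ge0.
move=> h; apply/ess_supP; move: h; apply: filterS_ae => x /=.
by rewrite lee_fin ger0_norm ?sqrtr_ge0.
Qed.

Lemma linf_normsP f (M : R) :
  (linf_norms f <= M%:E)%E <-> {ae leb2, forall x, `|f x| <= M}.
Proof.
by rewrite /linf_norms Lnorm.unlock leb2_setT_gt0; split=> [/ess_supP//|h]; apply/ess_supP.
Qed.

Lemma linf_norm_ge0 v : (0 <= linf_norm v)%E.
Proof. exact: Lnorm_ge0. Qed.

Lemma linf_norms_ge0 f : (0 <= linf_norms f)%E.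
Proof. exact: Lnorm_ge0. Qed.

Lemma norm_cpnt_enorm i x : `|cpnt i x| <= enorm x.
Proof. exact: le_trans (norm_cpnt_le i x) (norm_le_enorm x). Qed.

(** Truncation makes an essentially bounded field bounded everywhere without
    changing its class. *)
Definition clip (B t : R) : R := Num.max (- B) (Num.min B t).

Lemma clip_bound B t : 0 <= B -> `|clip B t| <= B.
Proof.
move=> B0; have BB : - B <= B by rewrite (le_trans _ B0)// oppr_le0.
by rewrite ler_norml /clip le_max lexx /= ge_max BB ge_min lexx.
Qed.

Lemma clip_id B t : `|t| <= B -> clip B t = t.
Proof. by rewrite ler_norml => /andP[h1 h2]; rewrite /clip (min_idPr h2) (max_idPr h1). Qed.

Lemma max_lipschitz (c a b : R) : `|Num.max c a - Num.max c b| <= `|a - b|.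
Proof.
have h1 : a - b <= `|a - b| by exact: ler_norm.
have h2 : b - a <= `|a - b| by rewrite distrC ler_norm.
move: h1 h2 (normr_ge0 (a - b)); move: `|a - b| => d h1 h2 h3.
case: (leP c a) => ha; case: (leP c b) => hb; rewrite ler_norml; apply/andP; split; lra.
Qed.

Lemma min_lipschitz (c a b : R) : `|Num.min c a - Num.min c b| <= `|a - b|.
Proof.
have h1 : a - b <= `|a - b| by exact: ler_norm.
have h2 : b - a <= `|a - b| by rewrite distrC ler_norm.
move: h1 h2 (normr_ge0 (a - b)); move: `|a - b| => d h1 h2 h3.
case: (leP c a) => ha; case: (leP c b) => hb; rewrite ler_norml; apply/andP; split; lra.
Qed.

Lemma aeI (P Q : R * R -> Prop) : {ae leb2, forall x, P x} -> {ae leb2, forall x, Q x} ->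
  {ae leb2, forall x, P x /\ Q x}.
Proof. by have FF := ae_filter_ringOfSetsType (@leb2 R); exact: (@filterI _ _ FF P Q). Qed.

Lemma measurable_clip B : measurable_fun setT (clip B).
Proof.
by apply: measurable_maxr; [exact: measurable_cst|apply: measurable_minr;
  [exact: measurable_cst|exact: measurable_id]].
Qed.

Lemma meas2_clip B f : meas2 f -> meas2 (fun x => clip B (f x)).
Proof. by move=> mf; exact: (measurableT_comp (measurable_clip B) mf). Qed.

(** Only the essential bound [e] enters the estimate; [B] ensures that the
    integrals exist. *)
Lemma convol_bound_ae h f (B e : R) x : 0 <= e -> L1 h -> meas2 f -> (forall y, `|f y| <= B) ->
  {ae leb2, forall y, `|f y| <= e} -> `|convol h f x| <= e * \int[leb2]_y `|h y|.
Proof.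
move=> e0 ih mf fB fe.
have -> : convol h f = convol h (fun y => clip e (f y)).
  apply: convol_ae => //; [exact: L1_measurable|exact: meas2_clip|].
  by apply: filterS_ae fe => y h1; rewrite clip_id.
apply: convol_bound => //; first exact: meas2_clip.
by move=> y; exact: clip_bound.
Qed.

End EssentialBounds.

Section SerfatiData.
Context {R : realType}.
Variables (u : R -> R * R -> R * R) (w : R -> R * R -> R).
Hypothesis sol : serfati_with_vorticity u w.
Implicit Types (x y : R * R).

Lemma meas2_velocity t i : 0 <= t -> meas2 (fun x => cpnt i (u t x)).
Proof.
move=> t0; have [mu _] := (serfati_C0 sol).1 t t0.
have -> : (fun x => cpnt i (u t x)) = if i == 0 then fst \o u t else snd \o u t.
  by apply/funext => x; rewrite /cpnt; case: ifP.
by case: ifP => _; [exact: (measurableT_comp measurable_fst mu)|exact: (measurableT_comp measurable_snd mu)].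
Qed.

Lemma meas2_vorticity t : 0 <= t -> meas2 (w t).
Proof. by move=> t0; have [[]] := serfati_vorticity sol t0. Qed.

Lemma data_bound : exists2 B : R, 0 < B & forall t, 0 <= t ->
  [/\ {ae leb2, forall x, enorm (u t x) <= B} & {ae leb2, forall x, `|w t x| <= B}].
Proof.
have := serfati_bounded sol; set S := ereal_sup _ => Soo.
have le_S t : 0 <= t -> (linf_norm (u t) + linf_norms (w t) <= S)%E.
  by move=> t0; apply: ereal_sup_ubound; exists t => //=; rewrite in_itv/= t0.
have S0 : (0 <= S)%E.
  by apply: le_trans (le_S 0 (lexx _)); rewrite adde_ge0 ?linf_norm_ge0 ?linf_norms_ge0.
have Sfin : S \is a fin_num by rewrite ge0_fin_numE.
exists (1 + fine S); first by rewrite ltr_pwDl// fine_ge0.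
have SE : (S <= (1 + fine S)%:E)%E by rewrite EFinD fineK// leeDr// lee_fin.
move=> t t0; have h := le_trans (le_S t t0) SE; split.
  apply/linf_normP; apply: le_trans h.
  by rewrite leeDl// linf_norms_ge0.
apply/linf_normsP; apply: le_trans h.
by rewrite leeDr// linf_norm_ge0.
Qed.

(** The exceptional null set depends on [t], which is why pointwise continuity of
    the velocity in time cannot be claimed. *)
Lemma velocity_continuous t0 (e : R) : 0 <= t0 -> 0 < e ->
  exists2 d : R, 0 < d & forall t, 0 <= t -> `|t - t0| < d ->
    {ae leb2, forall x, forall i, `|cpnt i (u t x) - cpnt i (u t0 x)| <= e}.
Proof.
move=> t00 e0; have := (serfati_C0 sol).2 t0 t00.
have oe : nbhs (0%E : \bar R) [set y | (y < e%:E)%E].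
  by apply: open_nbhs_nbhs; split; [exact: open_ereal_lt_ereal|rewrite /= lte_fin].
move=> /(_ _ oe) [d /= d0 h]; exists d => // t t0' td.
have := h t; rewrite /ball /= distrC => /(_ td); rewrite in_itv /= t0' => /(_ isT) hn.
have /linf_normP := ltW hn.
apply: filterS_ae => x hx i; apply: le_trans hx.
rewrite (_ : cpnt i (u t x) - cpnt i (u t0 x) = cpnt i ((u t \- u t0) x)).
  exact: norm_cpnt_enorm.
by rewrite /cpnt; case: ifP.
Qed.

Variable B : R.
Hypothesis B0 : 0 < B.
Hypothesis uwB : forall t, 0 <= t ->
  [/\ {ae leb2, forall x, enorm (u t x) <= B} & {ae leb2, forall x, `|w t x| <= B}].

(** Constant for negative times, so as to be continuous on the whole line. *)
Definition vel (s : R) (i : 'I_2) x : R := clip B (cpnt i (u (Num.max s 0) x)).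
Definition vort (s : R) x : R := clip B (w (Num.max s 0) x).

Let max0 (s : R) : 0 <= Num.max s 0. Proof. by rewrite le_max lexx orbT. Qed.

Lemma meas2_vel s i : meas2 (vel s i).
Proof. by apply: meas2_clip; exact: meas2_velocity. Qed.

Lemma meas2_vort s : meas2 (vort s).
Proof. by apply: meas2_clip; exact: meas2_vorticity. Qed.

Lemma vel_bound s i x : `|vel s i x| <= B.
Proof. exact: clip_bound (ltW B0). Qed.

Lemma vort_bound s x : `|vort s x| <= B.
Proof. exact: clip_bound (ltW B0). Qed.

Lemma vel_ae t : 0 <= t -> {ae leb2, forall x, forall i, vel t i x = cpnt i (u t x)}.
Proof.
move=> t0; have [+ _] := uwB t0; apply: filterS_ae => x hx i.
by rewrite /vel (max_idPl t0) clip_id// (le_trans (norm_cpnt_enorm _ _)).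
Qed.

Lemma vort_ae t : 0 <= t -> {ae leb2, forall x, vort t x = w t x}.
Proof.
move=> t0; have [_] := uwB t0; apply: filterS_ae => x hx.
by rewrite /vort (max_idPl t0) clip_id.
Qed.

Lemma clip_lipschitz (a b : R) : `|clip B a - clip B b| <= `|a - b|.
Proof.
exact: le_trans (max_lipschitz _ _ _) (min_lipschitz _ _ _).
Qed.

Lemma vel_continuous s0 (e : R) : 0 < e ->
  exists2 d : R, 0 < d & forall s, `|s - s0| < d ->
    {ae leb2, forall x, forall i, `|vel s i x - vel s0 i x| <= e}.
Proof.
move=> e0; have [d d0 h] := velocity_continuous (max0 s0) e0.
exists d => // s sd.
have := h _ (max0 s); have -> : `|Num.max s 0 - Num.max s0 0| < d.
  by apply: le_lt_trans sd; rewrite ![Num.max _ 0]maxC; exact: max_lipschitz.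
move=> /(_ isT); apply: filterS_ae => x hx i.
exact: le_trans (clip_lipschitz _ _) (hx i).
Qed.

Definition vel2 s k l x : R := vel s k x * vel s l x.

Lemma meas2_vel2 s k l : meas2 (vel2 s k l).
Proof. by apply: measurable_funM; exact: meas2_vel. Qed.

Lemma vel2_bound s k l x : `|vel2 s k l x| <= B ^+ 2.
Proof. by rewrite normrM expr2; apply: ler_pM => //; exact: vel_bound. Qed.

Lemma vel2_continuous s0 (e : R) : 0 < e ->
  exists2 d : R, 0 < d & forall s, `|s - s0| < d -> forall k l,
    {ae leb2, forall x, `|vel2 s k l x - vel2 s0 k l x| <= e}.
Proof.
move=> e0; have e1 : 0 < e / (2 * B) by rewrite divr_gt0// mulr_gt0.
have [d d0 h] := vel_continuous s0 e1; exists d => // s sd k l.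
have := h s sd; apply: filterS_ae => x hx.
have -> : vel2 s k l x - vel2 s0 k l x =
    (vel s k x - vel s0 k x) * vel s l x + vel s0 k x * (vel s l x - vel s0 l x).
  by rewrite /vel2; ring.
apply: (le_trans (ler_normD _ _)); rewrite !normrM.
apply: (@le_trans _ _ (e / (2 * B) * B + B * (e / (2 * B)))).
  by apply: lerD; apply: ler_pM => //; exact: vel_bound.
by rewrite le_eqVlt; apply/orP; left; apply/eqP; field; rewrite gt_eqF.
Qed.

Section Flux.
Variable theta : R * R -> R.
Hypothesis cth : cutoff theta.

(** The integrand of the time integral in the Serfati identity. *)
Definition flux i s x : R := \sum_(k < 2) \sum_(l < 2) convol (kerM theta i k l) (vel2 s k l) x.

Definition kerM_mass i : R := \sum_(k < 2) \sum_(l < 2) \int[leb2]_x `|kerM theta i k l x|.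

Lemma kerM_mass_ge0 i : 0 <= kerM_mass i.
Proof. by do 2 (apply: sumr_ge0 => ? _); exact: Rintegral_norm_ge0. Qed.

Lemma sum2_bound (F G : 'I_2 -> 'I_2 -> R) (e : R) :
  (forall k l, `|F k l| <= e * G k l) ->
  `|\sum_(k < 2) \sum_(l < 2) F k l| <= e * \sum_(k < 2) \sum_(l < 2) G k l.
Proof.
move=> h; apply: (le_trans (ler_norm_sum _ _ _)); rewrite mulr_sumr; apply: ler_sum => k _.
by apply: (le_trans (ler_norm_sum _ _ _)); rewrite mulr_sumr; apply: ler_sum.
Qed.

Lemma flux_bound i s x : `|flux i s x| <= B ^+ 2 * kerM_mass i.
Proof.
apply: sum2_bound => k l; apply: convol_bound; [exact: L1_kerM|exact: meas2_vel2|].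
by move=> y; exact: vel2_bound.
Qed.

Lemma meas2_flux i s : meas2 (flux i s).
Proof.
apply: measurable_sum => k; apply: measurable_sum => l.
apply: (@convol_measurable _ _ _ (B ^+ 2) (weight 2)).
- by apply: L1_weight; rewrite ltr1n.
- by move=> x; exact: weight_gt0.
- exact: L1_kerM.
- exact: meas2_vel2.
- by move=> y; exact: vel2_bound.
Qed.

(** Convolution with an [L^1] kernel turns continuity in [L^oo] into continuity
    at every point, uniformly. *)
Lemma flux_continuous i x : continuous (fun s => flux i s x).
Proof.
move=> s0; apply/cvgrPdist_le => e e0.
have m0 : 0 < kerM_mass i + 1 by rewrite ltr_wpDl// kerM_mass_ge0.
have e1 : 0 < e / (kerM_mass i + 1) by rewrite divr_gt0.
have [d d0 h] := vel2_continuous s0 e1.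
exists d => // s /=; rewrite distrC => sd.
have -> : flux i s0 x - flux i s x = - \sum_(k < 2) \sum_(l < 2)
    convol (kerM theta i k l) (fun y => vel2 s k l y - vel2 s0 k l y) x.
  rewrite /flux -sumrB -sumrN; apply: eq_bigr => k _; rewrite -sumrB -sumrN.
  apply: eq_bigr => l _.
  rewrite (convolDr (L1_kerM cth i k l) (meas2_vel2 s k l) (vel2_bound s k l)
    (meas2_vel2 s0 k l) (vel2_bound s0 k l)).
  by rewrite opprB.
rewrite normrN.
apply: (@le_trans _ _ (e / (kerM_mass i + 1) *
    kerM_mass i)).
  apply: sum2_bound => k l; apply: (@convol_bound_ae _ _ _ (B ^+ 2 + B ^+ 2)).
  - exact: ltW.
  - exact: L1_kerM.
  - by apply: measurable_funB; exact: meas2_vel2.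
  - by move=> y; apply: (le_trans (ler_normB _ _)); apply: lerD; exact: vel2_bound.
  - exact: h.
rewrite -mulrA ler_piMr ?(ltW e0)// mulrC ler_pdivrMr// mul1r.
by rewrite lerDl.
Qed.

Lemma measurable_flux i : meas3 (fun q => flux i q.1 q.2).
Proof.
apply: (@measurable_uncurry_continuous R _ (measurableTypeR R * measurableTypeR R)%type (flux i)).
  exact: flux_continuous.
exact: meas2_flux.
Qed.

(** The Serfati identity for the truncated fields: convolutions ignore the null
    sets on which they differ from the original ones. *)
Lemma serfati_vel t i : 0 <= t -> {ae leb2, forall x,
  vel t i x - vel 0 i x =
  convol (theta \* biot_savart i) (fun y => vort t y - vort 0 y) x
  - \int[@lebesgue_measure R]_(s in `[0, t]) flux i s x}.
Proof.
move=> t0; have I := serfati_ident sol cth t0 i.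
have mwt := meas2_vorticity t0; have mw0 := meas2_vorticity (lexx 0).
have Et := vel_ae t0; have E0 := vel_ae (lexx 0).
have -> : convol (theta \* biot_savart i) (fun y => vort t y - vort 0 y) =
    convol (theta \* biot_savart i) (w t \- w 0).
  apply: convol_ae.
  - exact: L1_measurable (L1_cut_biot_savart cth i).
  - by apply: measurable_funB; exact: meas2_vort.
  - exact: measurable_funB.
  - have := aeI (vort_ae t0) (vort_ae (lexx 0)).
    by apply: filterS_ae => x [-> ->].
have := aeI I (aeI Et E0); apply: filterS_ae => x [hx [ht h0]].
rewrite ht h0 hx; apply: (congr1 (fun z => _ - z)); apply: eq_Rintegral => s.
rewrite inE /= in_itv /= => /andP[s0 _].
apply: eq_bigr => k _; apply: eq_bigr => l _.
suff -> : convol (kerM theta i k l) (vel2 s k l) =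
  convol (kerM theta i k l) (tensor (u s) k l) by [].
apply: convol_ae.
- exact: L1_measurable (L1_kerM cth i k l).
- exact: meas2_vel2.
- by apply: measurable_funM; exact: meas2_velocity.
- by have := vel_ae s0; apply: filterS_ae => y hy; rewrite /vel2 /tensor !hy.
Qed.

End Flux.

End SerfatiData.

(** * Primitives in time *)

Section TimeIntegral.
Context {R : realType}.
Notation mu := (@lebesgue_measure R).
Implicit Types (x y : R * R) (phi : R * R -> R).

Definition window (a b t : R) : R := \1_(`[a, b]%classic) t.

Lemma windowE a b t : window a b t = (a <= t <= b)%R%:R.
Proof.
rewrite /window indicE; congr ((nat_of_bool _)%:R).
by apply/idP/idP; rewrite inE /= in_itv.
Qed.

Lemma measurable_window a b : measurable_fun setT (window a b).
Proof. exact: measurable_indic. Qed.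

Lemma Rintegral_window a b (f : R -> R) :
  \int[mu]_(s in `[a, b]) f s = \int[mu]_s (window a b s * f s).
Proof.
rewrite Rintegral_mkcond; apply: eq_Rintegral => s _.
by rewrite /window indicE /patch; case: ifP => _; rewrite ?mul1r ?mul0r.
Qed.

(** Multiplying by indicators keeps all integrals over the whole line, where
    Fubini is stated. *)
Definition ind (t : R) : R -> R := window 0 t.

Lemma indE t s : ind t s = (0 <= s <= t)%R%:R.
Proof. exact: windowE. Qed.

Lemma Rintegral_ind t (f : R -> R) :
  \int[mu]_(s in `[0, t]) f s = \int[mu]_s (ind t s * f s).
Proof. exact: Rintegral_window. Qed.

Lemma ind_ge0 t s : 0 <= ind t s.
Proof. by rewrite /ind /window indicE. Qed.

Lemma measurable_ind t : measurable_fun setT (ind t).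
Proof. exact: measurable_window. Qed.

Lemma integrable_ind t : mu.-integrable setT (EFin \o ind t).
Proof.
apply/integrableP; split; first by apply/measurable_EFinP; exact: measurable_ind.
have -> : (\int[mu]_s `|(EFin \o ind t) s| = \int[mu]_s (\1_(`[0%R, t]%classic) s)%:E)%E.
  by apply: eq_integral => s _; rewrite /= ger0_norm// ind_ge0.
rewrite integral_indic//= setIT lebesgue_measure_itv/=.
by case: ifP => _; rewrite ?oppr0 ?adde0 ltry.
Qed.

Lemma integral_ind t : \int[mu]_s ind t s = Num.max t 0.
Proof.
rewrite /Rintegral; have -> : (\int[mu]_s (ind t s)%:E = \int[mu]_s (\1_(`[0%R, t]%classic) s)%:E)%E by [].
rewrite integral_indic//= setIT lebesgue_measure_itv/= lte_fin.
by case: (ltP 0 t) => _ //=; rewrite oppr0 addr0.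
Qed.

Lemma le_norm_RintegralT (f g : R -> R) : measurable_fun setT f ->
  mu.-integrable setT (EFin \o g) -> (forall s, `|f s| <= g s) ->
  `|\int[mu]_s f s| <= \int[mu]_s g s.
Proof.
move=> mf ig fg; have if_ := integrable_dominated ig mf fg.
apply: (le_trans (le_normr_Rintegral measurableT if_)).
apply: le_Rintegral => //; exact: integrable_abse if_.
Qed.

Variables (h : R -> R * R -> R) (C : R).
Hypothesis mh : meas3 (fun q => h q.1 q.2).
Hypothesis hC : forall s x, `|h s x| <= C.

Let C0 : 0 <= C := le_trans (normr_ge0 _) (hC 0 0).

(** The time integral of the Serfati identity, for an abstract field [h]. *)
Definition primitive t x : R := \int[mu]_(s in `[0, t]) h s x.

Lemma measurable_slice s : meas2 (h s).
Proof. exact: (measurableT_comp mh (measurable_pair1 s)). Qed.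

Lemma measurable_slice_time x : measurable_fun setT (h ^~ x).
Proof. exact: (measurableT_comp mh (measurable_pair2 x)). Qed.

Lemma integrable_ind_mul t (f : R -> R) (M : R) : measurable_fun setT f ->
  (forall s, `|f s| <= M) -> mu.-integrable setT (EFin \o (fun s => ind t s * f s)).
Proof. by move=> mf fM; exact: integrable_mul_bounded (integrable_ind t) mf fM. Qed.

Lemma primitive_lipschitz t t' x : `|primitive t x - primitive t' x| <= C * `|t - t'|.
Proof.
wlog tt : t t' / t' <= t.
  by move=> W; have [/W//|/ltW/W] := leP t' t; rewrite distrC [`|t - t'|]distrC.
have m1 := measurable_slice_time x.
have i1 r := integrable_ind_mul r m1 (hC ^~ x).
have iD : mu.-integrable setT (EFin \o (fun s => ind t s - ind t' s)).
  exact: (@integrableB _ _ _ mu setT measurableT _ _ (integrable_ind t) (integrable_ind t')).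
have iC : mu.-integrable setT (EFin \o (fun s => C * (ind t s - ind t' s))).
  exact: (@integrableZl _ _ _ mu setT measurableT C (EFin \o (fun s => ind t s - ind t' s)) iD).
rewrite /primitive !Rintegral_ind -RintegralB//.
apply: (@le_trans _ _ (\int[mu]_s (C * (ind t s - ind t' s)))).
  apply: le_norm_RintegralT => //.
    by apply: measurable_funB; apply: measurable_funM => //; exact: measurable_ind.
  move=> s; rewrite -mulrBl normrM mulrC; apply: ler_pM => //.
  have N : 0 <= ind t s - ind t' s.
    rewrite subr_ge0 !indE ler_nat; case: (0 <= s) => //=.
    by case hs: (s <= t') => //=; rewrite (le_trans hs tt).
  by rewrite (ger0_norm N).
rewrite (RintegralZl _ measurableT iD) (RintegralB measurableT (integrable_ind t) (integrable_ind t')).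
rewrite !integral_ind ler_wpM2l//.
by apply: (le_trans (ler_norm _)); rewrite ![Num.max _ 0]maxC; exact: max_lipschitz.
Qed.

Lemma primitive_continuous x : continuous (primitive ^~ x).
Proof.
move=> t; apply/cvgrPdist_le => e e0.
have C1 : 0 < C + 1 by rewrite ltr_wpDl.
exists (e / (C + 1)) => /=; first by rewrite divr_gt0.
move=> t' /= tt'; apply: (le_trans (primitive_lipschitz _ _ _)).
apply: (@le_trans _ _ ((C + 1) * (e / (C + 1)))).
  by apply: ler_pM => //; [rewrite lerDl|exact: ltW].
by rewrite mulrCA mulfV ?mulr1// gt_eqF.
Qed.

Lemma primitive0 t x : t <= 0 -> primitive t x = 0.
Proof.
rewrite le_eqVlt => /predU1P[->|t0].
  by rewrite /primitive set_itv1 Rintegral_set1.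
rewrite /primitive set_itv_ge ?Rintegral_set0//.
by rewrite bnd_simp -ltNge.
Qed.

Lemma primitive_bound t x : 0 <= t -> `|primitive t x| <= C * t.
Proof.
move=> t0; have := primitive_lipschitz t 0 x.
by rewrite (primitive0 x (lexx 0)) !subr0 (ger0_norm t0).
Qed.

Lemma primitive_integrable t phi : L1 phi ->
  (mu \x leb2s)%E.-integrable setT
    (EFin \o (fun q : R * (R * R) => ind t q.1 * (h q.1 q.2 * phi q.2))).
Proof.
move=> ip; have mp := L1_measurable ip.
apply: (@integrable_iterated _ _ _ _ _ mu leb2s _ (fun s => ind t s * (C * \int[leb2]_x `|phi x|))).
- apply: measurable_funM; first exact: (measurableT_comp (measurable_ind t) measurable_fst).
  by apply: measurable_funM => //; exact: (measurableT_comp mp measurable_snd).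
- move=> s; apply: (@L1Z _ (ind t s)); exact: (integrable_bounded_mul ip (measurable_slice s) (hC s)).
- apply: (@integrable_ind_mul t _ (C * \int[leb2]_x `|phi x|)); first exact: measurable_cst.
  by move=> s; rewrite ger0_norm// mulr_ge0// Rintegral_norm_ge0.
move=> s /=.
have ihp : L1 (fun x => h s x * phi x).
  exact: (integrable_bounded_mul ip (measurable_slice s) (hC s)).
have i1 := L1_norm (L1Z (ind t s) ihp).
have i2 := L1Z (ind t s) (L1Z C (L1_norm ip)).
rewrite -(RintegralZl C measurableT (L1_norm ip)) -(RintegralZl _ measurableT (L1Z C (L1_norm ip))).
apply: (le_Rintegral measurableT i1 i2) => x _.
by rewrite normrM ger0_norm ?ind_ge0// ler_wpM2l ?ind_ge0// normrM ler_wpM2r.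
Qed.

Lemma primitive_swap t phi : L1 phi ->
  \int[leb2]_x (primitive t x * phi x) =
  \int[mu]_(s in `[0, t]) \int[leb2]_x (h s x * phi x).
Proof.
move=> ip; have iF := primitive_integrable t ip.
have E := Rfubini iF; rewrite /= in E.
rewrite Rintegral_ind; symmetry.
transitivity (\int[mu]_s \int[leb2s]_x (ind t s * (h s x * phi x))).
  apply: eq_Rintegral => s _; rewrite [RHS](RintegralZl _ measurableT)//.
  exact: (integrable_bounded_mul ip (measurable_slice s) (hC s)).
rewrite E; apply: eq_Rintegral => x _; rewrite /primitive Rintegral_ind.
rewrite -[RHS](RintegralZr _ measurableT (integrable_ind_mul t (measurable_slice_time x) (hC ^~ x))).
by apply: eq_Rintegral => s _; rewrite mulrA.
Qed.

(** Partial integrals of an integrable function are measurable; [h] itself is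
    only bounded, whence the weight. *)
Lemma meas2_primitive t : meas2 (primitive t).
Proof.
have iw := L1_weight (ltr1n R 2).
have m1 := L1_measurable (Rfubini_integrable2 (primitive_integrable t iw)).
have := measurable_funM m1 (measurable_funV (L1_measurable iw)).
congr (measurable_fun _ _); apply/funext => x /=.
have wn : weight 2 x != 0 :> R by rewrite gt_eqF// weight_gt0.
rewrite /primitive Rintegral_ind.
rewrite -[RHS](mulfK wn); congr (_ / _).
rewrite -[RHS](RintegralZr _ measurableT (integrable_ind_mul t (measurable_slice_time x) (hC ^~ x))).
by apply: eq_Rintegral => s _; rewrite mulrA.
Qed.

End TimeIntegral.

(** * Decay of the low frequencies of the increments *)

Section LowpassPart.
Context {R : realType}.
Notation mu := (@lebesgue_measure R).
Implicit Types (x y : R * R) (f h : R * R -> R).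
Local Open Scope complex_scope.

(** The multiplier only depends on the class of [f], and a bounded
    representative [f0] makes the kernel integrals converge. *)
Lemma is_fourier_multiplier_ae (m f f0 : R * R -> R) (B : R) : L1 m -> (forall xi, m (- xi) = m xi) ->
  L1 (cosT m) -> meas2 f -> meas2 f0 -> (forall x, `|f0 x| <= B) ->
  {ae leb2, forall x, f x = f0 x} ->
  is_fourier_multiplier (fun xi => (m xi)%:C) (fun x => (f x)%:C)
    (fun x => (convol (fun z => (2 * pi) ^- 2 * cosT m z) f0 x)%:C).
Proof.
move=> im em ic mf mf0 fB ff phi sphi.
rewrite (is_fourier_multiplier_convol im em ic mf0 fB sphi).
have ik := L1Z ((2 * pi) ^- 2) ic.
have m1 : meas2 (fun _ : R * R => 1 : R) by exact: measurable_cst.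
have b1 (y : R * R) : `|1 : R| <= 1 by rewrite normr1.
have [sa sb] := sphi.
have ia := schwartz_L1 sa; have ib := schwartz_L1 sb.
have [Pa ha] := schwartz_bounded sa; have [Pb hb] := schwartz_bounded sb.
have mq p (P : R) : L1 p -> (forall x, `|p x| <= P) ->
    meas2 (fun y => \int[leb2]_x ((2 * pi) ^- 2 * cosT m (x - y) * p x)).
  move=> ip pP; have := L1_measurable (convol_transpose_L1 ik m1 b1 ip pP).
  by congr (measurable_fun _ _); apply/funext => y; rewrite mul1r.
have mFa := mq _ _ ia ha; have mFb := mq _ _ ib hb.
rewrite /cintegral; congr (_ +i* _); apply: eq_Rintegral_ae.
- have := measurable_funM mf0 mFa; congr (measurable_fun _ _); apply/funext => y.
  by rewrite Re_mulc (fourier_multiplier_kernel y im em sphi) /= mul0r subr0.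
- have := measurable_funM mf mFa; congr (measurable_fun _ _); apply/funext => y.
  by rewrite Re_mulc (fourier_multiplier_kernel y im em sphi) /= mul0r subr0.
- by apply: filterS_ae ff => y ->.
- have := measurable_funM mf0 mFb; congr (measurable_fun _ _); apply/funext => y.
  by rewrite Im_mulc (fourier_multiplier_kernel y im em sphi) /= mul0r addr0.
- have := measurable_funM mf mFb; congr (measurable_fun _ _); apply/funext => y.
  by rewrite Im_mulc (fourier_multiplier_kernel y im em sphi) /= mul0r addr0.
- by apply: filterS_ae ff => y ->.
Qed.

End LowpassPart.

Section LowpassEstimate.
Context {R : realType}.
Notation mu := (@lebesgue_measure R).
Implicit Types (x y : R * R) (f h : R * R -> R).
Variables (u : R -> R * R -> R * R) (w : R -> R * R -> R).
Hypothesis sol : serfati_with_vorticity u w.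
Variable B : R.
Hypothesis B0 : 0 < B.
Hypothesis uwB : forall t, 0 <= t ->
  [/\ {ae leb2, forall x, enorm (u t x) <= B} & {ae leb2, forall x, `|w t x| <= B}].
Variable chi : R * R -> R.
Hypothesis chi_symbol : lowpass_symbol chi.

Let cchi : cutoff chi := lowpass_cutoff chi_symbol.

Definition vel_incr t i x : R := vel u B t i x - vel u B 0 i x.
Definition vort_incr t x : R := vort w B t x - vort w B 0 x.

Lemma meas2_vel_incr t i : meas2 (vel_incr t i).
Proof. by apply: measurable_funB; exact: (meas2_vel sol). Qed.

Lemma vel_incr_bound t i x : `|vel_incr t i x| <= B + B.
Proof. by apply: (le_trans (ler_normB _ _)); apply: lerD; exact: vel_bound. Qed.

Lemma meas2_vort_incr t : meas2 (vort_incr t).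
Proof. by apply: measurable_funB; exact: (meas2_vort sol). Qed.

Lemma vort_incr_bound t x : `|vort_incr t x| <= B + B.
Proof. by apply: (le_trans (ler_normB _ _)); apply: lerD; exact: vort_bound. Qed.

Lemma sum_ord2 (F : 'I_2 -> R) : \sum_(k < 2) F k = F 0 + F 1.
Proof.
rewrite big_ord_recl big_ord1; congr (F _ + F _); exact: val_inj.
Qed.

Lemma norm_sum4 (p a b c d m1 m2 m3 m4 : R) : `|a| <= p * m1 -> `|b| <= p * m2 ->
  `|c| <= p * m3 -> `|d| <= p * m4 -> `|(a + b) + (c + d)| <= p * ((m1 + m2) + (m3 + m4)).
Proof.
move=> h1 h2 h3 h4; rewrite !mulrDr; apply: (le_trans (ler_normD _ _)); apply: lerD;
  apply: (le_trans (ler_normD _ _)); exact: lerD.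
Qed.

Lemma convolD h f g B1 B2 : L1 h -> meas2 f -> (forall y, `|f y| <= B1) ->
  meas2 g -> (forall y, `|g y| <= B2) ->
  convol h (fun y => f y + g y) = fun x => convol h f x + convol h g x.
Proof.
move=> ih mf fB mg gB; apply/funext => x.
rewrite /convol -(RintegralD measurableT (convol_integrand_L1 x ih mf fB) (convol_integrand_L1 x ih mg gB)).
by apply: eq_Rintegral => y _; rewrite mulrDr.
Qed.

(** The kernels of the flux are odd and have moments of every order below 1. *)
Lemma lowpass_flux_error (a : R) : 0 <= a -> a < 1 ->
  exists2 C : R, 0 <= C & forall lam i s x, 0 < lam ->
    `|convol (lowpass_kernel chi lam) (flux u B chi i s) x| <= C * lam `^ (- a).
Proof.
move=> a0 a1; have [C C0 CE] := lowpass_error chi_symbol a0 a1.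
pose M i k l := B ^+ 2 * \int[leb2]_w `|kerM chi i k l w * `|w| `^ a|.
have M0 i k l : 0 <= M i k l by rewrite mulr_ge0 ?sqr_ge0// Rintegral_norm_ge0.
exists (C * \sum_(i < 2) \sum_(k < 2) \sum_(l < 2) M i k l).
  by rewrite mulr_ge0 ?(ltW C0)//; do 3 (apply: sumr_ge0 => ? _); exact: M0.
move=> lam i s x l0.
have ik := lowpass_kernel_L1 chi_symbol l0.
have E k l : `|convol (lowpass_kernel chi lam) (convol (kerM chi i k l) (vel2 u B s k l)) x|
    <= C * lam `^ (- a) * M i k l.
  apply: CE => //.
  - exact: L1_kerM.
  - by apply: Rintegral_odd; [exact: L1_kerM|exact: kerM_odd].
  - apply: decay3_moment_L1 => //; [exact: continuous_kerM|exact: decay3_kerM].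
  - exact: (meas2_vel2 sol).
  - by move=> y; exact: vel2_bound.
have mM k l : meas2 (convol (kerM chi i k l) (vel2 u B s k l)).
  apply: (@convol_measurable _ _ _ (B ^+ 2) (weight 2)).
  - by apply: L1_weight; rewrite ltr1n.
  - by move=> z; exact: weight_gt0.
  - exact: L1_kerM.
  - exact: (meas2_vel2 sol).
  - by move=> y; exact: vel2_bound.
have bM k l y : `|convol (kerM chi i k l) (vel2 u B s k l) y| <=
    B ^+ 2 * \int[leb2]_y `|kerM chi i k l y|.
  apply: convol_bound; [exact: L1_kerM|exact: (meas2_vel2 sol)|].
  by move=> z; exact: vel2_bound.
pose c k l := convol (kerM chi i k l) (vel2 u B s k l).
have cE k : convol (lowpass_kernel chi lam) (fun y => c k 0 y + c k 1 y) =
    fun x => convol (lowpass_kernel chi lam) (c k 0) x + convol (lowpass_kernel chi lam) (c k 1) x.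
  exact: (convolD ik (mM k 0) (bM k 0) (mM k 1) (bM k 1)).
have mc k : meas2 (fun y => c k 0 y + c k 1 y) by apply: measurable_funD; exact: mM.
have bc k y : `|c k 0 y + c k 1 y| <= B ^+ 2 * (\int[leb2]_y `|kerM chi i k 0 y|) +
    B ^+ 2 * \int[leb2]_y `|kerM chi i k 1 y|.
  by apply: (le_trans (ler_normD _ _)); apply: lerD; exact: bM.
have fE : flux u B chi i s = fun y => (c 0 0 y + c 0 1 y) + (c 1 0 y + c 1 1 y).
  by apply/funext => y; rewrite /flux !sum_ord2.
rewrite fE (convolD ik (mc 0) (bc 0) (mc 1) (bc 1)) !cE.
have SM : \sum_(k < 2) \sum_(l < 2) M i k l <= \sum_(i < 2) \sum_(k < 2) \sum_(l < 2) M i k l.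
  rewrite [leRHS]sum_ord2; have S0 j : 0 <= \sum_(k < 2) \sum_(l < 2) M j k l.
    by do 2 (apply: sumr_ge0 => ? _); exact: M0.
  by case: (ord2P i) => ->; [rewrite lerDl S0|rewrite lerDr S0].
have P0 : 0 <= C * lam `^ (- a) by rewrite mulr_ge0 ?(ltW C0) ?powR_ge0.
rewrite mulrAC; apply: le_trans (ler_wpM2l P0 SM).
have -> : \sum_(k < 2) \sum_(l < 2) M i k l = (M i 0 0 + M i 0 1) + (M i 1 0 + M i 1 1).
  by rewrite [LHS]sum_ord2 [X in X + _]sum_ord2 [X in _ + X]sum_ord2.
exact: norm_sum4 (E 0 0) (E 0 1) (E 1 0) (E 1 1).
Qed.

(** The components of [chi (lam D) (u t - u 0)]. *)
Definition lowpass_velocity t lam i x : R := convol (lowpass_kernel chi lam) (vel_incr t i) x.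

(** The estimate of [lowpass_error] for the two kernels of the Serfati identity;
    it is uniform in time, so that the flux term only costs a factor [t]. *)
Lemma lowpass_velocity_bound t (a : R) : 0 <= t -> 0 <= a -> a < 1 ->
  exists2 C : R, 0 <= C & forall lam i x, 0 < lam ->
    `|lowpass_velocity t lam i x| <= C * lam `^ (- a).
Proof.
move=> t0 a0 a1; have [C1 C1p E1] := lowpass_flux_error a0 a1.
have [C2 C2p E2] := lowpass_error chi_symbol a0 a1.
pose M i := (B + B) * \int[leb2]_w `|(chi \* biot_savart i) w * `|w| `^ a|.
have M0 i : 0 <= M i by rewrite mulr_ge0 ?addr_ge0 ?(ltW B0)// Rintegral_norm_ge0.
exists (C2 * (M 0 + M 1) + t * C1).
  by rewrite addr_ge0 ?mulr_ge0 ?(ltW C2p)// addr_ge0.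
move=> lam i x l0.
have ik := lowpass_kernel_L1 chi_symbol l0.
have [P _ kP] := lowpass_kernel_bounded chi_symbol l0.
pose h := convol (chi \* biot_savart i) (vort_incr t).
have mf := measurable_flux sol B0 cchi i.
have bf s y : `|flux u B chi i s y| <= B ^+ 2 * kerM_mass chi i by exact: (flux_bound sol B0 cchi).
pose J := primitive (flux u B chi i) t.
have mh : meas2 h.
  apply: (@convol_measurable _ _ _ (B + B) (weight 2)).
  - by apply: L1_weight; rewrite ltr1n.
  - by move=> z; exact: weight_gt0.
  - exact: L1_cut_biot_savart.
  - exact: meas2_vort_incr.
  - by move=> y; exact: vort_incr_bound.
have bh y : `|h y| <= (B + B) * \int[leb2]_y `|(chi \* biot_savart i) y|.
  by apply: convol_bound; [exact: L1_cut_biot_savart|exact: meas2_vort_incr|exact: vort_incr_bound].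
have mJ : meas2 J := meas2_primitive mf bf t.
have bJ y : `|J y| <= B ^+ 2 * kerM_mass chi i * t := primitive_bound mf bf y t0.
have -> : lowpass_velocity t lam i x =
    convol (lowpass_kernel chi lam) h x - convol (lowpass_kernel chi lam) J x.
  have <- := congr1 (fun F => F x) (convolDr ik mh bh mJ bJ).
  apply: (congr1 (fun F => F x)); apply: convol_ae.
  - exact: L1_measurable ik.
  - exact: meas2_vel_incr.
  - exact: measurable_funB.
  - have := (serfati_vel sol uwB cchi i t0). apply: filterS_ae => y. exact.
have iphi := L1_reflect x ik.
have JE : convol (lowpass_kernel chi lam) J x =
    \int[mu]_(s in `[0, t]) convol (lowpass_kernel chi lam) (flux u B chi i s) x.
  transitivity (\int[leb2]_y (J y * lowpass_kernel chi lam (x - y))).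
    by apply: eq_Rintegral => y _; rewrite mulrC.
  rewrite (primitive_swap mf bf t iphi); apply: eq_Rintegral => s _.
  by apply: eq_Rintegral => y _; rewrite mulrC.
rewrite JE mulrDl; apply: (le_trans (ler_normB _ _)); apply: lerD.
  apply: (@le_trans _ _ (C2 * lam `^ (- a) * M i)).
    apply: E2 => //.
    - exact: L1_cut_biot_savart.
    - by apply: Rintegral_odd; [exact: L1_cut_biot_savart|exact: cut_biot_savart_odd].
    - exact: cut_biot_savart_moment_L1.
    - exact: meas2_vort_incr.
    - by move=> y; exact: vort_incr_bound.
  rewrite mulrAC ler_wpM2r ?powR_ge0// ler_wpM2l ?(ltW C2p)//.
  by case: (ord2P i) => ->; [rewrite lerDl|rewrite lerDr].
rewrite Rintegral_ind.
apply: (@le_trans _ _ (\int[mu]_s (C1 * lam `^ (- a) * ind t s))).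
  apply: le_norm_RintegralT.
  - have m1 := integrable_measurable (Rfubini_integrable1 (primitive_integrable mf bf t iphi)).
    have := m1; congr (measurable_fun _ _); apply/funext => s /=.
    have ihp := integrable_mul_bounded iphi (measurable_slice mf s) (bf s).
    rewrite -[RHS](RintegralZl _ measurableT ihp).
    by apply: eq_Rintegral => y _; congr (_ * _); exact: mulrC.
  - exact: (@integrableZl _ _ _ mu setT measurableT _ (EFin \o ind t) (integrable_ind t)).
  - by move=> s; rewrite normrM mulrC (ger0_norm (ind_ge0 _ _)) ler_wpM2r ?ind_ge0// E1.
rewrite (RintegralZl _ measurableT (integrable_ind t)) integral_ind (max_idPl t0).
by rewrite mulrC mulrA.
Qed.

Lemma meas2_lowpass_velocity t lam i : 0 < lam -> meas2 (lowpass_velocity t lam i).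
Proof.
move=> l0; apply: (@convol_measurable _ _ _ (B + B) (weight 2)).
- by apply: L1_weight; rewrite ltr1n.
- by move=> z; exact: weight_gt0.
- exact: lowpass_kernel_L1.
- exact: meas2_vel_incr.
- by move=> y; exact: vel_incr_bound.
Qed.

Lemma enorm_le_cpnt (v : R * R) (M : R) : (forall i, `|cpnt i v| <= M) -> enorm v <= 2 * M.
Proof.
move=> h; apply: (le_trans (enorm_le_norm v)); rewrite ler_wpM2l// prod_normE ge_max.
by rewrite (h 0) (h 1).
Qed.

(** For a negative [alpha] the exponent 0 suffices, as [lam >= 1]. *)
Lemma lowpass_increment_decay t : 0 <= t ->
  exists g : R -> R * R -> R * R,
    (forall lam, 0 < lam -> is_lowpass chi lam (u t \- u 0) (g lam)) /\
    (forall alpha, alpha < 1 ->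
      exists C : R, \forall lam \near +oo_R,
        (linf_norm (g lam) <= (C * (1 / (lam `^ alpha)))%:E)%E).
Proof.
move=> t0; exists (fun lam x => (lowpass_velocity t lam 0 x, lowpass_velocity t lam 1 x)).
have cE lam i x : cpnt i (lowpass_velocity t lam 0 x, lowpass_velocity t lam 1 x) =
    lowpass_velocity t lam i x by case: (ord2P i) => ->.
split=> [lam l0|alpha a1].
- split; first split.
  + by apply: measurable_fun_pair; exact: meas2_lowpass_velocity.
  + have [C C0 h] := lowpass_velocity_bound t0 (lexx 0) ltr01.
    apply: (@le_lt_trans _ _ (2 * (C * lam `^ (- 0)))%:E); last exact: ltry.
    apply/linf_normP; apply: aeW => x; apply: enorm_le_cpnt => i.
    by rewrite cE; exact: h.
  + move=> i; have e1 : (fun x => (cpnt i (lowpass_velocity t lam 0 x, lowpass_velocity t lam 1 x))%:C%C) =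
        (fun x => (lowpass_velocity t lam i x)%:C%C).
      by apply/funext => x; rewrite cE.
    rewrite e1; have ln : lam != 0 by rewrite gt_eqF.
    have im : L1 (fun xi => chi (lam *: xi)).
      have := L1_affine 0 ln (chi_L1 chi_symbol); congr (leb2.-integrable setT (EFin \o _)).
      by apply/funext => xi; rewrite addr0.
    apply: (@is_fourier_multiplier_ae _ (fun xi => chi (lam *: xi)) _ (vel_incr t i) (B + B)) => //.
    * by move=> xi; rewrite scalerN (cutoff_even cchi).
    * have q0 : (2 * pi : R) ^+ 2 != 0 by rewrite expf_neq0// mulf_neq0// gt_eqF// pi_gt0.
      have := L1Z ((2 * pi) ^+ 2) (lowpass_kernel_L1 chi_symbol l0).
      congr (leb2.-integrable setT (EFin \o _)); apply/funext => x.
      by rewrite /lowpass_kernel mulrA mulfV// mul1r.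
    * have -> : (fun x => cpnt i ((u t \- u 0) x)) = fun x => cpnt i (u t x) - cpnt i (u 0 x).
        by apply/funext => x; rewrite /cpnt; case: ifP.
      by apply: measurable_funB; exact: (meas2_velocity sol).
    * exact: meas2_vel_incr.
    * exact: vel_incr_bound.
    * have := aeI (vel_ae uwB t0) (vel_ae uwB (lexx 0)); apply: filterS_ae => x [h1 h2].
      by rewrite /vel_incr h1 h2 /cpnt; case: ifP.
- pose a := Num.max alpha 0.
  have a0 : 0 <= a by rewrite le_max lexx orbT.
  have a1' : a < 1 by rewrite gt_max a1 ltr01.
  have [C C0 h] := lowpass_velocity_bound t0 a0 a1'.
  exists (2 * C); near=> lam.
  have l1 : 1 <= lam by near: lam; exact: nbhs_pinfty_ge.
  have l0 : 0 < lam by exact: lt_le_trans l1.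
  apply/linf_normP; apply: aeW => x.
  apply: (le_trans (enorm_le_cpnt (M := C * lam `^ (- a)) _)).
    by move=> i; rewrite cE; exact: h.
  rewrite -mulrA ler_wpM2l// ler_wpM2l// mul1r -powRN ler_powR// lerN2.
  by rewrite le_max lexx.
Unshelve. all: by end_near. Qed.

End LowpassEstimate.

(** * Test functions of space-time and integration by parts in time *)

Section SpaceTime.
Context {R : realType}.
Notation mu := (@lebesgue_measure R).
Implicit Types (x y : R * R) (phi psi : R * (R * R) -> R) (t s : R).

Lemma derive_time phi t x : differentiable phi (t, x) ->
  is_derive t (1 : R) (fun t => phi (t, x)) ('D_dir_t phi (t, x)).
Proof.
move=> df; have dp : is_diff t (fun t : R => (t, x)) (fun h => (h, 0)).
  by apply: is_diff_eq.
have dc : differentiable (fun t : R => phi (t, x)) t.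
  by apply: (@differentiable_comp _ _ _ _ (fun t => (t, x))).
apply: DeriveDef; first by apply: diff_derivable.
have dp' := @ex_diff _ _ _ _ _ _ _ dp.
by rewrite (derive_compose (1 : R) dp' df) (deriveE (1 : R) dp') (@diff_val _ _ _ _ _ _ _ dp).
Qed.

Lemma spacetime_slice_continuous phi t : continuous phi -> continuous (fun x => phi (t, x)).
Proof.
move=> cf x; apply: (@continuous_comp _ _ _ (fun x => (t, x)) phi); last exact: cf.
exact: (cvg_pair (cvg_cst t) cvg_id).
Qed.

Lemma spacetime_time_continuous phi x : continuous phi -> continuous (fun t => phi (t, x)).
Proof.
move=> cf t; apply: (@continuous_comp _ _ _ (fun t => (t, x)) phi); last exact: cf.
exact: (cvg_pair cvg_id (cvg_cst x)).
Qed.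

Lemma measurable_spacetime phi : continuous phi -> meas3 (fun q => phi (q.1, q.2)).
Proof.
move=> cf; apply: (@measurable_uncurry_continuous R _ (measurableTypeR R * measurableTypeR R)%type
  (fun t x => phi (t, x))).
  by move=> x; exact: spacetime_time_continuous.
by move=> t; apply: continuous_meas2; exact: spacetime_slice_continuous.
Qed.

Lemma spacetime_supp_time phi (r : R) t x : supp_in r phi -> r < `|t| -> phi (t, x) = 0.
Proof. by move=> pr rt; apply: pr; rewrite prod_normE lt_max rt. Qed.

Lemma spacetime_supp_space phi (r : R) t : supp_in r phi -> supp_in r (fun x => phi (t, x)).
Proof. by move=> pr x rx; apply: pr; rewrite prod_normE lt_max rx orbT. Qed.

(** A single domination for all times, so that space-time integrals reduce to
    the mass of [weight 2]. *)
Lemma spacetime_le_weight phi (r : R) : 0 < r -> continuous phi -> supp_in r phi ->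
  exists2 N : R, 0 < N & forall t x, `|phi (t, x)| <= N * weight 2 x.
Proof.
move=> r0 cf pr; set box := [set p : R * (R * R) | `|p| <= r].
have cb : compact box.
  have -> : box = `[- r, r]%classic `*` [set x : R * R | `|x| <= r].
    apply/seteqP; split => -[a b].
      by rewrite /box [X in X -> _]/= prod_normE ge_max /= ler_norml in_itv /= => /andP[].
    move=> -[h1 h2]; change (`|(a, b)| <= r); rewrite prod_normE ge_max ler_norml.
    by move: h1; rewrite /= in_itv /= => ->.
  by apply: compact_setX; [exact: segment_compact|exact: compact_box].
have [c _ fc] : exists2 c : R * (R * R), c \in box & forall p : R * (R * R), p \in box -> `|phi p| <= `|phi c|.
  apply: (@compact_EVT_max _ _ (fun p : R * (R * R) => `|phi p|)) => //.
  - by exists 0; rewrite /box /= normr0 ltW.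
  - by apply: continuous_subspaceT => p; apply: cvg_norm; exact: cf.
pose w0 : R := ((1 + r) `^ (- 2)) ^+ 2.
have w0p : 0 < w0 by rewrite exprn_gt0// powR_gt0// addr_gt0.
exists ((`|phi c| + 1) / w0); first by rewrite divr_gt0// ltr_wpDl.
move=> t x; have [xr|rx] := leP `|(t, x)| r; last first.
  by rewrite pr// normr0 mulr_ge0 ?ltW ?weight_gt0// divr_gt0// ltr_wpDl.
rewrite mulrAC ler_pdivlMr//; apply: ler_pM => //; first exact: ltW.
  by rewrite (le_trans (fc _ _)) ?inE// lerDl.
by apply: weight_ge => //; move: xr; rewrite prod_normE ge_max => /andP[].
Qed.

Lemma L1_slice phi t (N : R) : continuous phi -> (forall t x, `|phi (t, x)| <= N * weight 2 x) ->
  L1 (fun x => phi (t, x)).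
Proof.
move=> cf h; apply: (@L1_le_weight _ _ 2 N); first by rewrite ltr1n.
  by apply: continuous_meas2; exact: spacetime_slice_continuous.
exact: h.
Qed.

Lemma Rintegral_time_derive phi a b x : a <= b -> smooth phi ->
  \int[mu]_t (window a b t * 'D_dir_t phi (t, x)) = phi (b, x) - phi (a, x).
Proof.
move=> ab sp; rewrite -Rintegral_window.
have [->|ab'] := eqVneq a b; first by rewrite set_itv1 Rintegral_set1 subrr.
have sd := smooth_derive dir_t sp.
have := @derivable_FTC2 _ (fun t => 'D_dir_t phi (t, x)) (fun t => phi (t, x)) a b.
rewrite lt_neqAle ab' ab => /(_ isT) H.
suff E : (\int[mu]_(t in `[a, b]) ('D_dir_t phi (t, x))%:E = (phi (b, x))%:E - (phi (a, x))%:E)%E.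
  by rewrite /Rintegral E.
apply: H.
- move=> t _; apply: derive_time.
  exact: Cn_differentiable (smooth_Cn 0 setT sp) I.
- by move=> t _; exact: (spacetime_time_continuous (smooth_continuous sd)).
Qed.

(** The half line is only seen up to the time where the test function dies. *)
Lemma Rintegral_halfline (f : R -> R) T : (forall t, T < t -> f t = 0) ->
  \int[mu]_(t in `[0, +oo[) f t = \int[mu]_t (ind T t * f t).
Proof.
move=> fT; rewrite Rintegral_mkcond; apply: eq_Rintegral => t _.
rewrite indE /patch; case: (boolP (0 <= t)) => t0.
  rewrite mem_set /=; last by rewrite in_itv /= t0.
  by case: (leP t T) => tT; rewrite ?mul1r// fT// mulr0.
by rewrite memNset ?mul0r//= in_itv /= (negbTE t0).
Qed.

Section Flow.
Variables (h : R -> R * R -> R) (C : R).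
Hypothesis mh : meas3 (fun q => h q.1 q.2).
Hypothesis hC : forall s x, `|h s x| <= C.
Variables (phi : R * (R * R) -> R) (r T N : R).
Hypotheses (sphi : smooth phi) (r0 : 0 < r) (phir : supp_in r phi) (rT : r < T).
Hypothesis phiN : forall t x, `|'D_dir_t phi (t, x)| <= N * weight 2 x.
Hypothesis phiN' : forall t x, `|phi (t, x)| <= N * weight 2 x.

Let psi : R * (R * R) -> R := 'D_dir_t phi.
Let spsi : smooth psi := smooth_derive dir_t sphi.
Let cpsi : continuous psi := smooth_continuous spsi.
Let cphi : continuous phi := smooth_continuous sphi.
Let T0 : 0 < T := lt_trans r0 rT.
Let C0 : 0 <= C := le_trans (normr_ge0 _) (hC 0 0).
Let N0 : 0 <= N.
Proof.
have := le_trans (normr_ge0 _) (phiN 0 0).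
by rewrite pmulr_lge0// weight_gt0.
Qed.

(** [k] need only be bounded on the time window, as is the case of primitives
    in time. *)
Lemma spacetime_integrable (k : R -> R * R -> R) (K : R) (eta : R * (R * R) -> R) :
  meas3 (fun q => k q.1 q.2) ->
  continuous eta -> (forall t x, `|eta (t, x)| <= N * weight 2 x) ->
  (forall t x, 0 <= t <= T -> `|k t x| <= K) ->
  (mu \x leb2s)%E.-integrable setT
    (EFin \o (fun q : R * (R * R) => ind T q.1 * (k q.1 q.2 * eta (q.1, q.2)))).
Proof.
move=> mk ce hN kK.
have K0 : 0 <= K by apply: le_trans (kK 0 0 _); rewrite ?lexx ?(ltW T0).
have iw : L1 (weight (2 : R)) by apply: L1_weight; rewrite ltr1n.
have me := measurable_spacetime ce.
have bound t x : `|ind T t * (k t x * eta (t, x))| <= ind T t * (K * (N * weight 2 x)).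
  rewrite normrM (ger0_norm (ind_ge0 _ _)) indE; case: (boolP (0 <= t <= T)) => [tT|_]; last by rewrite !mul0r.
  by rewrite !mul1r normrM; apply: ler_pM => //; exact: kK.
have mslice t : meas2 (fun x => ind T t * (k t x * eta (t, x))).
  apply: measurable_funM; first exact: measurable_cst.
  apply: measurable_funM; first exact: (measurableT_comp mk (measurable_pair1 t)).
  by apply: continuous_meas2; exact: spacetime_slice_continuous.
have idom t : L1 (fun x => ind T t * (K * (N * weight 2 x))) by do 3 apply: L1Z.
have islice t : L1 (fun x => ind T t * (k t x * eta (t, x))).
  by apply: (integrable_dominated (idom t) (mslice t)) => x; exact: bound.
apply: (@integrable_iterated _ _ _ _ _ mu leb2s _
   (fun t => ind T t * (K * (N * \int[leb2]_x weight 2 x)))).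
- apply: measurable_funM; first exact: (measurableT_comp (measurable_ind T) measurable_fst).
  exact: measurable_funM.
- exact: islice.
- apply: (@integrable_ind_mul _ T _ (K * (N * \int[leb2]_x weight 2 x))).
    exact: measurable_cst.
  by move=> s; rewrite ger0_norm// !mulr_ge0//; apply: Rintegral_ge0 => x _; rewrite ltW// weight_gt0.
move=> t /=.
rewrite -(RintegralZl N measurableT iw) -(RintegralZl K measurableT (L1Z N iw)).
rewrite -(RintegralZl (ind T t) measurableT (L1Z K (L1Z N iw))).
exact: (le_Rintegral measurableT (L1_norm (islice t)) (idom t) (fun x _ => bound t x)).
Qed.

Lemma primitive_on_window t x : 0 <= t <= T -> `|primitive h t x| <= C * T.
Proof.
move=> /andP[t0 tT]; apply: (le_trans (primitive_bound mh hC x t0)).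
by rewrite ler_wpM2l.
Qed.

Lemma primitive_bound_abs t x : `|primitive h t x| <= C * `|t|.
Proof.
by have := primitive_lipschitz mh hC t 0 x; rewrite (primitive0 h x (lexx 0)) !subr0.
Qed.

Lemma measurable_primitive : meas3 (fun q => primitive h q.1 q.2).
Proof.
apply: (@measurable_uncurry_continuous R _ (measurableTypeR R * measurableTypeR R)%type (primitive h)).
  by move=> x; exact: primitive_continuous mh hC x.
by move=> t; exact: meas2_primitive mh hC t.
Qed.

Lemma phi_end x : phi (T, x) = 0.
Proof. by apply: spacetime_supp_time phir _; rewrite (gtr0_norm T0). Qed.

(** At a fixed point, the integral over [0 <= s <= t <= T] of [h s] against the
    time derivative of [phi] at [t], in both orders. *)
Lemma primitive_parts x :
  \int[mu]_t (ind T t * (primitive h t x * psi (t, x))) =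
  - \int[mu]_s (ind T s * (h s x * phi (s, x))).
Proof.
pose W := N * weight 2 x.
have W0 : 0 <= W by apply: le_trans (phiN' 0 x).
have mhx := measurable_slice_time mh x.
have mpx : measurable_fun setT (fun t => psi (t, x)).
  by apply: continuous_measurable_fun; exact: spacetime_time_continuous.
(* [q.1] is the later time [t], [q.2] the earlier time [s]. *)
pose F (q : R * R) : R := ind T q.1 * (ind q.1 q.2 * h q.2 x * psi (q.1, x)).
have iT := integrable_ind T.
have mind2 : meas2 (fun q : R * R => ind q.1 q.2).
  have -> : (fun q : R * R => ind q.1 q.2) =
      (fun q : R * R => if (0 <= q.2) && (q.2 <= q.1) then 1 else 0).
    by apply/funext => q; rewrite indE; case: ifP.
  have m1 : @measurable_fun _ _ (measurableTypeR R * measurableTypeR R)%type (measurableTypeR R) setT fst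
    by exact: measurable_fst.
  have m2 : @measurable_fun _ _ (measurableTypeR R * measurableTypeR R)%type (measurableTypeR R) setT snd
    by exact: measurable_snd.
  apply: measurable_fun_ifT; [|exact: measurable_cst|exact: measurable_cst].
  by apply: measurable_and; apply: measurable_fun_ler => //; exact: measurable_cst.
have mF : @measurable_fun _ _ (measurableTypeR R * measurableTypeR R)%type R setT F.
  apply: measurable_funM; first exact: (measurableT_comp (measurable_ind T) measurable_fst).
  apply: measurable_funM; last exact: (measurableT_comp mpx measurable_fst).
  by apply: measurable_funM => //; exact: (measurableT_comp mhx measurable_snd).
have Fb t s : `|F (t, s)| <= (C * W * ind T t) * ind T s.
  rewrite /F /=; case: (boolP ((0 <= t <= T) && (0 <= s <= t))) => [/andP[tT st]|nn].
    have sT : 0 <= s <= T.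
      by move: tT st => /andP[_ tT] /andP[-> st]; exact: le_trans st tT.
    rewrite !indE tT st sT !mul1r !mulr1 normrM; apply: ler_pM => //; exact: phiN.
  have -> : ind T t * (ind t s * h s x * psi (t, x)) = 0.
    rewrite !indE; move: nn; case: (0 <= t <= T) => /=; last by rewrite mul0r.
    by move=> /negbTE ->; rewrite !mul0r mulr0.
  by rewrite normr0; exact: mulr_ge0 (mulr_ge0 (mulr_ge0 C0 W0) (ind_ge0 T t)) (ind_ge0 T s).
have Fslice t : measurable_fun setT (fun s => F (t, s)).
  exact: (measurableT_comp mF (measurable_pair1 t)).
have idom (c : R) : mu.-integrable setT (EFin \o (fun s => c * ind T s)).
  exact: (@integrableZl _ _ _ mu setT measurableT c (EFin \o ind T) iT).
have iFt t : mu.-integrable setT (EFin \o (fun s => F (t, s))).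
  exact: integrable_dominated (idom _) (Fslice t) (Fb t).
have iF : (mu \x mu)%E.-integrable setT (EFin \o F).
  apply: (@integrable_iterated _ _ _ _ _ mu mu F (fun t => (C * W * T) * ind T t)) => //.
  move=> t; apply: (@le_trans _ _ (\int[mu]_s ((C * W * ind T t) * ind T s))).
    exact: (le_Rintegral measurableT (integrable_abse (iFt t)) (idom _) (fun s _ => Fb t s)).
  rewrite (RintegralZl _ measurableT iT) integral_ind (max_idPl (ltW T0)).
  by rewrite mulrAC.
have E := Rfubini iF; rewrite /= in E.
have i1 t := integrable_ind_mul t mhx (hC ^~ x).
transitivity (\int[mu]_t \int[mu]_s F (t, s)).
  apply: eq_Rintegral => t _; rewrite /primitive Rintegral_ind.
  rewrite -(RintegralZr _ measurableT (i1 t)).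
  have i2 : mu.-integrable setT (EFin \o (fun s => ind t s * h s x * psi (t, x))).
    exact: (@integrableZr _ _ _ mu setT measurableT (psi (t, x)) _ (i1 t)).
  by rewrite -[LHS](RintegralZl (ind T t) measurableT i2); apply: eq_Rintegral.
rewrite E.
have mphx : measurable_fun setT (fun t => phi (t, x)).
  by apply: continuous_measurable_fun; exact: spacetime_time_continuous.
have ihp : mu.-integrable setT (EFin \o (fun s => ind T s * (h s x * phi (s, x)))).
  apply: (@integrable_ind_mul _ T (fun s => h s x * phi (s, x)) (C * W)).
    exact: measurable_funM.
  by move=> s; rewrite normrM; apply: ler_pM => //; exact: phiN'.
rewrite -mulN1r -[RHS](RintegralZl _ measurableT ihp).
apply: eq_Rintegral => s _.
have [sT|sT] := boolP (0 <= s <= T); last first.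
  rewrite [in RHS]indE (negbTE sT) mul0r mulr0; apply: Rintegral_eq0 => t.
  rewrite /F /= !indE; case: (boolP (0 <= t <= T)) => tT; last by rewrite mul0r.
  case: (boolP (0 <= s <= t)) => st; last by rewrite !mul0r mulr0.
  move: sT; rewrite negb_and; move: st tT => /andP[s0 st] /andP[_ tT].
  by rewrite s0 (le_trans st tT).
have [s0 sT'] := andP sT.
have FE t : F (t, s) = h s x * (window s T t * psi (t, x)).
  rewrite /F /= !indE windowE s0 /=; case: (boolP (s <= t)) => st; last by rewrite !mul0r !mulr0.
  by rewrite (le_trans s0 st) /=; case: (t <= T) => /=; ring.
have -> : (fun t => F (t, s)) = fun t => h s x * (window s T t * psi (t, x)) by apply/funext.
have iw : mu.-integrable setT (EFin \o (fun t => window s T t * psi (t, x))).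
  apply: (integrable_dominated (idom W)).
    exact: (measurable_funM (measurable_window s T) mpx).
  move=> t; rewrite normrM windowE indE; case: (boolP (s <= t <= T)) => st.
    move: (st) => /andP[st1 st2]; rewrite (le_trans s0 st1) st2 /= normr1 mul1r mulr1.
    exact: phiN.
  by rewrite normr0 mul0r mulr_ge0.
rewrite [LHS](RintegralZl _ measurableT iw).
have D0 := Rintegral_time_derive x sT' sphi.
rewrite [X in _ * X]D0 phi_end indE sT.
by rewrite mul1r sub0r mulrN mulN1r.
Qed.

(** [primitive_parts] integrated in space; the fields are not differentiable in
    time, so that the time derivative stays on the test function throughout. *)
Lemma flow_parts :
  \int[mu]_t (ind T t * \int[leb2]_x (primitive h t x * psi (t, x))) =
  - \int[mu]_s (ind T s * \int[leb2]_x (h s x * phi (s, x))).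
Proof.
have iA := spacetime_integrable measurable_primitive cpsi phiN primitive_on_window.
have iB := spacetime_integrable mh cphi phiN' (fun t x _ => hC t x).
have EA := Rfubini iA; have EB := Rfubini iB; rewrite /= in EA EB.
transitivity (\int[mu]_t \int[leb2s]_x (ind T t * (primitive h t x * psi (t, x)))).
  apply: eq_Rintegral => t _; rewrite [RHS](RintegralZl _ measurableT)//.
  exact: (integrable_bounded_mul (L1_slice t cpsi phiN) (meas2_primitive mh hC t) (primitive_bound_abs t)).
rewrite EA.
have iBx : L1 (fun x => \int[mu]_s (ind T s * (h s x * phi (s, x)))) := Rfubini_integrable2 iB.
transitivity (- \int[leb2]_x \int[mu]_s (ind T s * (h s x * phi (s, x)))).
  rewrite -mulN1r -[RHS](RintegralZl _ measurableT iBx).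
  by apply: eq_Rintegral => x _; rewrite mulN1r; exact: primitive_parts.
congr (- _); rewrite -[LHS]EB; apply: eq_Rintegral => s _.
rewrite [LHS](RintegralZl _ measurableT)//.
exact: (integrable_bounded_mul (L1_slice s cphi phiN') (measurable_slice mh s) (hC s)).
Qed.

(** The boundary term at time 0, which produces the initial datum. *)
Lemma initial_parts (v : R * R -> R) (K : R) : meas2 v -> (forall x, `|v x| <= K) ->
  \int[mu]_t (ind T t * \int[leb2]_x (v x * psi (t, x))) = - \int[leb2]_x (v x * phi (0, x)).
Proof.
move=> mv vK.
have mv2 : meas3 (fun q : R * (R * R) => v q.2) by exact: (measurableT_comp mv measurable_snd).
have iA := spacetime_integrable (k := fun _ => v) mv2 cpsi phiN (fun t x _ => vK x).
have EA := Rfubini iA; rewrite /= in EA.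
transitivity (\int[mu]_t \int[leb2s]_x (ind T t * (v x * psi (t, x)))).
  apply: eq_Rintegral => t _; rewrite [RHS](RintegralZl _ measurableT)//.
  exact: (integrable_bounded_mul (L1_slice t cpsi phiN) mv vK).
rewrite EA.
have i0 : L1 (fun x => v x * phi (0, x)).
  exact: (integrable_bounded_mul (L1_slice 0 cphi phiN') mv vK).
rewrite -mulN1r -[RHS](RintegralZl _ measurableT i0); apply: eq_Rintegral => x _.
have mpx : measurable_fun setT (fun t => psi (t, x)).
  by apply: continuous_measurable_fun; exact: spacetime_time_continuous.
have ip := integrable_ind_mul T mpx (fun t => phiN t x).
transitivity (v x * \int[mu]_t (ind T t * psi (t, x))).
  by rewrite -[RHS](RintegralZl _ measurableT ip); apply: eq_Rintegral => t _; rewrite mulrCA.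
have := @Rintegral_time_derive phi 0 T x (ltW T0) sphi; rewrite phi_end => E0.
by rewrite [X in v x * X]E0; move: (v x) (phi (0, x)) => a b; ring.
Qed.

End Flow.
End SpaceTime.

(** * The projected equation *)

Section Limits.
Context {R : realType}.
Notation mu := (@lebesgue_measure R).

(** A uniform rate on the window replaces a pointwise bound; it also provides
    the measurability of the limit, which is not known beforehand. *)
Lemma Rcvg_window (p : nat -> R -> R) (q : R -> R) (T K M : R) :
  (forall n, measurable_fun setT (fun t => ind T t * p n t)) ->
  (forall n t, 0 <= t <= T -> `|p n t - q t| <= K * n.+1%:R^-1) ->
  (forall t, 0 <= t <= T -> `|p 0%N t| <= M) ->
  \int[mu]_t (ind T t * p n t) @[n --> \oo] --> \int[mu]_t (ind T t * q t).
Proof.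
move=> mp pq pM.
have cv t : ind T t * p n t @[n --> \oo] --> ind T t * q t.
  case: (boolP (0 <= t <= T)) => tT; last first.
    under eq_fun do rewrite indE (negbTE tT) mul0r.
    by rewrite indE (negbTE tT) mul0r; exact: cvg_cst.
  apply: cvgM; first exact: cvg_cst.
  have h : K * n.+1%:R^-1 @[n --> \oo] --> 0.
    by rewrite -[X in _ --> X](mulr0 K); apply: cvgM; [exact: cvg_cst|exact: cvg_harmonic].
  apply/cvgrPdist_le => e e0.
  have [N _ HN] := (cvgrPdist_le _ _).1 h e e0.
  exists N => // n /HN; rewrite sub0r normrN => hn.
  rewrite distrC; apply: le_trans (pq n t tT) (le_trans _ hn); exact: ler_norm.
have bd t n : `|ind T t * p n t| <= (M + K + `|K|) * ind T t.
  rewrite indE; case: (boolP (0 <= t <= T)) => tT; last by rewrite !mul0r mulr0 normr0.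
  rewrite mul1r mulr1.
  have h1 := pq n t tT; have h2 := pq 0%N t tT; have h3 := pM t tT.
  have k1 : K * n.+1%:R^-1 <= `|K|.
    apply: (le_trans (ler_norm _)); rewrite normrM ler_piMr// ger0_norm ?invr_ge0//.
    by rewrite invf_le1// ler1n.
  rewrite invr1 mulr1 in h2.
  have -> : p n t = (p n t - q t) + (p 0%N t - (p 0%N t - q t)) by ring.
  apply: (le_trans (ler_normD _ _)); rewrite [leRHS]addrC; apply: lerD; first exact: le_trans k1.
  by apply: (le_trans (ler_normB _ _)); apply: lerD.
apply: (@Rdominated_cvg _ _ _ mu setT _ _ (fun t => (M + K + `|K|) * ind T t)) => //.
- by apply: (@measurable_fun_cvg _ _ _ setT (fun n t => ind T t * p n t)) => // t _; exact: cv.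
- exact: (@integrableZl _ _ _ mu setT measurableT _ (EFin \o ind T) (integrable_ind T)).
- by apply: aeW => t _; exact: cv.
- by apply: aeW => t n _; exact: bd.
Qed.

Lemma Rintegral_sum2 (F : 'I_2 -> 'I_2 -> R * R -> R) : (forall k l, L1 (F k l)) ->
  \int[leb2]_x (\sum_(k < 2) \sum_(l < 2) F k l x) = \sum_(k < 2) \sum_(l < 2) \int[leb2]_x F k l x.
Proof.
move=> iF; rewrite [RHS]sum_ord2 [X in X + _]sum_ord2 [X in _ + X]sum_ord2.
rewrite -(RintegralD measurableT (iF 0 0) (iF 0 1)) -(RintegralD measurableT (iF 1 0) (iF 1 1)).
rewrite -(RintegralD measurableT (L1D (iF 0 0) (iF 0 1)) (L1D (iF 1 0) (iF 1 1))).
by apply: eq_Rintegral => x _; rewrite !sum_ord2.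
Qed.

End Limits.

Section WeakSolution.
Context {R : realType}.
Notation mu := (@lebesgue_measure R).
Implicit Types (x y : R * R) (psi : R * R -> R).
Variables (u : R -> R * R -> R * R) (w : R -> R * R -> R).
Hypothesis sol : serfati_with_vorticity u w.
Variable B : R.
Hypothesis B0 : 0 < B.
Hypothesis uwB : forall t, 0 <= t ->
  [/\ {ae leb2, forall x, enorm (u t x) <= B} & {ae leb2, forall x, `|w t x| <= B}].

Lemma fun_dist_ae (f g : R * R -> R) psi : meas2 f -> meas2 g -> meas2 psi ->
  {ae leb2, forall x, f x = g x} -> fun_dist f psi = fun_dist g psi.
Proof.
move=> mf mg mp fg; apply: eq_Rintegral_ae.
- exact: measurable_funM.
- exact: measurable_funM.
- by apply: filterS_ae fg => x ->.
Qed.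

Lemma gamma_conv_ae theta j k l (f g : R * R -> R) psi : cutoff theta -> meas2 f -> meas2 g ->
  {ae leb2, forall x, f x = g x} -> gamma_conv theta j k l f psi = gamma_conv theta j k l g psi.
Proof.
move=> cth mf mg fg; rewrite /gamma_conv.
rewrite (convol_ae (L1_measurable (L1_cut_fundsol cth)) mf mg fg).
by rewrite (convol_ae (L1_measurable (L1_kerG cth j k l)) mf mg fg).
Qed.

(** The projection is linear in classes of bounded fields, so that the truncated
    products may be used. *)
Lemma leray_div_vel theta t i psi : cutoff theta -> 0 <= t -> smooth psi ->
  leray_div theta (tensor (u t)) i psi = leray_div theta (vel2 u B t) i psi.
Proof.
move=> cth t0 sp.
have mT k l : meas2 (tensor (u t) k l) by apply: measurable_funM; exact: (meas2_velocity sol).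
have mV := meas2_vel2 sol B t.
have E k l : {ae leb2, forall x, tensor (u t) k l x = vel2 u B t k l x}.
  by have := vel_ae uwB t0; apply: filterS_ae => x hx; rewrite /vel2 /tensor !hx.
rewrite /leray_div; apply: (f_equal2 (fun a b : R => a + b)).
  apply: eq_bigr => k _; rewrite /dderive; congr (- _); apply: fun_dist_ae => //.
  by apply: continuous_meas2; apply: smooth_continuous; exact: smooth_derive.
by apply: eq_bigr => j _; apply: eq_bigr => k _; exact: gamma_conv_ae.
Qed.

(** [convol_identity] summed over the components of the tensor; the Kronecker
    symbol selects the divergence. *)
Lemma flux_leray theta theta' i t psi : cutoff theta -> cutoff theta' -> 0 <= t -> test psi ->
  \int[leb2]_x (flux u B theta' i t x * psi x) =
  leray_div theta (tensor (u t)) i psi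
  - \sum_(k < 2) \sum_(l < 2)
      \int[leb2]_x (convol (theta' \* biot_savart i) (vel2 u B t k l) x
                    * gradperp l (partial k psi) x).
Proof.
move=> cth cth' t0 tp; have [sp [r r0 pr]] := test_supp tp.
rewrite (leray_div_vel i cth t0 sp).
pose Q k l := \int[leb2]_x (convol (kerM theta' i k l) (vel2 u B t k l) x * psi x).
have ip := supp_L1 (smooth_continuous sp) pr.
have mM := meas2_vel2 sol B t.
have bM k l := vel2_bound u B0 t k l.
have iQ k l : L1 (fun x => convol (kerM theta' i k l) (vel2 u B t k l) x * psi x).
  exact: (convol_mul_L1 (L1_kerM cth' i k l) (mM k l) (bM k l) ip).
have -> : \int[leb2]_x (flux u B theta' i t x * psi x) = \sum_(k < 2) \sum_(l < 2) Q k l.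
  rewrite -[RHS](Rintegral_sum2 iQ); apply: eq_Rintegral => x _.
  by rewrite /flux mulr_suml; apply: eq_bigr => k _; rewrite mulr_suml.
rewrite /leray_div -big_split -sumrB; apply: eq_bigr => k _ /=.
pose X k l := \int[leb2]_x (vel2 u B t k l x * partial k psi x).
pose G k l := gamma_conv theta k l i (vel2 u B t k l) psi.
pose Er k l := \int[leb2]_x (convol (theta' \* biot_savart i) (vel2 u B t k l) x
                    * gradperp l (partial k psi) x).
have QE l : Q k l = - (i == l)%:R * X k l + G k l - Er k l.
  exact: (convol_identity cth cth' i k l (mM k l) (bM k l) tp).
have dE : dderive (edir k) (fun_dist (vel2 u B t k i)) psi = - X k i by [].
rewrite dE [LHS]sum_ord2 !QE -/(G k) -/(Er k).
have -> : \sum_(l < 2) G k l = G k 0 + G k 1 by exact: sum_ord2.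
have -> : \sum_(l < 2) Er k l = Er k 0 + Er k 1 by exact: sum_ord2.
by case: (ord2P i) => ->; rewrite /=; move: (X k 0) (X k 1) (G k 0) (G k 1) (Er k 0) (Er k 1)
  => a b c d e f; ring.
Qed.

Definition cut_mass (theta : R * R -> R) (i : 'I_2) : R := \int[leb2]_x `|(theta \* biot_savart i) x|.

Lemma pairing_bound (h f g : R * R -> R) (K Q : R) : L1 h -> meas2 f -> (forall x, `|f x| <= K) ->
  L1 g -> \int[leb2]_x `|g x| <= Q ->
  `|\int[leb2]_x (convol h f x * g x)| <= K * (\int[leb2]_x `|h x|) * Q.
Proof.
move=> ih mf fK ig gQ; have K0 := le_trans (normr_ge0 _) (fK 0).
have P0 : 0 <= K * \int[leb2]_x `|h x| by rewrite mulr_ge0// Rintegral_norm_ge0.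
apply: (le_trans _ (ler_wpM2l P0 gQ)).
rewrite -[leRHS](RintegralZl _ measurableT (L1_norm ig)).
apply: le_norm_Rintegral2.
- by apply: L1Z; exact: L1_norm.
- exact: L1_measurable (convol_mul_L1 ih mf fK ig).
- by move=> x; rewrite normrM ler_wpM2r//; exact: convol_bound.
Qed.

(** The error is proportional to the mass of the cut-off kernel, uniformly in
    time. *)
Lemma flux_leray_error theta theta' i t psi (Q : R) : cutoff theta -> cutoff theta' -> 0 <= t ->
  test psi -> (forall k l, \int[leb2]_x `|gradperp l (partial k psi) x| <= Q) ->
  `|\int[leb2]_x (flux u B theta' i t x * psi x) - leray_div theta (tensor (u t)) i psi|
    <= (B ^+ 2 * (\sum_(k < 2) \sum_(l < 2) Q)) * cut_mass theta' i.
Proof.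
move=> cth cth' t0 tp hQ; have [sp [r r0 pr]] := test_supp tp.
rewrite (flux_leray i cth cth' t0 tp) addrC addKr normrN mulrAC.
apply: sum2_bound => k l.
apply: pairing_bound (hQ k l).
- exact: L1_cut_biot_savart.
- exact: (meas2_vel2 sol).
- by move=> x; exact: vel2_bound.
have sk : smooth (partial k psi) := smooth_derive (edir k) sp.
have sg : smooth (partial (pidx l) (partial k psi)) := smooth_derive (edir (pidx l)) sk.
have gr := supp_in_derive (edir (pidx l)) (supp_in_derive (edir k) pr).
rewrite gradperpE; apply: L1Z; exact: supp_L1 (smooth_continuous sg) gr.
Qed.

Lemma second_derivatives_le_weight (phi : R * (R * R) -> R) : test phi ->
  exists2 N : R, 0 < N & forall k l t x,
    `|gradperp l (partial k (fun x => phi (t, x))) x| <= N * weight 2 x.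
Proof.
move=> tp; have [sp [r r0 pr]] := test_supp tp.
have H k l : exists2 N : R, 0 < N & forall t x,
    `|gradperp l (partial k (fun x => phi (t, x))) x| <= N * weight 2 x.
  pose s := [:: edir (pidx l); edir k] : seq (R * R).
  pose g := iter_derive [seq (0, v) | v <- s] phi.
  have sg : smooth g by do 2 apply: smooth_derive.
  have gr : supp_in r g by do 2 apply: supp_in_derive.
  have [N N0 h] := spacetime_le_weight r0 (smooth_continuous sg) gr.
  exists N => // t x; rewrite gradperpE normrM.
  have -> : `|psign l| = 1 :> R by rewrite /psign; case: ifP; rewrite ?normrN normr1.
  rewrite mul1r; have e : partial (pidx l) (partial k (fun x0 => phi (t, x0))) x = g (t, x).
    exact: (congr1 (fun F : R * R -> R => F x) (iter_derive_slice t s sp)).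
  by rewrite e; exact: h.
have [N1 p1 h1] := H 0 0; have [N2 p2 h2] := H 0 1.
have [N3 p3 h3] := H 1 0; have [N4 p4 h4] := H 1 1.
exists (N1 + N2 + (N3 + N4)); first by rewrite !addr_gt0.
move=> k l t x; have w0 := ltW (weight_gt0 2 x).
by case: (ord2P k) => ->; case: (ord2P l) => ->;
  [apply: le_trans (h1 t x) _|apply: le_trans (h2 t x) _|apply: le_trans (h3 t x) _
  |apply: le_trans (h4 t x) _]; rewrite ler_wpM2r//; lra.
Qed.

Lemma leray_div0 theta (f : 'I_2 -> 'I_2 -> R * R -> R) i psi : (forall x, psi x = 0) ->
  leray_div theta f i psi = 0.
Proof.
move=> p0; have -> : psi = cst 0 by apply/funext.
have d0 v : 'D_v (cst 0 : R * R -> R) = cst 0.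
  by apply/funext => x; rewrite derive_cst.
have f0 (g : R * R -> R) : fun_dist g (cst 0) = 0.
  by apply: Rintegral_eq0 => x; rewrite mulr0.
rewrite /leray_div big1 ?add0r; last by move=> k _; rewrite /dderive d0 f0 oppr0.
apply: big1 => k _; apply: big1 => l _.
by rewrite /gamma_conv [X in _ + X]f0 addr0 /dderive (d0 (edir k)) (d0 (edir l)) (d0 (edir i)) f0 !oppr0.
Qed.

Section Test.
Variables (theta : R * R -> R) (i : 'I_2) (phi : R * (R * R) -> R).
Hypotheses (cth : cutoff theta) (tphi : test phi).

(** With the cut-offs [theta ((n+1) x)], the velocity is its initial value minus
    the time integral of the flux, up to [O (1/n)]; against the time derivative
    of [phi] the integral becomes the flux against [phi], which tends to the
    projection. *)
Lemma velocity_weak_equation :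
  dderive dir_t (spacetime_dist (fun t => cpnt i \o u t)) phi
  + \int[mu]_(t in `[0, +oo[) leray_div theta (tensor (u t)) i (fun x => phi (t, x)) =
  \int[leb2]_x (cpnt i (u 0 x) * phi (0, x)).
Proof.
have [sphi [r r0 phir]] := test_supp tphi.
pose T := r + 1; have rT : r < T by rewrite ltrDl.
have T0 : 0 < T := lt_trans r0 rT.
pose psi := 'D_dir_t phi : R * (R * R) -> R.
have spsi : smooth psi := smooth_derive dir_t sphi.
have psir : supp_in r psi := supp_in_derive dir_t phir.
have cphi := smooth_continuous sphi; have cpsi := smooth_continuous spsi.
have [N1 N1p b1] := spacetime_le_weight r0 cpsi psir.
have [N2 N2p b2] := spacetime_le_weight r0 cphi phir.
have [N3 N3p b3] := second_derivatives_le_weight tphi.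
pose N := N1 + N2 + N3.
have wl (a : R) x : a <= N -> a * weight 2 x <= N * weight 2 x.
  by move=> aN; rewrite ler_wpM2r// ltW// weight_gt0.
have phiN t x : `|psi (t, x)| <= N * weight 2 x.
  by apply: (le_trans (b1 t x)); apply: wl; rewrite /N; lra.
have phiN' t x : `|phi (t, x)| <= N * weight 2 x.
  by apply: (le_trans (b2 t x)); apply: wl; rewrite /N; lra.
have grN k l t x : `|gradperp l (partial k (fun x => phi (t, x))) x| <= N * weight 2 x.
  by apply: (le_trans (b3 k l t x)); apply: wl; rewrite /N; lra.
have iw : L1 (weight (2 : R)) by apply: L1_weight; rewrite ltr1n.
pose Q := N * \int[leb2]_x weight 2 x.
have QE : Q = \int[leb2]_x (N * weight 2 x) by rewrite (RintegralZl N measurableT iw).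
have leQ (f : R * R -> R) : meas2 f -> (forall x, `|f x| <= N * weight 2 x) ->
    L1 f /\ \int[leb2]_x `|f x| <= Q.
  move=> mf fN; have i1 := integrable_dominated (L1Z N iw) mf fN; split=> //.
  by rewrite QE; exact: (le_Rintegral measurableT (L1_norm i1) (L1Z N iw) (fun x _ => fN x)).
have slice_phi t := leQ _ (continuous_meas2 (spacetime_slice_continuous (t := t) cphi)) (phiN' t).
have slice_psi t := leQ _ (continuous_meas2 (spacetime_slice_continuous (t := t) cpsi)) (phiN t).
have test_phi t : test (fun x => phi (t, x)).
  exact: test_of_supp (smooth_slice t sphi) (spacetime_supp_space t phir).
have en0 n : 0 < n.+1%:R^-1 :> R by rewrite invr_gt0.
(* The inverse of an inverse is the form in which [cutoff_scale] provides the
   scale [e = 1/(n+1)]. *)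
pose th n : R * R -> R := fun x => theta ((n.+1%:R^-1)^-1 *: x).
have cthn n : cutoff (th n) := cutoff_scale (en0 n) cth.
have massE n : cut_mass (th n) i = n.+1%:R^-1 * cut_mass theta i.
  exact: (cut_biot_savart_scale i (en0 n) cth).
have mfl n := measurable_flux sol B0 (cthn n) i.
have bfl n := flux_bound sol B0 (cthn n) i.
pose h n t := \int[leb2]_x (flux u B (th n) i t x * phi (t, x)).
pose L t := leray_div theta (tensor (u t)) i (fun x => phi (t, x)).
have fun_phi_L1 n t : L1 (fun x => flux u B (th n) i t x * phi (t, x)).
  exact: (integrable_bounded_mul (slice_phi t).1 (meas2_flux sol B0 (cthn n) i t) (bfl n t)).
have ih n : mu.-integrable setT (EFin \o (fun t => ind T t * h n t)).
  have := Rfubini_integrable1 (spacetime_integrable r0 rT phiN (mfl n) cphi phiN' (fun t x _ => bfl n t x)).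
  congr (mu.-integrable setT (EFin \o _)); apply/funext => t /=.
  by rewrite -[RHS](RintegralZl _ measurableT (fun_phi_L1 n t)).
have hL : \int[mu]_t (ind T t * h n t) @[n --> \oo] --> \int[mu]_t (ind T t * L t).
  apply: (Rcvg_window (K := B ^+ 2 * (\sum_(k < 2) \sum_(l < 2) Q) * cut_mass theta i)
    (M := B ^+ 2 * kerM_mass (th 0%N) i * Q)).
  - by move=> n; exact: integrable_measurable (ih n).
  - move=> n t /andP[t0 _].
    have gQ k l : \int[leb2]_x `|gradperp l (partial k (fun x => phi (t, x))) x| <= Q.
      have sk := smooth_derive (edir k) (smooth_slice t sphi).
      have sg := smooth_derive (edir (pidx l)) sk.
      apply: (leQ _ _ (grN k l t)).2; rewrite gradperpE.
      by apply: measurable_funM; [exact: measurable_cst|exact: continuous_meas2 (smooth_continuous sg)].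
    apply: (le_trans (flux_leray_error i cth (cthn n) t0 (test_phi t) gQ)).
    by rewrite massE mulrCA mulrC.
  - move=> t _; have C0 : 0 <= B ^+ 2 * kerM_mass (th 0%N) i := le_trans (normr_ge0 _) (bfl 0%N 0 0).
    apply: (le_trans _ (ler_wpM2l C0 (slice_phi t).2)).
    rewrite -[leRHS](RintegralZl _ measurableT (L1_norm (slice_phi t).1)).
    apply: le_norm_Rintegral2.
    + by apply: L1Z; exact: L1_norm (slice_phi t).1.
    + exact: L1_measurable (fun_phi_L1 0%N t).
    + by move=> x; rewrite normrM ler_wpM2r//; exact: bfl.
pose v0 := vel u B 0 i.
have mv0 : meas2 v0 := meas2_vel sol B 0 i.
have bv0 x : `|v0 x| <= B := vel_bound u B0 0 i x.
pose J n := primitive (flux u B (th n) i).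
have mJ n := measurable_primitive (mfl n) (bfl n).
have bJ n t x : 0 <= t <= T -> `|J n t x| <= B ^+ 2 * kerM_mass (th n) i * T.
  by move=> tT; exact: (primitive_on_window (mfl n) (bfl n) x tT).
(* [a - b n] is the velocity of [p] up to the vorticity term of cut-off [th n]. *)
pose a t := \int[leb2]_x (v0 x * psi (t, x)).
pose b n t := \int[leb2]_x (J n t x * psi (t, x)).
pose p t := \int[leb2]_x (cpnt i (u t x) * psi (t, x)).
have v0L1 t : L1 (fun x => v0 x * psi (t, x)).
  exact: (integrable_bounded_mul (slice_psi t).1 mv0 bv0).
have JL1 n t : L1 (fun x => J n t x * psi (t, x)).
  exact: (integrable_bounded_mul (slice_psi t).1 (meas2_primitive (mfl n) (bfl n) t)
    (primitive_bound_abs (mfl n) (bfl n) t)).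
have ia : mu.-integrable setT (EFin \o (fun t => ind T t * a t)).
  have mv2 : meas3 (fun q : R * (R * R) => v0 q.2) by exact: (measurableT_comp mv0 measurable_snd).
  have := Rfubini_integrable1 (spacetime_integrable (k := fun _ => v0) r0 rT phiN mv2 cpsi phiN
    (fun t x _ => bv0 x)).
  congr (mu.-integrable setT (EFin \o _)); apply/funext => t /=.
  by rewrite -[RHS](RintegralZl _ measurableT (v0L1 t)).
have ib n : mu.-integrable setT (EFin \o (fun t => ind T t * b n t)).
  have := Rfubini_integrable1 (spacetime_integrable r0 rT phiN (mJ n) cpsi phiN (bJ n)).
  congr (mu.-integrable setT (EFin \o _)); apply/funext => t /=.
  by rewrite -[RHS](RintegralZl _ measurableT (JL1 n t)).
have aE : \int[mu]_t (ind T t * a t) = - \int[leb2]_x (v0 x * phi (0, x)).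
  exact: (initial_parts sphi r0 phir rT phiN phiN' mv0 bv0).
have bE n : \int[mu]_t (ind T t * b n t) = - \int[mu]_t (ind T t * h n t).
  exact: (flow_parts (mfl n) (bfl n) sphi r0 phir rT phiN phiN').
have iab n : mu.-integrable setT (EFin \o (fun t => ind T t * (a t - b n t))).
  have := @integrableB _ _ _ mu setT measurableT _ _ ia (ib n).
  congr (mu.-integrable setT _); apply/funext => t /=.
  by rewrite -EFinB mulrBr.
have abE n : \int[mu]_t (ind T t * (a t - b n t)) =
    - (\int[leb2]_x (v0 x * phi (0, x))) + \int[mu]_t (ind T t * h n t).
  rewrite -aE -[X in _ = _ + X]opprK -bE -(RintegralB measurableT ia (ib n)).
  by apply: eq_Rintegral => t _; rewrite mulrBr.
have a_sub_b_near_p n t : 0 <= t -> `|(a t - b n t) - p t| <=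
    (B + B) * cut_mass (th n) i * Q.
  move=> t0; pose f y := vort w B t y - vort w B 0 y.
  have mf : meas2 f by apply: measurable_funB; exact: (meas2_vort sol).
  have bf y : `|f y| <= B + B.
    by apply: (le_trans (ler_normB _ _)); apply: lerD; exact: vort_bound.
  have ik := L1_cut_biot_savart (cthn n) i.
  pose c := convol (th n \* biot_savart i) f.
  have mc : meas2 c.
    apply: (@convol_measurable _ _ _ (B + B) (weight 2)) => //.
    by move=> z; exact: weight_gt0.
  have cL1 : L1 (fun x => c x * psi (t, x)) := convol_mul_L1 ik mf bf (slice_psi t).1.
  have mpsi := continuous_meas2 (spacetime_slice_continuous (t := t) cpsi).
  have -> : p t = a t + \int[leb2]_x (c x * psi (t, x)) - b n t.
    rewrite /a /b -(RintegralD measurableT (v0L1 t) cL1).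
    rewrite -(RintegralB measurableT (L1D (v0L1 t) cL1) (JL1 n t)).
    apply: eq_Rintegral_ae.
    - by apply: measurable_funM => //; exact: (meas2_velocity sol).
    - exact: L1_measurable (L1B (L1D (v0L1 t) cL1) (JL1 n t)).
    - have := aeI (vel_ae uwB t0) (serfati_vel sol uwB (cthn n) i t0).
      apply: filterS_ae => x [hx hs]; rewrite -(hx i).
      have -> : vel u B t i x = v0 x + c x - J n t x.
        by rewrite /v0 /c /J /primitive -addrA -hs addrC subrK.
      by rewrite mulrBl mulrDl.
  have -> : a t - b n t - (a t + \int[leb2]_x (c x * psi (t, x)) - b n t) =
      - \int[leb2]_x (c x * psi (t, x)).
    by move: (a t) (b n t) (\int[leb2]_x _) => a1 b1' c1; ring.
  by rewrite normrN; exact: (pairing_bound ik mf bf (slice_psi t).1 (slice_psi t).2).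
have pL : \int[mu]_t (ind T t * (a t - b n t)) @[n --> \oo] --> \int[mu]_t (ind T t * p t).
  apply: (Rcvg_window (K := (B + B) * cut_mass theta i * Q)
    (M := B * Q + B ^+ 2 * kerM_mass (th 0%N) i * T * Q)).
  - by move=> n; exact: integrable_measurable (iab n).
  - move=> n t /andP[t0 _]; apply: (le_trans (a_sub_b_near_p n t t0)).
    by rewrite massE; move: (n.+1%:R^-1 : R) => e; rewrite le_eqVlt; apply/orP; left; apply/eqP; ring.
  - move=> t tT; have field_bound (f : R * R -> R) (K : R) : 0 <= K ->
        L1 (fun x => f x * psi (t, x)) -> (forall x, `|f x| <= K) ->
        `|\int[leb2]_x (f x * psi (t, x))| <= K * Q.
      move=> K0 if_ fK; apply: (le_trans _ (ler_wpM2l K0 (slice_psi t).2)).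
      rewrite -[leRHS](RintegralZl _ measurableT (L1_norm (slice_psi t).1)).
      apply: le_norm_Rintegral2.
      + by apply: L1Z; exact: L1_norm (slice_psi t).1.
      + exact: L1_measurable if_.
      + by move=> x; rewrite normrM ler_wpM2r.
    apply: (le_trans (ler_normB _ _)); apply: lerD.
      exact: (field_bound v0 B (ltW B0) (v0L1 t) bv0).
    have K0 := le_trans (normr_ge0 _) (bJ 0%N t 0 tT).
    exact: (field_bound (J 0%N t) _ K0 (JL1 0%N t) (fun x => bJ 0%N t x tT)).
(* Both members are the limit of the integrals of [a - b n]. *)
have pE : \int[mu]_t (ind T t * p t) =
    - (\int[leb2]_x (v0 x * phi (0, x))) + \int[mu]_t (ind T t * L t).
  apply: (Rcvg_unique pL); under eq_fun do rewrite abE.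
  by apply: cvgD; [exact: cvg_cst|exact: hL].
have psiT t x : T < t -> psi (t, x) = 0.
  by move=> Tt; apply: spacetime_supp_time psir _; rewrite gtr0_norm (lt_trans _ Tt).
have phiT t x : T < t -> phi (t, x) = 0.
  by move=> Tt; apply: spacetime_supp_time phir _; rewrite gtr0_norm (lt_trans _ Tt).
have LT t : T < t -> L t = 0 by move=> Tt; apply: leray_div0 => x; exact: phiT.
have pT t : T < t -> p t = 0.
  by move=> Tt; apply: Rintegral_eq0 => x; rewrite psiT// mulr0.
have -> : dderive dir_t (spacetime_dist (fun t => cpnt i \o u t)) phi =
    - \int[mu]_(t in `[0, +oo[) p t by [].
have LH := Rintegral_halfline LT.
rewrite [X in - X + _](Rintegral_halfline pT) [X in _ + X]LH pE opprD opprK subrK.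
apply: eq_Rintegral_ae.
- by apply: measurable_funM => //; exact: continuous_meas2 (spacetime_slice_continuous (t := 0) cphi).
- apply: measurable_funM; first exact: (meas2_velocity sol).
  exact: continuous_meas2 (spacetime_slice_continuous (t := 0) cphi).
- by have := vel_ae uwB (lexx 0); apply: filterS_ae => x hx; rewrite /v0 hx.
Qed.

End Test.

Lemma bounded_weak_solution_of_serfati : bounded_weak_solution (u 0) u.
Proof.
have in0 := (serfati_C0 sol).1.
split.
- exact: in0.
- by move=> t t0; exact: (in0 t t0).1.
- apply: (@le_lt_trans _ _ B%:E); last exact: ltry.
  apply: ge_ereal_sup => _ [t /= + <-]; rewrite in_itv /= andbT => t0.
  by apply/linf_normP; exact: (uwB t0).1.
move=> theta cth phi tphi.
have i0 l : L1 (fun x => cpnt l (u 0 x) * phi l (0, x)).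
  have [sp [r r0 pr]] := test_supp (tphi l).
  have cs := spacetime_slice_continuous (t := 0) (smooth_continuous sp).
  have ip := supp_L1 cs (spacetime_supp_space 0 pr).
  have := integrable_mul_bounded ip (meas2_vel sol B 0 l) (vel_bound u B0 0 l).
  move=> iv; apply: (L1_ae_eq iv).
    apply: measurable_funM; [exact: (meas2_velocity sol)|exact: continuous_meas2].
  by have := vel_ae uwB (lexx 0); apply: filterS_ae => x hx; rewrite hx mulrC.
transitivity (\sum_(l < 2) \int[leb2]_x (cpnt l (u 0 x) * phi l (0, x))).
  by apply: eq_bigr => l _; exact: (velocity_weak_equation l cth (tphi l)).
rewrite [LHS]sum_ord2.
rewrite -(RintegralD measurableT (i0 0) (i0 1)); apply: eq_Rintegral => x _.
by rewrite sum_ord2.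
Qed.

End WeakSolution.

Theorem theorem46 (R : realType) (chi : R * R -> R)
    (chi_symbol : lowpass_symbol chi)
    (u : R -> R * R -> R * R)
    (u_serfati : serfati_solution u) :
  (forall t : R, 0 <= t ->
     exists g : R -> R * R -> R * R,
       (forall lambda : R, 0 < lambda ->
          is_lowpass chi lambda (u t \- u 0) (g lambda)) /\
       (forall alpha : R, alpha < 1 ->
          exists C : R, \forall lambda \near +oo_R,
            (linf_norm (g lambda) <= (C * (1 / (lambda `^ alpha)))%:E)%E)) /\
  bounded_weak_solution (u 0) u.
Proof.
have [w sol] := u_serfati; have [B B0 uwB] := data_bound sol.
split; last exact: (bounded_weak_solution_of_serfati sol B0 uwB).
by move=> t t0; exact: (lowpass_increment_decay sol B0 uwB chi_symbol t0).
Qed.
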